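(* Let $N\ge1$ and $0<\theta\le2$, and consider the problem $$\partial_t u+(-\Delta)^{\frac{\theta}{2}}u=u^p+\mu,\quad x\in{\bf R}^N,\ t>0,\qquad u(0)=0\ \mbox{ in }{\bf R}^N. \qquad (P)$$ (1) Let $1<p\le p_*$ (with $p<\infty$) and let $\mu\not\equiv0$ in ${\bf R}^N$. Then problem $(P)$ possesses no global-in-time solutions. (2) Let $p_*<p<\infty$ and let $\mu$ be a nonnegative measurable function in ${\bf R}^N$. Then there exists $\gamma=\gamma(N,\theta,p)>0$, depending only on $N,\theta,p$, with the following property: if there exists $R>0$ such that $$\mu(x)\ge\gamma|x|^{-\frac{\theta p}{p-1}}$$ for almost all $x\in{\bf R}^N\setminus B(0,R)$, then problem $(P)$ possesses no global-in-time solutions.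
   Context: $\mu$ is a nonnegative Radon measure in ${\bf R}^N$ or a nonnegative measurable function in ${\bf R}^N$; in the latter case it is identified with the measure $\mu(x)\,dx$ ($\mu\not\equiv 0$ means it is not the zero measure). $(-\Delta)^{\theta/2}$ is the fractional power of $-\Delta$ in ${\bf R}^N$ (Fourier symbol $|\xi|^\theta$). $B(x,\sigma)=\{y\in{\bf R}^N: |x-y|<\sigma\}$. $p_*:=N/(N-\theta)$ if $0<\theta<N$, and $p_*:=\infty$ if $\theta\ge N$. Definition of solution: let $0<T\le\infty$ and let $u$ be a nonnegative measurable function in ${\bf R}^N\times(0,T)$. Then $u$ is a solution to $(P)$ in ${\bf R}^N\times[0,T)$ if $$\int_0^T\int_{{\bf R}^N}u\,(-\partial_t\varphi+(-\Delta)^{\frac{\theta}{2}}\varphi)\,dx\,dt=\int_0^T\int_{{\bf R}^N}u^p\varphi\,dx\,dt+\int_0^T\int_{{\bf R}^N}\varphi\,d\mu(x)\,dt$$ for all $\varphi\in C_0^\infty({\bf R}^N\times[0,T))$ (smooth functions with compact support in ${\bf R}^N\times[0,T)$, not required to vanish at $t=0$), where all integrals are understood to be well defined and finite. A global-in-time solution is a solution in ${\bf R}^N\times[0,\infty)$. *)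

(* Defs.v *)
From HB Require Import structures.
From mathcomp Require Import all_boot all_order all_algebra.
From mathcomp Require Import all_classical all_reals all_analysis.

Set Implicit Arguments.
Unset Strict Implicit.
Unset Printing Implicit Defensive.
Import Order.TTheory GRing.Theory Num.Theory.
Import numFieldNormedType.Exports.

Local Open Scope classical_set_scope.
Local Open Scope ring_scope.

(* R^n is 'rV[R]_n, with the library's topology and normed module structure
   (the latter for the sup norm, which is only used through its topology) and
   with the product of n copies of the Borel sigma-algebra of R, i.e. the
   Borel sigma-algebra of R^n. *)
Section measurable_rV.
Context {R : realType}.

Definition rV_coord n (i : 'I_n) (x : 'rV[R]_n) : R := x ord0 i.

Section structure.
Variable n : nat.

Let rV_set0 : g_sigma_preimage (@rV_coord n) set0.
Proof. exact: sigma_algebra0. Qed.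

Let rV_setC A :
  g_sigma_preimage (@rV_coord n) A -> g_sigma_preimage (@rV_coord n) (~` A).
Proof. exact: sigma_algebraC. Qed.

Let rV_bigcup (F : (set 'rV[R]_n)^nat) :
  (forall i, g_sigma_preimage (@rV_coord n) (F i)) ->
  g_sigma_preimage (@rV_coord n) (\bigcup_i (F i)).
Proof. exact: sigma_algebra_bigcup. Qed.

HB.instance Definition _ :=
  @isMeasurable.Build (measure_tuple_display default_measure_display)
    'rV[R]_n (g_sigma_preimage (@rV_coord n)) rV_set0 rV_setC rV_bigcup.

End structure.

Lemma measurable_rV_coord n (i : 'I_n) :
  measurable_fun [set: 'rV[R]_n] (rV_coord i).
Proof.
move=> _ Y mY; rewrite setTI; apply: sub_sigma_algebra => /=.
rewrite -bigcup_seq/=; exists i => /=; first by rewrite mem_index_enum.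
by exists Y => //; rewrite setTI.
Qed.

Lemma measurable_fun_rV d (T : measurableType d) n (f : T -> 'rV[R]_n) :
  (forall i, measurable_fun [set: T] (rV_coord i \o f)) ->
  measurable_fun [set: T] f.
Proof.
move=> mf.
have sub : g_sigma_preimage (fun i => @rV_coord n i \o f) `<=` measurable.
  apply: smallest_sub; first exact: sigma_algebra_measurable.
  rewrite -bigcup_seq; apply: bigcup_sub => i _.
  by move=> A [B mB <-]; exact: mf.
move: sub; rewrite g_sigma_preimage_comp => sub _ A mA.
by apply: sub; exists A.
Qed.

End measurable_rV.

Section lebesgue_rV.
Context {R : realType}.

Definition rV_cons n (z : measurableTypeR R * 'rV[R]_n) : 'rV[R]_n.+1 :=
  row_mx (z.1 : R)%:M z.2 : 'rV[R]_(1 + n).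

Definition rV_uncons n (x : 'rV[R]_n.+1) : measurableTypeR R * 'rV[R]_n :=
  (x ord0 ord0, @rsubmx R 1 1 n x).

Lemma rV_consEl n z (j : 'I_1) : @rV_cons n z ord0 (@lshift 1 n j) = z.1.
Proof. by rewrite /rV_cons (row_mxEl (z.1 : R)%:M z.2) !ord1 mxE mulr1n. Qed.

Lemma rV_consEr n z (j : 'I_n) :
  @rV_cons n z ord0 (@rshift 1 n j) = z.2 ord0 j.
Proof. by rewrite /rV_cons (row_mxEr (z.1 : R)%:M z.2). Qed.

Lemma rV_consK n : cancel (@rV_cons n) (@rV_uncons n).
Proof.
move=> [a x]; congr pair; last exact: row_mxKr.
have -> : (ord0 : 'I_n.+1) = @lshift 1 n ord0 by exact: val_inj.
exact: rV_consEl.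
Qed.

Lemma measurable_rV_cons n : measurable_fun setT (@rV_cons n).
Proof.
apply: measurable_fun_rV => i; rewrite /comp /rV_coord.
case: (@split_ordP 1 n i) => j ->.
- by under eq_fun do rewrite rV_consEl; exact: measurable_fst.
- under eq_fun do rewrite rV_consEr.
  exact: (measurableT_comp (measurable_rV_coord j) measurable_snd).
Qed.

Lemma measurable_rV_uncons n : measurable_fun setT (@rV_uncons n).
Proof.
apply/measurable_fun_pair; first exact: (measurable_rV_coord ord0).
apply: measurable_fun_rV => i; rewrite /comp /rV_coord /=.
under eq_fun do rewrite mxE.
exact: (measurable_rV_coord (rshift 1 i)).
Qed.

Section step.
Variables (n : nat) (m : {sigma_finite_measure set 'rV[R]_n -> \bar R}).

Definition lebesgue_rV_step : set 'rV[R]_n.+1 -> \bar R :=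
  pushforward (@lebesgue_measure R \x m)%E (@rV_cons n).

Let pushforward_rV_cons : {measure set 'rV[R]_n.+1 -> \bar R} :=
  measure_function_pushforward__canonical__measure_function_Measure
    (@lebesgue_measure R \x m)%E (@measurable_rV_cons n).

HB.instance Definition _ := isMeasure.Build _ _ _ lebesgue_rV_step
  (measure0 pushforward_rV_cons) (measure_ge0 pushforward_rV_cons)
  (@measure_semi_sigma_additive _ _ _ pushforward_rV_cons).

Let lebesgue_rV_step_sigma_finite : sigma_finite setT lebesgue_rV_step.
Proof.
have /sigma_finiteP[F [TF ndF Foo]] := sigma_finiteT (@lebesgue_measure R).
have /sigma_finiteP[G [TG ndG Goo]] := sigma_finiteT m.
exists (fun k => @rV_uncons n @^-1` (F k `*` G k)).
  rewrite -preimage_bigcup; apply/esym/seteqP; split => // x _ /=.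
  have [k _ Fk] : (\bigcup_k F k) (rV_uncons x).1 by rewrite -TF.
  have [l _ Gl] : (\bigcup_k G k) (rV_uncons x).2 by rewrite -TG.
  exists (maxn k l) => //; split.
  - by move: Fk; exact/subsetPset/ndF/leq_maxl.
  - by move: Gl; exact/subsetPset/ndG/leq_maxr.
move=> k; have [mF Fk] := Foo k; have [mG Gk] := Goo k; split.
  rewrite -[X in measurable X]setTI; apply: measurable_rV_uncons => //.
  exact: measurableX.
rewrite /lebesgue_rV_step /pushforward -comp_preimage.
suff -> : @rV_uncons n \o @rV_cons n = id
  by rewrite preimage_id product_measure1E// lte_mul_pinfty// ge0_fin_numE.
by apply/funext => z /=; rewrite rV_consK.
Qed.

HB.instance Definition _ :=
  Measure_isSigmaFinite.Build _ _ _ lebesgue_rV_step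
    lebesgue_rV_step_sigma_finite.

End step.

(* Lebesgue measure on the Borel sets of R^n. *)
Fixpoint lebesgue_rV n : {sigma_finite_measure set 'rV[R]_n -> \bar R} :=
  if n is k.+1 then lebesgue_rV_step (lebesgue_rV k)
  else \d_(0 : 'rV[R]_0).

End lebesgue_rV.

(* The completions of the Lebesgue measures on R^n and R^n x R: they are
   defined on the Lebesgue measurable sets (caratheodory_type). *)
Definition Lebesgue_rV {R : realType} (n : nat) :=
  @completed_measure_extension _ _ _ (@lebesgue_rV R n).
HB.instance Definition _ (R : realType) n := Measure.on (@Lebesgue_rV R n).

Definition Lebesgue_space_time {R : realType} (n : nat) :=
  @completed_measure_extension _ _ _
    (@lebesgue_rV R n \x @lebesgue_measure R)%E.
HB.instance Definition _ (R : realType) n :=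
  Measure.on (@Lebesgue_space_time R n).

Section problem.
Context {R : realType} {N : nat}.
Implicit Types (x y xi : 'rV[R]_N) (z : 'rV[R]_N * R) (T : \bar R).

Definition dotrV x y : R := \sum_(i < N) x ord0 i * y ord0 i.

(* Euclidean norm: the norm `|x| of 'rV[R]_N is the sup norm. *)
Definition enorm x : R := Num.sqrt (dotrV x x).

(* Real and imaginary parts of \int f(y) e^(-i y.xi) dy. *)
Definition fourier_re (f : 'rV[R]_N -> R) xi : R :=
  \int[lebesgue_rV N]_y (f y * cos (dotrV y xi)).
Definition fourier_im (f : 'rV[R]_N -> R) xi : R :=
  - \int[lebesgue_rV N]_y (f y * sin (dotrV y xi)).

(* (-Delta)^(theta/2) f, the Fourier multiplier of symbol |xi|^theta:
   (2 pi)^(-N) \int |xi|^theta \hat f(xi) e^(i x.xi) dxi; only the real part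
   of the integrand is kept, its imaginary part being odd in xi for real f. *)
Definition frac_laplacian (theta : R) (f : 'rV[R]_N -> R) x : R :=
  (2 * pi) ^- N * \int[lebesgue_rV N]_xi (enorm xi `^ theta *
    (fourier_re f xi * cos (dotrV x xi) - fourier_im f xi * sin (dotrV x xi))).

(* C^infinity: all iterated directional derivatives are differentiable. *)
Definition smooth (V : normedModType R) (f : V -> R) : Prop :=
  forall (vs : seq V) (a : V),
    differentiable (foldr (fun v (g : V -> R) => 'D_v g) f vs) a.

(* C_0^infinity(R^N x [0, T)), as the restrictions to t >= 0 of the smooth
   functions with compact support in R^N x (-oo, T); no condition at t = 0. *)
Definition test_function T (phi : 'rV[R]_N * R -> R) : Prop :=
  let supp := closure [set z | phi z != 0] in
  [/\ smooth phi, compact supp & supp `<=` [set z | (z.2%:E < T)%E]].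

(* R^N x (0, T) *)
Definition space_time T : set ('rV[R]_N * R) :=
  [set z | 0 < z.2 /\ (z.2%:E < T)%E].

(* - d_t phi + (-Delta)^(theta/2) phi *)
Definition adjoint_operator (theta : R) (phi : 'rV[R]_N * R -> R) z : R :=
  - derive1 (fun t => phi (z.1, t)) z.2
  + frac_laplacian theta (fun x => phi (x, z.2)) z.1.

(* u is a solution of
     d_t u + (-Delta)^(theta/2) u = u^p + mu,  u(0) = 0,  in R^N x [0, T).
   Only the values of u on R^N x (0, T) matter. *)
Definition is_solution (theta p : R) (mu : {measure set 'rV[R]_N -> \bar R})
    T (u : 'rV[R]_N * R -> R) : Prop :=
  let lambda := @Lebesgue_space_time R N in
  let D := space_time T in
  [/\ forall z, D z -> 0 <= u z,
      measurable_fun (D : set (caratheodory_type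
        ((@lebesgue_rV R N \x @lebesgue_measure R)%E^*)%mu)) u
    & forall phi, test_function T phi ->
      [/\ lambda.-integrable D
            (fun z => (u z * adjoint_operator theta phi z)%:E),
          lambda.-integrable D (fun z => (u z `^ p * phi z)%:E),
          (mu \x @lebesgue_measure R)%E.-integrable D (fun z => (phi z)%:E)
        & \int[lambda]_(z in D) (u z * adjoint_operator theta phi z) =
          \int[lambda]_(z in D) (u z `^ p * phi z) +
          \int[(mu \x @lebesgue_measure R)%E]_(z in D) phi z]].

Definition has_global_solution (theta p : R)
    (mu : {measure set 'rV[R]_N -> \bar R}) : Prop :=
  exists u, is_solution theta p mu +oo%E u.

(* Regularity is automatic for locally finite Borel measures on R^N. *)
Definition radon_measure (mu : {measure set 'rV[R]_N -> \bar R}) : Prop :=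
  forall K : set 'rV[R]_N, compact K -> (mu K < +oo)%E.

(* mu = f(x) dx, for a nonnegative Lebesgue measurable function f. *)
Definition has_density (f : 'rV[R]_N -> R)
    (mu : {measure set 'rV[R]_N -> \bar R}) : Prop :=
  [/\ forall x, 0 <= f x,
      measurable_fun
        ([set: 'rV[R]_N] : set (caratheodory_type ((@lebesgue_rV R N)^*)%mu)) f
    & forall A : set 'rV[R]_N, measurable A ->
        mu A = (\int[@Lebesgue_rV R N]_(x in A) (f x)%:E)%E].

End problem.

Definition p_star {R : realType} (N : nat) (theta : R) : \bar R :=
  if theta < N%:R then (N%:R / (N%:R - theta))%:E else +oo%E.

(* Main.v *)
(** Test the equation with powers of cutoffs [phi = Phi^(l+2)], where [Phi] is a
    product of one-dimensional bumps at spatial scale [r] and time scale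
    [T >= r^theta].  The fractional Laplacian is subordinate to the heat flow,
    which is an average in each coordinate, so Jensen's inequality gives
    [adj phi <= C r^(-theta) Phi^(l+1)] for the adjoint operator [adj].  Young's
    inequality absorbs [u * adj phi] into [u^p * phi] and leaves, with
    [p' = p/(p-1)],
      [int u^p phi dx dt <= C T r^(N - theta p')],
      [mu [-r,r]^N <= C r^(N - theta p')].
    When [p > p_star], a density [gamma |x|^(-theta p')] with [gamma] large violates
    the second bound.  When [p <= p_star], that is [N <= theta p'], add up the
    identities tested at the scales [r 2^k], [k < n], with the same [T = (r 2^n)^theta]:
    the source contributes [n T mu [-r,r]^N], whereas by geometric summation
    the left side is at most [C T (e + n e^(-1/(p-1)))] for every [e > 0].  A large
    [e] followed by [n -> oo] forces [mu [-r,r]^N = 0]. *)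

Require Import Defs.
From HB Require Import structures.
From mathcomp Require Import all_boot all_order all_algebra.
From mathcomp Require Import all_classical all_reals all_analysis.
From mathcomp Require Import measurable_realfun.
From mathcomp Require Import ring lra.
Set Implicit Arguments.
Unset Strict Implicit.
Unset Printing Implicit Defensive.
Import Order.TTheory GRing.Theory Num.Theory.
Import numFieldNormedType.Exports.
Local Open Scope classical_set_scope.
Local Open Scope ring_scope.

(** The fractional Laplacian is given by Fourier integrals, on which pointwise signs are invisible;
    hence the detour by the heat flow, whose kernel is positive, and hence cutoffs that are products
    of even functions: their transforms are real, factor into one-dimensional cosine transforms and
    scale explicitly. The power [l] is chosen with [l+1 >= s = 1/(p-1)], that is [(l+2)/p <= l+1],
    so that Young's inequality leaves no negative power of the cutoff. The condition [T >= r^theta]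
    makes the time derivative, of size [1/T], no larger than [r^(-theta)]. At [p = p_star] the
    exponent [N - theta p'] is zero, so a single scale shows only that [mu] has finite mass. Several
    scales gain a logarithm: the source counts [n] times, whereas the coefficients [r_k^(-theta)]
    form a geometric series. At each point the sum of the bounds on the adjoint terms is therefore
    comparable with its largest term, and one integral of [u^p], at the largest scale, pays for all
    of them. *)

(** * Integration and differentiation rules for real-valued functions *)

Lemma Rintegral_dominated_cvg d (T : measurableType d) (R : realType)
    (mu : {measure set T -> \bar R}) (D : set T) (f_ : nat -> T -> R)
    (f g : T -> R) :
  measurable D -> (forall n, measurable_fun D (f_ n)) ->
  (forall x, D x -> f_ ^~ x @ \oo --> f x) ->
  mu.-integrable D (EFin \o g) ->
  (forall n x, D x -> `|f_ n x| <= g x) ->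
  mu.-integrable D (EFin \o f) /\
  \int[mu]_(x in D) f_ n x @[n --> \oo] --> \int[mu]_(x in D) f x.
Proof.
move=> mD mf_ f_f ig fg.
have mf : measurable_fun D f by exact: (measurable_fun_cvg mf_).
have [] := @dominated_convergence _ _ _ mu D mD
  (fun n => EFin \o f_ n) (EFin \o f) (EFin \o g).
- by move=> n; exact/measurable_EFinP.
- exact/measurable_EFinP.
- by apply: aeW => x Dx; apply/cvg_EFin; [exact: nearW|exact: f_f].
- exact: ig.
- by apply: aeW => x n Dx; rewrite lee_fin fg.
move=> itf _ cvgf; split => //.
apply: fine_cvg; rewrite /Rintegral fineK//; exact: integrable_fin_num.
Qed.

Lemma le_integrableR d (T : measurableType d) (R : realType)
    (mu : {measure set T -> \bar R}) (D : set T) (f g : T -> R) :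
  measurable D -> measurable_fun D f -> (forall x, D x -> `|f x| <= g x) ->
  mu.-integrable D (EFin \o g) -> mu.-integrable D (EFin \o f).
Proof.
move=> mD mf fg; apply: le_integrable => //; first exact/measurable_EFinP.
move=> x Dx /=; rewrite lee_fin (le_trans (fg x Dx))//; exact: ler_norm.
Qed.

Section integrable_real.
Context d (T : measurableType d) (R : realType).
Variables (mu : {measure set T -> \bar R}) (D : set T).
Hypothesis mD : measurable D.
Implicit Types (f g : T -> R).

Lemma integrableRZ (c : R) f : mu.-integrable D (EFin \o f) ->
  mu.-integrable D (EFin \o (fun x => c * f x)).
Proof. exact: integrableZl. Qed.

Lemma integrableRD f g : mu.-integrable D (EFin \o f) ->
  mu.-integrable D (EFin \o g) ->
  mu.-integrable D (EFin \o (fun x => f x + g x)).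
Proof. exact: integrableD. Qed.

Lemma integrableRB f g : mu.-integrable D (EFin \o f) ->
  mu.-integrable D (EFin \o g) ->
  mu.-integrable D (EFin \o (fun x => f x - g x)).
Proof. exact: integrableB. Qed.

Lemma integrableR_measurable f : mu.-integrable D (EFin \o f) ->
  measurable_fun D f.
Proof. by move=> /integrableP[/measurable_EFinP]. Qed.

End integrable_real.

Section pointwise_derivatives.
Context {R : realType}.
Implicit Types (f g : R -> R) (x a b : R).

Lemma is_derive_mul f g x a b : is_derive x 1 f a -> is_derive x 1 g b ->
  is_derive x (1 : R) (fun y => f y * g y) (a * g x + f x * b).
Proof.
move=> df dg; apply: (is_derive_eq (is_deriveM df dg)).
by rewrite addrC; congr (_ + _); rewrite /GRing.scale/= mulrC.
Qed.

Lemma is_derive_comp f g x a b : is_derive (g x) 1 f a -> is_derive x 1 g b ->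
  is_derive x (1 : R) (fun y => f (g y)) (a * b).
Proof. exact: is_derive1_comp. Qed.

Lemma is_derive_mulc (c x : R) : is_derive x 1 (fun y => c * y) c.
Proof.
apply: (is_derive_eq (is_derive_mul (is_derive_cst c x 1) (is_derive_id x 1))).
by rewrite mul0r add0r mulr1.
Qed.

Lemma is_derive_scale (c : R) f x a : is_derive x 1 f a ->
  is_derive x (1 : R) (fun y => c * f y) (c * a).
Proof.
move=> df; apply: (is_derive_eq (is_derive_mul (is_derive_cst c x 1) df)).
by rewrite mul0r add0r.
Qed.

Lemma is_derive_pow f x a n : is_derive x 1 f a ->
  is_derive x (1 : R) (fun y => f y ^+ n.+1) (n.+1%:R * a * f x ^+ n).
Proof.
move=> df; elim: n => [|n IH].
  rewrite (_ : (fun y => _) = f); last by apply/funext => y; rewrite expr1.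
  by apply: (is_derive_eq df); rewrite expr0 mulr1 mul1r.
rewrite (_ : (fun y => _) = fun y => f y * f y ^+ n.+1); last first.
  by apply/funext => y; rewrite exprS.
apply: (is_derive_eq (is_derive_mul df IH)).
by rewrite !exprS -[n.+2%:R]natr1; ring.
Qed.

Lemma is_derive_continuous f (df : R -> R) :
  (forall x, is_derive x (1 : R) f (df x)) -> continuous f.
Proof.
by move=> dF x; apply/differentiable_continuous/derivable1_diffP; have [] := dF x.
Qed.

End pointwise_derivatives.

(** * Gaussians and the heat flow on the line *)
Section improper.
Context {R : realType}.
Local Notation mu := (@lebesgue_measure R).

Lemma Rintegral_itv_derive (G g : R -> R) (a b : R) : a < b ->
  (forall x, is_derive x (1 : R) G (g x)) -> continuous g ->
  \int[mu]_(x in `[a, b]) g x = G b - G a.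
Proof.
move=> ab dG cg.
have cG : continuous G := is_derive_continuous dG.
rewrite /Rintegral (@continuous_FTC2 R g G a b ab) //.
- exact: continuous_subspaceT.
- split.
  + by move=> x _; have [] := dG x.
  + exact/cvg_at_right_filter/cG.
  + exact/cvg_at_left_filter/cG.
- by move=> x _; rewrite derive1E; have [_ ->] := dG x.
Qed.

(** The fundamental theorem of calculus on [[-(n+1), n+1]], then dominated convergence of the
    truncated integrals. The index [n+1] keeps the interval nondegenerate. *)
Lemma Rintegral_derive_eq0 (G g : R -> R) :
  (forall x, is_derive x (1 : R) G (g x)) -> continuous g ->
  mu.-integrable setT (EFin \o g) ->
  (G n.+1%:R - G (- n.+1%:R)) @[n --> \oo] --> (0 : R) ->
  \int[mu]_x g x = 0.
Proof.
move=> dG cg ig G0.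
have mg : measurable_fun setT g by exact: continuous_measurable_fun.
have [|||||_ H] := @Rintegral_dominated_cvg _ _ R mu setT
  (fun n => g \_ `[- n.+1%:R, n.+1%:R]) g (fun x => `|g x|).
- exact: measurableT.
- move=> n; apply: (measurable_restrictT g _).1 => //.
  exact: measurable_funTS.
- move=> x _; apply/cvgrPdist_lt => e e0; near=> n.
  rewrite patchE mem_set ?subrr ?normr0//= in_itv/= -ler_norml.
  rewrite (@le_trans _ _ n%:R)// ?ler_nat//.
  near: n; exact: nbhs_infty_ger.
- exact: integrable_norm.
- by move=> n x _; rewrite patchE; case: ifP; rewrite ?normr0/=.
apply: (cvg_unique _ _ G0) => //.
rewrite (_ : (fun n => _) = (fun n : nat =>
  \int[mu]_x (g \_ `[- n.+1%:R, n.+1%:R]) x)) //.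
apply/funext => n; rewrite -Rintegral_mkcond (@Rintegral_itv_derive G)//.
by rewrite ltrNl (@lt_trans _ _ 0)// oppr_lt0.
Unshelve. all: end_near. Qed.

End improper.

Section gaussian_charfun.
Context {R : realType}.
Local Notation mu := (@lebesgue_measure R).

Lemma integrable_normal (s : R) :
  mu.-integrable setT (EFin \o normal_pdf 0 s).
Proof. exact: integrable_normal_pdf. Qed.

Lemma Rintegral_normal (s : R) : \int[mu]_x normal_pdf 0 s x = 1.
Proof. by rewrite /Rintegral integral_normal_pdf. Qed.

Lemma normal_pdf0E (s x : R) : s != 0 ->
  normal_pdf 0 s x = normal_peak s * expR (- (x ^+ 2 / (s ^+ 2 *+ 2))).
Proof.
by move=> s0; rewrite normal_pdfE// /normal_fun subr0 mulNr.
Qed.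

(** With [w = |x| / (2s)] the Gaussian is proportional to [exp (-2 w^2)]: one factor [exp (-w^2)]
    absorbs [w], the other is a Gaussian of deviation [sqrt 2 * s]. First moments thus have an
    integrable bound. *)
Lemma normal_pdf_moment (s x : R) : 0 < s ->
  `|x| * normal_pdf 0 s x <= 2 * Num.sqrt 2 * s * normal_pdf 0 (Num.sqrt 2 * s) x.
Proof.
move=> s0.
have r0 : 0 < Num.sqrt 2 :> R by rewrite sqrtr_gt0.
have r2 : Num.sqrt 2 ^+ 2 = 2 :> R by rewrite sqr_sqrtr.
have sN : s != 0 by rewrite gt_eqF.
rewrite !normal_pdf0E ?gt_eqF ?mulr_gt0//.
have -> : normal_peak (Num.sqrt 2 * s) = normal_peak s / Num.sqrt 2.
  rewrite /normal_peak exprMn r2 -!mulrA -mulrnAr sqrtrM// invfM mulrC.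
  by rewrite mulrnAr.
rewrite exprMn r2.
set P := normal_peak s; have P0 : 0 <= P by exact: normal_peak_ge0.
set w := `|x| / (2 * s).
have -> : x ^+ 2 / (s ^+ 2 *+ 2) = w ^+ 2 *+ 2.
  by rewrite /w exprMn real_normK ?num_real//; field.
have -> : x ^+ 2 / ((2 * s ^+ 2) *+ 2) = w ^+ 2.
  by rewrite /w exprMn real_normK ?num_real//; field.
have -> : `|x| = 2 * s * w by rewrite /w; field.
have w0 : 0 <= w by rewrite /w divr_ge0// mulr_ge0// ltW.
have -> : expR (- (w ^+ 2 *+ 2)) = expR (- w ^+ 2) * expR (- w ^+ 2).
  by rewrite -expRD mulr2n opprD.
have we : w * expR (- w ^+ 2) <= 1.
  rewrite expRN ler_pdivrMr ?expR_gt0// mul1r.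
  apply: le_trans (expR_ge1Dx _); nra.
have -> : 2 * Num.sqrt 2 * s * (P / Num.sqrt 2 * expR (- w ^+ 2)) =
  2 * s * P * expR (- w ^+ 2) * 1.
  by field; rewrite gt_eqF.
have -> : 2 * s * w * (P * (expR (- w ^+ 2) * expR (- w ^+ 2))) =
  2 * s * P * expR (- w ^+ 2) * (w * expR (- w ^+ 2)) by ring.
by apply: ler_wpM2l => //; rewrite !mulr_ge0 ?expR_ge0// ltW.
Qed.

Lemma is_derive_normal (s x : R) : s != 0 ->
  is_derive x (1 : R) (normal_pdf 0 s) (- (x / s ^+ 2) * normal_pdf 0 s x).
Proof.
move=> s0.
have -> : normal_pdf 0 s =
    fun y => normal_peak s * expR ((- (s ^+ 2 *+ 2)^-1 * y) * y).
  by apply/funext => y; rewrite normal_pdf0E//; congr (_ * expR _); ring.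
by apply: is_derive_eq; rewrite /GRing.scale/=; field.
Qed.

(** Differentiation under the integral and integration by parts give [F' = -s^2 t F], so
    [F t * exp (s^2 t^2 / 2)] is constant, equal to [F 0 = 1]. *)
Lemma charfun_normal (s z : R) : 0 < s ->
  \int[mu]_x (normal_pdf 0 s x * cos (z * x)) = expR (- (s ^+ 2 * z ^+ 2 / 2)).
Proof.
move=> s0; have sN : s != 0 by rewrite gt_eqF.
pose N := normal_pdf 0 s; pose f (t x : R) := N x * cos (t * x).
pose F t := \int[mu]_x f t x.
have mN : measurable_fun setT N by exact: measurable_normal_pdf.
have cN : continuous N by exact: continuous_normal_pdf.
have N0 x : 0 <= N x by exact: normal_pdf_ge0.
have cct (t : R) : continuous (fun x : R => cos (t * x)).
  apply: (@is_derive_continuous _ _ (fun x => - sin (t * x) * t)) => x.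
  by apply: is_derive_comp; exact: is_derive_mulc.
have cst (t : R) : continuous (fun x : R => sin (t * x)).
  apply: (@is_derive_continuous _ _ (fun x => cos (t * x) * t)) => x.
  by apply: is_derive_comp; exact: is_derive_mulc.
have intf t : mu.-integrable setT (EFin \o f t).
  apply: (@le_integrableR _ _ R mu setT _ N) => //.
  - by apply: measurable_funM => //; exact: continuous_measurable_fun.
  - by move=> x _; rewrite normrM ger0_norm// ler_piMr// cos_max.
  - exact: integrable_normal.
pose K x := 2 * Num.sqrt 2 * s * normal_pdf 0 (Num.sqrt 2 * s) x.
have iK : mu.-integrable setT (EFin \o K).
  by apply: integrableRZ => //; exact: integrable_normal.
have df t x : is_derive t (1 : R) (fun t => f t x) (- (x * N x) * sin (t * x)).
  rewrite /f; by apply: is_derive_eq; rewrite /GRing.scale/=; ring.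
have dF t : is_derive t (1 : R) F (\int[mu]_x (- (x * N x) * sin (t * x))).
  have tI : `]t - 1, t + 1[%classic t by rewrite /= in_itv/=; lra.
  have bnd x y : `]t - 1, t + 1[%classic x -> setT y ->
      `|partial1of2 f x y| <= K y.
    move=> _ _; rewrite partial1of2E; have [_ ->] := df x y.
    rewrite normrM normrN normrM (ger0_norm (N0 _)).
    apply: le_trans (normal_pdf_moment _ s0).
    by rewrite ler_piMr ?mulr_ge0// sin_max.
  have K0 y : 0 <= K y.
    by rewrite /K !mulr_ge0 ?normal_pdf_ge0 ?sqrtr_ge0// ltW.
  split.
    apply: (@derivable_under_integral R _ _ mu f setT measurableT t _ _ tI
      (fun x _ => intf x) _ K K0 iK bnd).
    by move=> x y _ _; have [] := df x y.
  rewrite -derive1E.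
  rewrite (@differentiation_under_integral R _ _ mu f setT measurableT t _ _ tI
      (fun x _ => intf x) _ K K0 iK bnd).
    by apply: eq_Rintegral => x _; rewrite partial1of2E; have [_ ->] := df t x.
  by move=> x y _ _; have [] := df x y.
have ibp t : \int[mu]_x (- (x * N x) * sin (t * x)) = - (s ^+ 2 * t) * F t.
  (* [G' = g] because [N' = -(x / s^2) N]; that the integral of [g] vanishes is the claim. *)
  pose G x := s ^+ 2 * (N x * sin (t * x)).
  pose g x := - (x * N x) * sin (t * x) + s ^+ 2 * t * f t x.
  have dG x : is_derive x (1 : R) G (g x).
    have dN := is_derive_normal x sN; rewrite -/N in dN.
    have dsin : is_derive x 1 (fun x => sin (t * x)) (cos (t * x) * t).
      by apply: is_derive_comp; exact: is_derive_mulc.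
    apply: (is_derive_eq (is_derive_scale (s ^+ 2) (is_derive_mul dN dsin))).
    by rewrite /g /f; field.
  have cxN : continuous (fun x : R => - (x * N x) * sin (t * x)).
    move=> x; apply: cvgM; last exact: cst.
    by apply: (@cvgN _ R^o); apply: cvgM => //; exact: cN.
  have i1 : mu.-integrable setT (EFin \o (fun x => - (x * N x) * sin (t * x))).
    apply: (@le_integrableR _ _ R mu setT _ K) => //.
      exact: continuous_measurable_fun.
    move=> x _; rewrite normrM normrN normrM (ger0_norm (N0 _)).
    apply: le_trans (normal_pdf_moment _ s0).
    by rewrite ler_piMr ?mulr_ge0// sin_max.
  have i2 : mu.-integrable setT (EFin \o (fun x => s ^+ 2 * t * f t x)).
    exact: integrableRZ.
  have : \int[mu]_x g x = 0.
    apply: (@Rintegral_derive_eq0 R G) => //.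
    - move=> x; apply: cvgD; first exact: cxN.
      apply: cvgM; first exact: cvg_cst.
      by apply: cvgM; [exact: cN|exact: cct].
    - exact: integrableRD.
    (* [|x| |G x|] is bounded, so the boundary terms are of order [1/(n+1)]. *)
    - pose C := s ^+ 2 * (2 * Num.sqrt 2 * s * normal_peak (Num.sqrt 2 * s)).
      have GC (x : R) : `|x| * `|G x| <= C.
        rewrite /G normrM ger0_norm ?sqr_ge0// /C mulrCA ler_wpM2l ?sqr_ge0//.
        rewrite normrM mulrA.
        apply: (@le_trans _ _ (`|x| * N x)).
          by rewrite ger0_norm// ler_piMr ?mulr_ge0// sin_max.
        apply: (le_trans (normal_pdf_moment _ s0)).
        by rewrite ler_wpM2l ?normal_pdf_ub ?gt_eqF ?mulr_ge0 ?mulr_gt0 ?sqrtr_gt0 ?ltW.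
      apply: norm_cvg0.
      apply: (@squeeze_cvgr _ _ _ _ (fun=> 0) (fun n => 2 * C * harmonic n)).
      + apply: nearW => n; rewrite normr_ge0/= /harmonic/=.
        rewrite ler_pdivlMr// (le_trans (ler_wpM2r _ (ler_normB _ _)))//.
        have := GC n.+1%:R; have := GC (- n.+1%:R).
        by rewrite normrN ger0_norm//; lra.
      + exact: cvg_cst.
      + by rewrite -(mulr0 (2 * C)); apply: cvgM; [exact: cvg_cst|exact: cvg_harmonic].
  rewrite RintegralD// RintegralZl//.
  by move/eqP; rewrite addr_eq0 => /eqP ->; rewrite mulNr.
pose Q t := F t * expR (s ^+ 2 / 2 * t * t).
have dQ (t : R) : is_derive t (1 : R) Q 0.
  have dFt := dF t; rewrite ibp in dFt.
  by apply: is_derive_eq; rewrite /GRing.scale/=; field.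
have := @is_derive_0_is_cst R Q z 0 dQ.
rewrite /Q mulr0 expR0 mulr1.
have -> : F 0 = 1.
  rewrite -(Rintegral_normal s); apply: eq_Rintegral => x _.
  by rewrite /f mul0r cos0 mulr1.
rewrite -/(F z) => Fz.
have -> : s ^+ 2 * z ^+ 2 / 2 = s ^+ 2 / 2 * z * z by field.
have e0 : expR (s ^+ 2 / 2 * z * z) != 0 by rewrite gt_eqF ?expR_gt0.
by apply: (mulIf e0); rewrite Fz expRN mulVf.
Qed.

End gaussian_charfun.

Lemma Rintegral_Fubini d1 d2 (T1 : measurableType d1) (T2 : measurableType d2)
    (R : realType) (m1 : {sigma_finite_measure set T1 -> \bar R})
    (m2 : {sigma_finite_measure set T2 -> \bar R}) (f : T1 * T2 -> R) :
  (m1 \x m2)%E.-integrable setT (EFin \o f) ->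
  (forall x, m2.-integrable setT (fun y => (f (x, y))%:E)) ->
  (forall y, m1.-integrable setT (fun x => (f (x, y))%:E)) ->
  \int[m1]_x \int[m2]_y f (x, y) = \int[m2]_y \int[m1]_x f (x, y).
Proof.
move=> fi f1 f2; have := Fubini fi; rewrite /Rintegral => /(congr1 fine).
congr (fine _ = fine _); apply: eq_integral => x _; rewrite fineK//.
- exact: integrable_fin_num.
- exact: integrable_fin_num.
Qed.

Lemma integrable_prod_le d1 d2 (T1 : measurableType d1) (T2 : measurableType d2)
    (R : realType) (m1 : {sigma_finite_measure set T1 -> \bar R})
    (m2 : {sigma_finite_measure set T2 -> \bar R}) (f : T1 * T2 -> R)
    (a : T1 -> R) (b : T2 -> R) :
  measurable_fun setT f -> m1.-integrable setT (EFin \o a) ->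
  m2.-integrable setT (EFin \o b) ->
  (forall x y, `|f (x, y)| <= a x * b y) ->
  (m1 \x m2)%E.-integrable setT (EFin \o f).
Proof.
move=> mf ia ib fab.
have mfx x : measurable_fun setT (fun y => f (x, y)).
  exact: (measurableT_comp mf (measurable_pair1 x)).
apply/integrable12ltyP; first exact/measurable_EFinP.
apply: (@le_lt_trans _ _ (\int[m1]_x (`|a x|%:E * \int[m2]_y `|b y|%:E))%E).
  apply: ge0_le_integral => //=.
  - by move=> x _; exact: integral_ge0.
  - apply: (measurable_fun_fubini_tonelli_F (m2 := m2) (fun z => `|(f z)%:E|%E)) => //.
    by apply: measurableT_comp => //; exact/measurable_EFinP.
  - apply: emeasurable_funM => //; apply/measurable_EFinP.
    by apply: measurableT_comp => //; exact: integrableR_measurable ia.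
  move=> x _; rewrite -ge0_integralZl//=.
  - apply: ge0_le_integral => //=.
    + by apply/measurable_EFinP; exact: measurableT_comp.
    + apply: measurable_funeM; apply/measurable_EFinP.
      by apply: measurableT_comp => //; exact: integrableR_measurable ib.
    + move=> y _; rewrite -EFinM lee_fin -normrM.
      exact: le_trans (fab x y) (ler_norm _).
  - apply/measurable_EFinP; apply: measurableT_comp => //.
    exact: integrableR_measurable ib.
have b_fin : (\int[m2]_y `|b y|%:E < +oo)%E by case/integrableP: ib.
rewrite ge0_integralZr//=.
- apply: lte_mul_pinfty => //; first exact: integral_ge0.
  + rewrite ge0_fin_numE; [by case/integrableP: ia|exact: integral_ge0].
- apply/measurable_EFinP; apply: measurableT_comp => //.
  exact: integrableR_measurable ia.
- exact: integral_ge0.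
Qed.

(** * The cosine transform, Gaussian damping and inversion *)

Section cosine_transform.
Context {R : realType}.
Local Notation mu := (@lebesgue_measure R).
Implicit Types (g : R -> R) (s x y z xi : R).

Lemma le_integrable_lebesgue (f g : R -> R) :
  measurable_fun setT f -> (forall x, `|f x| <= g x) ->
  mu.-integrable setT (EFin \o g) -> mu.-integrable setT (EFin \o f).
Proof. by move=> mf fg; exact: (@le_integrableR _ _ R mu setT f g). Qed.

Definition cos_transform g xi : R := \int[mu]_y (g y * cos (y * xi)).

(** The symbol [exp (-t xi^2)] of the heat semigroup at time [t = s^2 / 2]. *)
Definition gauss_weight s xi : R := expR (- (s ^+ 2 * xi ^+ 2 / 2)).

Lemma gauss_weight_ge0 s xi : 0 <= gauss_weight s xi.
Proof. exact: expR_ge0. Qed.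

Lemma gauss_weight_le1 s xi : gauss_weight s xi <= 1.
Proof.
by rewrite -[leRHS]expR0 ler_expR oppr_le0 mulr_ge0// mulr_ge0 ?sqr_ge0.
Qed.

Lemma measurable_gauss_weight s : measurable_fun setT (gauss_weight s).
Proof.
apply: measurableT_comp => //; apply: measurableT_comp => //.
by apply: measurable_funM => //; apply: measurable_funM => //; apply: measurable_funX.
Qed.

Lemma gauss_weight_normal s xi : 0 < s ->
  gauss_weight s xi = (normal_peak s^-1)^-1 * normal_pdf 0 s^-1 xi.
Proof.
move=> s0; rewrite normal_pdf0E ?gt_eqF ?invr_gt0// mulKf; last first.
  by rewrite gt_eqF// normal_peak_gt0// gt_eqF// invr_gt0.
rewrite /gauss_weight; congr (expR (- _)); field; by rewrite gt_eqF.
Qed.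

Lemma integrable_gauss_weight s : 0 < s ->
  mu.-integrable setT (EFin \o gauss_weight s).
Proof.
move=> s0; rewrite (_ : gauss_weight s =
    fun xi => (normal_peak s^-1)^-1 * normal_pdf 0 s^-1 xi); last first.
  by apply/funext => xi; rewrite gauss_weight_normal.
by apply: integrableRZ => //; exact: integrable_normal.
Qed.

Lemma measurable_cosM z : measurable_fun setT (fun xi : R => cos (z * xi)).
Proof.
apply: measurableT_comp; last exact: measurable_funM.
exact: continuous_measurable_fun (@continuous_cos R).
Qed.

(** Up to normalisation the weight is itself a Gaussian density, of deviation [1/s], so
    [charfun_normal] applies. *)
Lemma cos_transform_gauss s z : 0 < s ->
  \int[mu]_xi (gauss_weight s xi * cos (z * xi)) = 2 * pi * normal_pdf 0 s z.
Proof.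
move=> s0; have s'0 : 0 < s^-1 by rewrite invr_gt0.
have P0 := normal_peak_gt0 (lt0r_neq0 s'0).
under eq_Rintegral do rewrite gauss_weight_normal// -mulrA.
rewrite RintegralZl//; last first.
  apply: (le_integrable_lebesgue (g := normal_pdf 0 s^-1)) => //.
  - apply: measurable_funM; first exact: measurable_normal_pdf.
    exact: measurable_cosM.
  - move=> x; rewrite normrM ger0_norm ?normal_pdf_ge0// ler_piMr ?cos_max//.
    exact: normal_pdf_ge0.
  - exact: integrable_normal.
rewrite charfun_normal// normal_pdf0E ?gt_eqF// [in RHS]mulrA.
rewrite (_ : s^-1 ^+ 2 * z ^+ 2 / 2 = z ^+ 2 / (s ^+ 2 *+ 2)); last first.
  by field; rewrite gt_eqF.
congr (_ * _).
rewrite /normal_peak invrK; apply: (mulIf (x := Num.sqrt (s ^+ 2 * pi *+ 2))).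
  by rewrite gt_eqF// sqrtr_gt0 pmulrn_lgt0// mulr_gt0 ?pi_gt0// exprn_gt0.
rewrite mulfVK; last first.
  by rewrite gt_eqF// sqrtr_gt0 pmulrn_lgt0// mulr_gt0 ?pi_gt0// exprn_gt0.
rewrite -sqrtrM ?pmulrn_lge0 ?mulr_ge0 ?pi_ge0 ?sqr_ge0//.
rewrite (_ : s^-1 ^+ 2 * pi *+ 2 * _ = (2 * pi) ^+ 2) ?sqrtr_sqr ?ger0_norm ?mulr_ge0 ?pi_ge0//.
by field; rewrite gt_eqF.
all: exact: ltW.
Qed.

(** The Gaussian kernel averaged over the centres [x] and [-x]: this is what the product
    [cos (x xi) cos (y xi)] produces, and on even functions it acts as the usual heat kernel. *)
Definition heat_kernel s x y : R :=
  (normal_pdf 0 s (y - x) + normal_pdf 0 s (y + x)) / 2.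

Lemma heat_kernelE s x : s != 0 -> heat_kernel s x =
  fun y => 2^-1 * (normal_pdf x s y + normal_pdf (- x) s y).
Proof.
move=> s0; apply/funext => y; rewrite /heat_kernel mulrC !normal_pdfE//.
by rewrite /normal_fun !subr0 opprK.
Qed.

Lemma heat_kernel_ge0 s x y : 0 <= heat_kernel s x y.
Proof. by rewrite /heat_kernel divr_ge0// addr_ge0// normal_pdf_ge0. Qed.

Lemma integrable_heat_kernel s x : s != 0 ->
  mu.-integrable setT (EFin \o heat_kernel s x).
Proof.
move=> s0; rewrite heat_kernelE//; apply: integrableRZ => //.
by apply: integrableRD => //; exact: integrable_normal_pdf.
Qed.

Lemma Rintegral_heat_kernel s x : s != 0 -> \int[mu]_y heat_kernel s x y = 1.
Proof.
move=> s0; rewrite heat_kernelE// RintegralZl//; last first.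
  by apply: integrableRD => //; exact: integrable_normal_pdf.
rewrite RintegralD//; [|exact: integrable_normal_pdf..].
by rewrite /Rintegral !integral_normal_pdf/=; field.
Qed.

Lemma measurable_heat_kernel s x : s != 0 -> measurable_fun setT (heat_kernel s x).
Proof. by move=> /integrable_heat_kernel/integrableR_measurable; exact. Qed.

Lemma heat_kernel_ub s x y : s != 0 -> heat_kernel s x y <= normal_peak s.
Proof.
move=> s0; have := normal_pdf_ub 0 (y - x) s0; have := normal_pdf_ub 0 (y + x) s0.
rewrite /heat_kernel; lra.
Qed.

Definition heat s g x : R := \int[mu]_y (g y * heat_kernel s x y).

Lemma integrable_cosM g xi : mu.-integrable setT (EFin \o g) ->
  mu.-integrable setT (EFin \o (fun y => g y * cos (y * xi))).
Proof.
move=> ig; apply: (le_integrable_lebesgue (g := fun y => `|g y|)) => //.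
- apply: measurable_funM; first exact: integrableR_measurable ig.
  under eq_fun do rewrite mulrC; exact: measurable_cosM.
- by move=> y; rewrite normrM ler_piMr// cos_max.
- exact: integrable_norm.
Qed.

(** The Gaussian factor justifies Fubini without any integrability of the transform of [g]; the
    product of cosines then splits into the two Gaussians of [heat_kernel]. *)
Lemma heat_cos_transform s g x : 0 < s -> mu.-integrable setT (EFin \o g) ->
  \int[mu]_xi (gauss_weight s xi * cos_transform g xi * cos (x * xi)) =
  2 * pi * heat s g x.
Proof.
move=> s0 ig; have mg := integrableR_measurable ig.
pose f (z : R * R) := gauss_weight s z.1 * cos (x * z.1) * (g z.2 * cos (z.2 * z.1)).
have mcos d (T : measurableType d) (h k : T -> R) : measurable_fun setT h ->
    measurable_fun setT k -> measurable_fun setT (fun t => cos (h t * k t)).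
  move=> mh mk; apply: measurableT_comp; last exact: measurable_funM.
  exact: continuous_measurable_fun (@continuous_cos R).
have mf : measurable_fun setT f.
  apply: measurable_funM; apply: measurable_funM.
  - exact: measurableT_comp (measurable_gauss_weight s) measurable_fst.
  - by apply: mcos.
  - exact: measurableT_comp mg measurable_snd.
  - by apply: mcos.
have G0 xi : 0 <= gauss_weight s xi by exact: expR_ge0.
have fle xi y : `|f (xi, y)| <= gauss_weight s xi * `|g y|.
  rewrite /f/= !normrM (ger0_norm (G0 _)) -mulrA ler_wpM2l// mulrCA.
  by rewrite ler_piMr// mulr_ile1 ?cos_max.
have ifz : (mu \x mu)%E.-integrable setT (EFin \o f).
  apply: (@integrable_prod_le _ _ _ _ _ mu mu f (gauss_weight s) (fun y => `|g y|)) => //.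
  - exact: integrable_gauss_weight.
  - exact: integrable_norm.
have ify xi : mu.-integrable setT (fun y => (f (xi, y))%:E).
  exact: (integrableRZ measurableT (gauss_weight s xi * cos (x * xi))
    (integrable_cosM xi ig)).
have ig1 y : mu.-integrable setT (EFin \o (fun xi => gauss_weight s xi * cos (y * xi))).
  apply: (le_integrable_lebesgue (g := gauss_weight s)) => //.
  - apply: measurable_funM; first exact: measurable_gauss_weight.
    exact: measurable_cosM.
  - by move=> xi; rewrite normrM ger0_norm// ler_piMr// cos_max.
  - exact: integrable_gauss_weight.
have fE xi y : f (xi, y) = g y / 2 * (gauss_weight s xi * cos ((y - x) * xi) +
    gauss_weight s xi * cos ((y + x) * xi)).
  by rewrite /f/= mulrBl mulrDl cosB cosD; field.
have ifx y : mu.-integrable setT (fun xi => (f (xi, y))%:E).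
  under eq_fun do rewrite fE.
  by apply: integrableRZ => //; exact: integrableRD.
transitivity (\int[mu]_xi \int[mu]_y f (xi, y)).
  apply: eq_Rintegral => xi _; rewrite /f/= RintegralZl//.
    by rewrite /cos_transform mulrAC.
  exact: integrable_cosM.
rewrite Rintegral_Fubini//.
transitivity (\int[mu]_y (2 * pi * (g y * heat_kernel s x y))); last first.
  rewrite RintegralZl//.
  apply: (le_integrable_lebesgue (g := fun y => normal_peak s * `|g y|)) => //.
  - by apply: measurable_funM => //; apply: measurable_heat_kernel; rewrite gt_eqF.
  - move=> y; rewrite normrM mulrC ler_wpM2r//.
    by rewrite ger0_norm ?heat_kernel_ge0// heat_kernel_ub// gt_eqF.
  - by apply: integrableRZ => //; exact: integrable_norm.
apply: eq_Rintegral => y _; under eq_Rintegral do rewrite fE.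
rewrite RintegralZl//; last exact: integrableRD.
rewrite RintegralD// !cos_transform_gauss// /heat_kernel.
by field.
Qed.

End cosine_transform.

(** The tangent at [m] to the convex function [a^(l+1)]; the induction step loses exactly
    [(l+1) m^l (a - m)^2]. It serves in Jensen's inequality and again when the heat flow is compared
    with its initial value. *)
Lemma expr_tangent (R : realDomainType) (a m : R) l : 0 <= a -> 0 <= m ->
  m ^+ l.+1 + l.+1%:R * m ^+ l * (a - m) <= a ^+ l.+1.
Proof.
move=> a0 m0; elim: l => [|l IH]; first by rewrite !expr1 expr0 mulr1 mul1r; lra.
rewrite [leRHS]exprS; apply: le_trans (ler_wpM2l a0 IH).
rewrite -subr_ge0 !exprS -[l.+2%:R]natr1.
have -> : a * (m * m ^+ l + l.+1%:R * m ^+ l * (a - m)) - (m * (m * m ^+ l) +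
  (l.+1%:R + 1) * (m * m ^+ l) * (a - m)) = l.+1%:R * m ^+ l * (a - m) ^+ 2.
  by ring.
by rewrite mulr_ge0 ?sqr_ge0// mulr_ge0 ?exprn_ge0.
Qed.

Section heat_properties.
Context {R : realType}.
Local Notation mu := (@lebesgue_measure R).
Implicit Types (g : R -> R) (s x y z xi : R).

Lemma integrable_mul_heat s g x : s != 0 -> measurable_fun setT g ->
  (forall y, 0 <= g y <= 1) ->
  mu.-integrable setT (EFin \o (fun y => g y * heat_kernel s x y)).
Proof.
move=> s0 mg g01; apply: (le_integrable_lebesgue (g := heat_kernel s x)).
- by apply: measurable_funM => //; exact: measurable_heat_kernel.
- move=> y; have /andP[g0 g1] := g01 y.
  have k0 := heat_kernel_ge0 s x y.
  by rewrite normrM !ger0_norm// ler_piMl.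
- exact: integrable_heat_kernel.
Qed.

Lemma heat_ge0 s g x : (forall y, 0 <= g y) -> 0 <= heat s g x.
Proof.
by move=> g0; apply: Rintegral_ge0 => y _; rewrite mulr_ge0 ?heat_kernel_ge0.
Qed.

(** The tangent inequality at the mean [m], integrated against the probability density
    [heat_kernel s x]. *)
Lemma heat_jensen s g x l : s != 0 -> measurable_fun setT g ->
  (forall y, 0 <= g y <= 1) ->
  heat s g x ^+ l.+1 <= heat s (fun y => g y ^+ l.+1) x.
Proof.
move=> s0 mg g01.
have g0 y : 0 <= g y by case/andP: (g01 y).
set m := heat s g x; have m0 : 0 <= m by exact: heat_ge0.
have ig := integrable_mul_heat x s0 mg g01.
have igl : mu.-integrable setT (EFin \o (fun y => g y ^+ l.+1 * heat_kernel s x y)).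
  apply: integrable_mul_heat => //; first exact: measurable_funX.
  move=> y; have /andP[gy0 gy1] := g01 y.
  by rewrite exprn_ge0//= exprn_ile1.
have ik := integrable_heat_kernel x s0.
have E : m ^+ l.+1 = \int[mu]_y ((m ^+ l.+1 - l.+1%:R * m ^+ l * m) * heat_kernel s x y
    + (l.+1%:R * m ^+ l) * (g y * heat_kernel s x y)).
  rewrite RintegralD//; [|exact: integrableRZ|exact: integrableRZ].
  rewrite !RintegralZl// Rintegral_heat_kernel// -/(heat s g x) -/m; ring.
rewrite {1}E; apply: le_Rintegral => //.
  by apply: integrableRD => //; exact: integrableRZ.
move=> y _; rewrite mulrA -mulrDl ler_wpM2r ?heat_kernel_ge0//.
by apply: le_trans (expr_tangent l (g0 y) m0); rewrite mulrBr; lra.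
Qed.

(** The error is at most [M] times a first moment of the kernel. Evenness turns the half centred at
    [-x] into a comparison with [g (-x) = g x]. *)
Lemma heat_approx s g x (M : R) : 0 < s -> measurable_fun setT g ->
  (forall y, 0 <= g y <= 1) -> (forall y, g (- y) = g y) ->
  (forall y z, `|g y - g z| <= M * `|y - z|) -> 0 <= M ->
  `|heat s g x - g x| <= 2 * Num.sqrt 2 * M * s.
Proof.
move=> s0 mg g01 ge gM M0; have sN : s != 0 by rewrite gt_eqF.
have r0 : 0 < Num.sqrt 2 * s by rewrite mulr_gt0// sqrtr_gt0.
have rN : Num.sqrt 2 * s != 0 by rewrite gt_eqF.
have ig := integrable_mul_heat x sN mg g01.
have ik := integrable_heat_kernel x sN.
have -> : heat s g x - g x = \int[mu]_y ((g y - g x) * heat_kernel s x y).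
  under eq_Rintegral do rewrite mulrBl.
  rewrite RintegralB//; last exact: integrableRZ.
  by rewrite RintegralZl// Rintegral_heat_kernel// mulr1.
have ii : mu.-integrable setT (EFin \o (fun y => (g y - g x) * heat_kernel s x y)).
  rewrite (_ : (fun y => _) = fun y => g y * heat_kernel s x y - g x * heat_kernel s x y).
    by apply: integrableRB => //; exact: integrableRZ.
  by apply/funext => y; rewrite mulrBl.
apply: (le_trans (le_normr_Rintegral _ ii)) => //.
have -> : 2 * Num.sqrt 2 * M * s = \int[mu]_y (2 * Num.sqrt 2 * M * s *
    heat_kernel (Num.sqrt 2 * s) x y).
  by rewrite RintegralZl ?Rintegral_heat_kernel ?mulr1//; exact: integrable_heat_kernel.
apply: le_Rintegral => //.
- exact: integrable_norm.
- by apply: integrableRZ => //; exact: integrable_heat_kernel.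
move=> y _; rewrite normrM (ger0_norm (heat_kernel_ge0 _ _ _)) /heat_kernel.
have h1 := normal_pdf_moment (y - x) s0; have h2 := normal_pdf_moment (y + x) s0.
have n1 := normal_pdf_ge0 0 s (y - x); have n2 := normal_pdf_ge0 0 s (y + x).
have g1 := gM y x; have g2 := gM y (- x); rewrite ge opprK in g2.
have k1 := ler_wpM2r n1 g1; have k2 := ler_wpM2r n2 g2.
have l1 := ler_wpM2l M0 h1; have l2 := ler_wpM2l M0 h2.
rewrite !mulrA ler_pM2r ?invr_gt0// [leLHS]mulrDr.
have -> : 2 * Num.sqrt 2 * M * s *
   (normal_pdf 0 (Num.sqrt 2 * s) (y - x) + normal_pdf 0 (Num.sqrt 2 * s) (y + x)) =
  M * (2 * Num.sqrt 2 * s * normal_pdf 0 (Num.sqrt 2 * s) (y - x)) +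
  M * (2 * Num.sqrt 2 * s * normal_pdf 0 (Num.sqrt 2 * s) (y + x)) by ring.
rewrite lerD//; first by apply: le_trans l1; rewrite mulrA.
by apply: le_trans l2; rewrite mulrA.
Qed.

Lemma gauss_weight_cvg (s : nat -> R) xi : s n @[n --> \oo] --> (0 : R) ->
  gauss_weight (s n) xi @[n --> \oo] --> (1 : R).
Proof.
move=> s_cvg; rewrite -expR0.
apply: (cvg_comp _ expR); last exact: continuous_expR.
rewrite -[0 : R]oppr0; apply: (@cvgN _ R^o).
rewrite -(mul0r 2^-1); apply: cvgM; last exact: cvg_cst.
rewrite -(mul0r (xi ^+ 2)); apply: cvgM; last exact: cvg_cst.
by rewrite -(mulr0 (0 : R)); exact: cvgM.
Qed.

(** With weights of parameter [s = 1/(n+1)] the damped integral is a heat flow, which tends to [g x]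
    by [heat_approx], and dominated convergence removes the damping. *)
Lemma cos_transform_inversion g x (M : R) :
  mu.-integrable setT (EFin \o g) ->
  mu.-integrable setT (EFin \o cos_transform g) ->
  (forall y, 0 <= g y <= 1) -> (forall y, g (- y) = g y) ->
  (forall y z, `|g y - g z| <= M * `|y - z|) -> 0 <= M ->
  \int[mu]_xi (cos_transform g xi * cos (x * xi)) = 2 * pi * g x.
Proof.
move=> ig igh g01 ge gM M0; have mg := integrableR_measurable ig.
have mgh := integrableR_measurable igh.
pose s (n : nat) : R := harmonic n.
have s0 n : 0 < s n by rewrite /s /harmonic/= invr_gt0.
have s_cvg : s n @[n --> \oo] --> (0 : R) by exact: cvg_harmonic.
have [||||_ H] := @Rintegral_dominated_cvg _ _ R mu setT
  (fun n xi => gauss_weight (s n) xi * cos_transform g xi * cos (x * xi))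
  (fun xi => cos_transform g xi * cos (x * xi)) (fun xi => `|cos_transform g xi|)
  measurableT.
- move=> n; apply: measurable_funM; last exact: measurable_cosM.
  by apply: measurable_funM => //; exact: measurable_gauss_weight.
- move=> xi _; rewrite -[cos_transform g xi in X in _ --> X]mul1r.
  apply: cvgM; last exact: cvg_cst.
  apply: cvgM; last exact: cvg_cst.
  exact: gauss_weight_cvg.
- exact: integrable_norm.
- move=> n xi _; rewrite !normrM ger0_norm ?expR_ge0// -mulrA.
  rewrite -[leRHS]mul1r ler_pM ?mulr_ge0 ?expR_ge0 ?gauss_weight_le1//.
  by rewrite ler_piMr// cos_max.
move: H; under eq_fun do rewrite heat_cos_transform//.
move=> H; apply: (cvg_unique _ H) => //.
apply: cvgM; first exact: cvg_cst.
apply/cvgrPdist_le => e e0.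
have : 2 * Num.sqrt 2 * M * s n @[n --> \oo] --> (0 : R).
  rewrite -[X in _ --> X](mulr0 (2 * Num.sqrt 2 * M)).
  by apply: cvgM => //; exact: cvg_cst.
move/cvgr0_norm_le => /(_ e e0); apply: filterS => n.
rewrite ger0_norm ?mulr_ge0 ?sqrtr_ge0 ?(ltW (s0 n))// distrC => h.
exact: le_trans (heat_approx x (s0 n) mg g01 ge gM M0) h.
Qed.

Lemma continuous_cos_transform g : mu.-integrable setT (EFin \o g) ->
  continuous (cos_transform g).
Proof.
move=> ig a.
have aI : (`]a - 1, a + 1[%classic : set R) a by rewrite /= in_itv/=; lra.
apply: (@continuity_under_integral R _ _ mu (fun xi y => g y * cos (y * xi)) setT
  measurableT (a - 1) (a + 1) _ _ (fun y => `|g y|)) => //; last by rewrite inE.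
- by move=> xi _; exact: integrable_cosM.
- apply: aeW => y _ xi _; apply: cvgM; first exact: cvg_cst.
  apply: (cvg_comp _ cos); last exact: continuous_cos.
  by apply: cvgM; [exact: cvg_cst|exact: cvg_id].
- exact: integrable_norm.
- by move=> xi _; apply: aeW => y _; rewrite normrM ler_piMr// cos_max.
Qed.

Lemma integrable_bounded_support (h : R -> R) (M b : R) : measurable_fun setT h ->
  (forall y, `|h y| <= M) -> (forall y, b <= `|y| -> h y = 0) -> 0 <= b ->
  mu.-integrable setT (EFin \o h) /\ \int[mu]_y `|h y| <= 2 * b * M.
Proof.
move=> mh hM hb b0.
pose I : set R := `[- b, b]%classic.
have muI : mu I = (2 * b)%:E.
  rewrite /I lebesgue_measure_itv/=; case: ifPn; first by rewrite lte_fin => _; congr EFin; lra.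
  by rewrite lte_fin -leNgt => ?; congr EFin; lra.
have iI : mu.-integrable setT (EFin \o (fun y => M * \1_I y)).
  by apply: integrableRZ => //; exact: integrable_indic_itv.
have hI y : `|h y| <= M * \1_I y.
  rewrite indicE; case: (boolP (y \in I)) => [_|yI]; first by rewrite mulr1.
  rewrite hb ?normr0 ?mulr0//; move: yI; rewrite notin_setE /I/= in_itv/= -ler_norml.
  by move=> /negP; rewrite -ltNge => /ltW.
have ih : mu.-integrable setT (EFin \o h) by exact: le_integrable_lebesgue hI iI.
split => //.
have -> : 2 * b * M = \int[mu]_y (M * \1_I y).
  rewrite RintegralZl//; last exact: integrable_indic_itv.
  have mI : measurable (I : set (measurableTypeR R)) by exact: measurable_itv.
  have E : (\int[mu]_x (\1_I x)%:E)%E = (2 * b)%:E.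
    by rewrite integral_indic// setIT; exact: muI.
  by rewrite /Rintegral E mulrC.
by apply: le_Rintegral => //; exact: integrable_norm.
Qed.

Lemma cos_transform_norm_le (h : R -> R) (M b xi : R) : measurable_fun setT h ->
  (forall y, `|h y| <= M) -> (forall y, b <= `|y| -> h y = 0) -> 0 <= b ->
  `|cos_transform h xi| <= 2 * b * M.
Proof.
move=> mh hM hb b0; have [ih hle] := integrable_bounded_support mh hM hb b0.
apply: le_trans hle; apply: le_trans (le_normr_Rintegral _ (integrable_cosM xi ih)) _ => //.
apply: le_Rintegral => //.
- by apply: integrable_norm; exact: integrable_cosM.
- exact: integrable_norm.
- by move=> y _; rewrite normrM ler_piMr// cos_max.
Qed.

Lemma cos_transform_derive2 (h h1 h2 : R -> R) (b xi : R) :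
  (forall y, is_derive y (1 : R) h (h1 y)) ->
  (forall y, is_derive y (1 : R) h1 (h2 y)) -> continuous h2 ->
  mu.-integrable setT (EFin \o h) -> mu.-integrable setT (EFin \o h2) ->
  (forall y, b <= `|y| -> h y = 0) -> (forall y, b <= `|y| -> h1 y = 0) ->
  cos_transform h2 xi = - (xi ^+ 2 * cos_transform h xi).
Proof.
move=> dh dh1 ch2 ih ih2 hb h1b.
have ch : continuous h by exact: is_derive_continuous dh.
have ic := integrable_cosM xi ih; have ic2 := integrable_cosM xi ih2.
have dcos (y : R) : is_derive y (1 : R) (fun y => cos (y * xi)) (- sin (y * xi) * xi).
  apply: is_derive_comp; apply: is_derive_eq; rewrite /GRing.scale/=; ring.
have dsin (y : R) : is_derive y (1 : R) (fun y => sin (y * xi)) (cos (y * xi) * xi).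
  apply: is_derive_comp; apply: is_derive_eq; rewrite /GRing.scale/=; ring.
have ccos : continuous (fun y => cos (y * xi)) by exact: is_derive_continuous dcos.
(* In [G'] the cross terms [xi h1 sin] cancel, so both integrations by parts are done at once. *)
pose G y := h1 y * cos (y * xi) + xi * (h y * sin (y * xi)).
pose g y := h2 y * cos (y * xi) + xi ^+ 2 * (h y * cos (y * xi)).
have : \int[mu]_y g y = 0.
  apply: (@Rintegral_derive_eq0 R G).
  - move=> y; apply: (is_derive_eq (is_deriveD (is_derive_mul (dh1 y) (dcos y))
      (is_derive_scale xi (is_derive_mul (dh y) (dsin y))))).
    by rewrite /g; ring.
  - move=> y; apply: cvgD; first by apply: cvgM; [exact: ch2|exact: ccos].
    apply: cvgM; first exact: cvg_cst.
    by apply: cvgM; [exact: ch|exact: ccos].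
  - by apply: integrableRD => //; exact: integrableRZ.
  - apply: cvg_near_cst; near=> n.
    have bn : b <= n.+1%:R.
      by apply: (@le_trans _ _ n%:R); [near: n; exact: nbhs_infty_ger|rewrite ler_nat].
    by rewrite /G !hb ?h1b ?normrN ?ger0_norm// !mul0r mulr0 addr0 subrr.
rewrite RintegralD// ?RintegralZl//; last exact: integrableRZ.
by move/eqP; rewrite addr_eq0 => /eqP.
Unshelve. all: end_near. Qed.

End heat_properties.

(** * Smooth cutoffs *)
Section flat.
Context {R : realType}.
Implicit Types (P : {poly R}) (x y : R).

(** With [y = 1/x] the derivative of [P(y) exp (-y)] is [y^2 (P - P')(y) exp (-y)]: the polynomial
    factor makes the family stable under differentiation. *)
Definition flat P x : R := if 0 < x then P.[x^-1] * expR (- x^-1) else 0.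

Definition flat_deriv P : {poly R} := 'X^2 * (P - P^`()).

(** Each degree of [P] costs a factor [y], absorbed by half of the exponential rate; hence an
    induction over all rates [e]. *)
Lemma poly_le_expR P (e : R) : 0 < e ->
  exists2 C, 0 <= C & forall y, 0 <= y -> `|P.[y]| <= C * expR (e * y).
Proof.
elim/poly_ind: P e => [|P c IH] e e0.
  by exists 0 => // y _; rewrite horner0 normr0 mul0r.
have e2 : 0 < e / 2 by rewrite divr_gt0.
have [C C0 HC] := IH _ e2; exists (C * (e / 2)^-1 + `|c|).
  by rewrite addr_ge0 ?mulr_ge0// invr_ge0 ltW.
move=> y y0; rewrite !hornerE; apply: (le_trans (ler_normD _ _)).
rewrite mulrDl lerD//; last first.
  by rewrite ler_peMr// -[leLHS]expR0 ler_expR mulr_ge0// ltW.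
rewrite normrM (ger0_norm y0) (_ : e * y = e / 2 * y + e / 2 * y); last by field.
rewrite expRD; set E := expR (e / 2 * y).
have -> : C / (e / 2) * (E * E) = (C * E) * ((e / 2)^-1 * E) by ring.
apply: ler_pM => //; first exact: HC.
rewrite -(ler_pM2l e2) mulVKf ?gt_eqF//.
by apply: le_trans (expR_ge1Dx _); rewrite lerDr.
Qed.

(** A quadratic bound makes the difference quotients at 0 tend to 0. *)
Lemma flat_le P : exists2 C, 0 <= C & forall x, 0 < x -> `|flat P x| <= C * x ^+ 2.
Proof.
have [C C0 HC] := poly_le_expR (P * 'X^2) ltr01; exists C => // x x0.
rewrite /flat x0 normrM (ger0_norm (expR_ge0 _)) expRN ler_pdivrMr ?expR_gt0//.
have y0 : 0 < x^-1 by rewrite invr_gt0.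
have := HC _ (ltW y0); rewrite mul1r hornerM hornerXn normrM.
rewrite (ger0_norm (sqr_ge0 _)) mulrAC -ler_pdivlMr ?exprn_gt0//.
by rewrite exprVn invrK => /le_trans; apply; rewrite lexx.
Qed.

Lemma is_derive_flat P x : is_derive x (1 : R) (flat P) (flat (flat_deriv P) x).
Proof.
have [x0|x0|->] := ltgtP x 0.
- rewrite {2}/flat ltNge (ltW x0)/=.
  have d0 : is_derive x (1 : R) (fun=> 0 : R) (0 : R) by exact: is_derive_cst.
  apply: near_eq_is_derive d0.
  near=> y; rewrite /flat ltNge (_ : y <= 0)//.
  by near: y; exact: lt_le_nbhsl.
- have xN : x != 0 by rewrite gt_eqF.
  have dV : is_derive x (1 : R) (fun y : R => y^-1) (- x ^- 2).
    apply: (is_derive_eq (is_deriveV xN (is_derive_id x 1))).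
    by rewrite /GRing.scale/= mulr1.
  have dP := is_derive_comp (is_derive_poly P x^-1) dV.
  have dNV : is_derive x (1 : R) (fun y : R => - y^-1) (x ^- 2).
    by apply: (is_derive_eq (is_deriveN dV)); rewrite opprK.
  have dE := is_derive_comp (g := fun y : R => - y^-1) (is_derive_expR (- x^-1)) dNV.
  apply: near_eq_is_derive (is_derive_eq (is_derive_mul dP dE) _).
    near=> y; rewrite /flat (_ : 0 < y)//.
    by near: y; exact: lt_nbhsr.
  rewrite /flat x0 /flat_deriv hornerM hornerXn hornerD hornerN; field.
  exact: xN.
- rewrite {2}/flat ltxx; have [C C0 HC] := flat_le P.
  have H : h^-1 *: ((flat P \o shift 0) (h *: (1 : R)) - flat P 0) @[h --> 0^'] --> (0 : R).
    apply/cvgrPdist_le => e e0; near=> h.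
    rewrite sub0r normrN /shift/= addr0 {2}/flat ltxx subr0 /GRing.scale/= mulr1.
    rewrite normrM normfV; have hN : h != 0 by near: h; exact: nbhs_dnbhs_neq.
    rewrite mulrC ler_pdivrMr ?normr_gt0//.
    have [h0|h0] := ltP 0 h; last by rewrite /flat ltNge h0/= normr0 mulr_ge0// ltW.
    apply: (le_trans (HC _ h0)); rewrite gtr0_norm// expr2 mulrA ler_pM2r//.
    rewrite (@le_trans _ _ ((C + 1) * h))//.
      by rewrite ler_pM2r//; lra.
    rewrite mulrC -ler_pdivlMr; last lra.
    rewrite -(gtr0_norm h0); near: h; apply: dnbhs0_le.
    by rewrite divr_gt0//; lra.
  split; first by apply/cvg_ex; exists 0.
  exact/cvg_lim.
Unshelve. all: end_near. Qed.

End flat.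

Section elementary.
Context {R : realType}.

(* A class closed under directional derivatives, so that membership gives
   smoothness without a chain rule for iterated derivatives. *)
Inductive elementary (V : normedModType R) : (V -> R) -> Prop :=
| elementary_cst c : elementary (fun=> c)
| elementary_lin (L : {linear V -> R}) : continuous L -> elementary L
| elementaryD f g : elementary f -> elementary g -> elementary (fun x => f x + g x)
| elementaryM f g : elementary f -> elementary g -> elementary (fun x => f x * g x)
| elementary_flat P f : elementary f -> elementary (fun x => flat P (f x)).

Lemma elementary_diff (V : normedModType R) (f : V -> R) : elementary f ->
  (forall a, differentiable f a) /\ (forall v, elementary ('D_v f)).
Proof.
elim=> [c|L cL|{}f g ef [df dvf] eg [dg dvg]|{}f g ef [df dvf] eg [dg dvg]|P {}f ef [df dvf]].
- split=> [a|v]; first exact: differentiable_cst.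
  rewrite (_ : 'D_v _ = fun=> 0); first exact: elementary_cst.
  by apply/funext => a; exact: derive_cst.
- have dL a : differentiable L a by exact: linear_differentiable.
  split=> // v; rewrite (_ : 'D_v _ = fun=> L v); first exact: elementary_cst.
  by apply/funext => a; rewrite deriveE// diff_lin.
- split=> [a|v]; first exact: differentiableD.
  rewrite (_ : 'D_v _ = fun x => 'D_v f x + 'D_v g x); first exact: elementaryD.
  by apply/funext => a; rewrite -deriveD//; exact: diff_derivable.
- split=> [a|v]; first exact: differentiableM.
  rewrite (_ : 'D_v _ = fun x => f x * 'D_v g x + g x * 'D_v f x).
    by apply: elementaryD; exact: elementaryM.
  by apply/funext => a; rewrite (@deriveM _ _ f g)//; exact: diff_derivable.
- have dF y : differentiable (flat P) y.
    by apply/derivable1_diffP; have [] := is_derive_flat P y.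
  split=> [a|v]; first exact: (@differentiable_comp _ _ _ _ f (flat P)).
  rewrite (_ : 'D_v _ = fun x => 'D_v f x * flat (flat_deriv P) (f x)).
    by apply: elementaryM => //; exact: elementary_flat.
  apply/funext => a; rewrite deriveE; last exact: (@differentiable_comp _ _ _ _ f (flat P)).
  rewrite (@diff_comp _ _ _ _ f (flat P))//= diff1E//= derive1E.
  by have [_ ->] := is_derive_flat P (f a); rewrite /GRing.scale/= -deriveE.
Qed.

Lemma elementary_smooth (V : normedModType R) (f : V -> R) : elementary f -> smooth f.
Proof.
move=> ef vs a; apply: (elementary_diff _).1; elim: vs => //= v vs IH.
exact: (elementary_diff IH).2.
Qed.

Lemma elementaryX (V : normedModType R) (f : V -> R) n : elementary f ->
  elementary (fun x => f x ^+ n).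
Proof.
move=> ef; elim: n => [|n IH]; first exact: elementary_cst.
by rewrite (_ : (fun x => _) = fun x => f x * f x ^+ n);
  [exact: elementaryM|apply/funext => x; rewrite exprS].
Qed.

Lemma elementary_prod (V : normedModType R) I (r : seq I) (f : I -> V -> R) :
  (forall i, elementary (f i)) -> elementary (fun x => \prod_(i <- r) f i x).
Proof.
move=> ef; elim: r => [|i r IH].
  rewrite (_ : (fun x => _) = fun=> 1); first exact: elementary_cst.
  by apply/funext => x; rewrite big_nil.
rewrite (_ : (fun x => _) = fun x => f i x * \prod_(i <- r) f i x).
  exact: elementaryM.
by apply/funext => x; rewrite big_cons.
Qed.

End elementary.

(** * Even bumps on the line and the decay of their transforms *)

Section profile.
Context {R : realType}.
Local Notation mu := (@lebesgue_measure R).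
Implicit Types (g h : R -> R) (r x y z xi b : R).

Lemma elementary_derive h : elementary h ->
  exists2 h', elementary h' & forall y, is_derive y (1 : R) h (h' y).
Proof.
move=> eh; have [dh eD] := elementary_diff eh; exists ('D_1 h) => //.
by move=> y; split => //; exact/derivable1_diffP.
Qed.

Lemma elementary_continuous h : elementary h -> continuous h.
Proof. by move=> /elementary_derive[h' _]; exact: is_derive_continuous. Qed.

Lemma continuous_support_bounded h b : continuous h ->
  (forall y, b <= `|y| -> h y = 0) ->
  exists2 M, 0 <= M & forall y, `|h y| <= M.
Proof.
move=> ch hb.
have ab : - `|b| <= `|b| by rewrite ge0_cp.
have cn : {within `[- `|b|, `|b|], continuous (fun y => `|h y|)}.
  by apply: continuous_subspaceT => y; apply: cvg_norm; exact: ch.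
have [c _ Hc] := EVT_max ab cn; exists `|h c| => // y.
have [yb|yb] := leP `|y| `|b|.
  by apply: Hc; rewrite in_itv/= -ler_norml.
by rewrite hb ?normr0// (le_trans (ler_norm b))// ltW.
Qed.

(** The derivative at [y] sees a neighbourhood of [y], whence the strict inequality; enlarging [b]
    by 1 at each use recovers a closed condition. *)
Lemma support_derive h h' b : (forall y, is_derive y (1 : R) h (h' y)) ->
  (forall y, b <= `|y| -> h y = 0) -> forall y, b < `|y| -> h' y = 0.
Proof.
move=> dh hb y yb.
have d0 : is_derive y (1 : R) (fun=> 0 : R) (0 : R) by exact: is_derive_cst.
have d1 : is_derive y (1 : R) h 0.
  apply: near_eq_is_derive d0; near=> z; rewrite hb// ltW//.
  near: z; apply: (cvgr_gt `|y|) => //; exact: norm_continuous.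
by have [_ <-] := dh y; have [_ ->] := d1.
Unshelve. all: end_near. Qed.

Lemma is_derive_dilate h h' r : (forall y, is_derive y (1 : R) h (h' y)) ->
  forall y, is_derive y (1 : R) (fun y => h (r^-1 * y)) (r^-1 * h' (r^-1 * y)).
Proof.
move=> dh y; apply: (is_derive_eq (is_derive_comp (dh _) (is_derive_mulc r^-1 y))).
by rewrite mulrC.
Qed.

Lemma elementary_dilate h r : elementary h -> elementary (fun y => h (r^-1 * y)).
Proof.
elim=> [c|L cL|{}f g ef edf eg edg|{}f g ef edf eg edg|P {}f ef edf].
- exact: elementary_cst.
- rewrite (_ : (fun y => _) = fun y => r^-1 * L y).
    by apply: elementaryM; [exact: elementary_cst|exact: elementary_lin].
  by apply/funext => y; rewrite -[r^-1 * y]/(r^-1 *: y) linearZ.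
- exact: elementaryD.
- exact: elementaryM.
- exact: elementary_flat.
Qed.

(** Four derivatives, as two uses of [cos_transform_derive2], because the transform must remain
    integrable after multiplication by [1 + (r xi)^2]. Dilation divides the fourth derivative by
    [r^4] and multiplies the length of the support by [r], which gives the bound [C * r]. *)
Lemma cos_transform_decay g b : elementary g ->
  (forall y, b <= `|y| -> g y = 0) -> 0 <= b -> exists2 C, 0 <= C &
  forall r xi, 0 < r ->
    `|cos_transform (fun y => g (r^-1 * y)) xi| * (1 + (r * xi) ^+ 4) <= C * r.
Proof.
move=> eg gb b0.
have [g1 eg1 d1] := elementary_derive eg; have [g2 eg2 d2] := elementary_derive eg1.
have [g3 eg3 d3] := elementary_derive eg2; have [g4 eg4 d4] := elementary_derive eg3.
pose B := b + 1 + 1 + 1 + 1.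
have s1 y : b + 1 <= `|y| -> g1 y = 0.
  by move=> h; apply: (support_derive d1 gb); lra.
have s2 y : b + 1 + 1 <= `|y| -> g2 y = 0.
  by move=> h; apply: (support_derive d2 s1); lra.
have s3 y : b + 1 + 1 + 1 <= `|y| -> g3 y = 0.
  by move=> h; apply: (support_derive d3 s2); lra.
have s4 y : B <= `|y| -> g4 y = 0.
  by rewrite /B => h; apply: (support_derive d4 s3); lra.
have B0 : 0 <= B by rewrite /B; lra.
have [M0 M00 HM0] := continuous_support_bounded (elementary_continuous eg) gb.
have [M2 M20 HM2] := continuous_support_bounded (elementary_continuous eg2) s2.
have [M4 M40 HM4] := continuous_support_bounded (elementary_continuous eg4) s4.
exists (2 * B * (M0 + M4)); first by rewrite !mulr_ge0// addr_ge0.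
move=> r xi r0; have rN : r != 0 by rewrite gt_eqF.
have rB h : (forall y, B <= `|y| -> h y = 0) -> forall y, B * r <= `|y| -> h (r^-1 * y) = 0.
  move=> hB y By; apply: hB; rewrite normrM gtr0_norm ?invr_gt0// mulrC.
  by rewrite ler_pdivlMr.
pose h0 y := g (r^-1 * y); pose h1 y := r^-1 * g1 (r^-1 * y).
pose h2 y := r^-1 * (r^-1 * g2 (r^-1 * y)).
pose h3 y := r^-1 * (r^-1 * (r^-1 * g3 (r^-1 * y))).
pose h4 y := r^-1 * (r^-1 * (r^-1 * (r^-1 * g4 (r^-1 * y)))).
have dh0 y : is_derive y (1 : R) h0 (h1 y) by exact: is_derive_dilate.
have dh1 y : is_derive y (1 : R) h1 (h2 y).
  by apply: is_derive_scale; exact: is_derive_dilate.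
have dh2 y : is_derive y (1 : R) h2 (h3 y).
  by do 2 apply: is_derive_scale; exact: is_derive_dilate.
have dh3 y : is_derive y (1 : R) h3 (h4 y).
  by do 3 apply: is_derive_scale; exact: is_derive_dilate.
have ch0 : continuous h0 by exact: is_derive_continuous dh0.
have ch2 : continuous h2 by exact: is_derive_continuous dh2.
have ch4 : continuous h4.
  move=> y; do 4 (apply: cvgM; first exact: cvg_cst).
  exact: (elementary_continuous (elementary_dilate r eg4)).
have Br0 : 0 <= B * r by rewrite mulr_ge0// ltW.
have s0' y : B <= `|y| -> g y = 0 by move=> h; apply: gb; rewrite /B in h; lra.
have s1' y : B <= `|y| -> g1 y = 0 by move=> h; apply: s1; rewrite /B in h; lra.
have s2' y : B <= `|y| -> g2 y = 0 by move=> h; apply: s2; rewrite /B in h; lra.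
have s3' y : B <= `|y| -> g3 y = 0 by move=> h; apply: s3; rewrite /B in h; lra.
have z0 y : B * r <= `|y| -> h0 y = 0 by move=> h; exact: (rB g).
have z1 y : B * r <= `|y| -> h1 y = 0 by move=> h; rewrite /h1 (rB g1)// mulr0.
have z2 y : B * r <= `|y| -> h2 y = 0 by move=> h; rewrite /h2 (rB g2)// !mulr0.
have z3 y : B * r <= `|y| -> h3 y = 0 by move=> h; rewrite /h3 (rB g3)// !mulr0.
have z4 y : B * r <= `|y| -> h4 y = 0 by move=> h; rewrite /h4 (rB g4)// !mulr0.
have b0' y : `|h0 y| <= M0 by exact: HM0.
have b2 y : `|h2 y| <= r^-1 * (r^-1 * M2).
  by rewrite /h2 !normrM gtr0_norm ?invr_gt0// !ler_pM2l ?invr_gt0.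
have b4 y : `|h4 y| <= r^-1 * (r^-1 * (r^-1 * (r^-1 * M4))).
  by rewrite /h4 !normrM gtr0_norm ?invr_gt0// !ler_pM2l ?invr_gt0.
have m0 := continuous_measurable_fun ch0.
have m2 := continuous_measurable_fun ch2.
have m4 := continuous_measurable_fun ch4.
have [i0 _] := integrable_bounded_support m0 b0' z0 Br0.
have [i2 _] := integrable_bounded_support m2 b2 z2 Br0.
have [i4 _] := integrable_bounded_support m4 b4 z4 Br0.
have e2 := cos_transform_derive2 xi dh0 dh1 ch2 i0 i2 z0 z1.
have e4 := cos_transform_derive2 xi dh2 dh3 ch4 i2 i4 z2 z3.
have E : cos_transform h4 xi = xi ^+ 4 * cos_transform h0 xi by rewrite e4 e2; ring.
have n0 := cos_transform_norm_le xi m0 b0' z0 Br0.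
have n4 := cos_transform_norm_le xi m4 b4 z4 Br0.
rewrite E normrM in n4.
rewrite mulrDr mulr1 [leRHS]mulrAC mulrDr lerD//; first by apply: le_trans n0 _; lra.
rewrite exprMn mulrCA -(ler_pM2l (_ : 0 < r ^- 4)) ?invr_gt0 ?exprn_gt0//.
have x4 : 0 <= xi ^+ 4 by exact: exprn_even_ge0.
rewrite mulKf ?expf_neq0// mulrC; rewrite (ger0_norm x4) in n4.
apply: (le_trans n4); rewrite le_eqVlt; apply/orP; left; apply/eqP; by field.
Qed.

(** The factor [r] makes the integral independent of the scale, so that bounds by this weight are
    uniform in [r]. *)
Definition cauchy_weight r xi : R := r / (1 + (r * xi) ^+ 2).

Lemma cauchy_weight_ge0 r xi : 0 <= r -> 0 <= cauchy_weight r xi.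
Proof. by move=> r0; rewrite /cauchy_weight divr_ge0// addr_ge0 ?sqr_ge0. Qed.

Lemma integral_cauchy_weight r : 0 < r ->
  mu.-integrable setT (EFin \o cauchy_weight r) /\
  \int[mu]_xi cauchy_weight r xi = pi.
Proof.
move=> r0.
have d1E : (fun x => r * x)^`()%classic = cst r.
  by apply/funext => x; rewrite derive1E; have [_ ->] := is_derive_mulc r x.
have E : (\int[mu]_x (cauchy_weight r x)%:E = pi%:E)%E.
  have -> : (\int[mu]_x (cauchy_weight r x)%:E = \int[mu]_x ((oneDsqr x)^-1)%:E)%E.
    rewrite (@increasing_ge0_integration_by_substitutionT R (fun x => r * x)
       (fun x => (oneDsqr x)^-1)).
    - by apply: eq_integral => x _; rewrite d1E /cauchy_weight mulrC.
    - by move=> x y; rewrite ltr_pM2l.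
    - by rewrite d1E => ?; exact: cvg_cst.
    - by rewrite d1E; exact: is_cvg_cst.
    - by rewrite d1E; exact: is_cvg_cst.
    - by move=> x; have [] := is_derive_mulc r x.
    - by apply/gt0_cvgMrNy => //; exact: cvg_id.
    - by apply/gt0_cvgMry => //; exact: cvg_id.
    - exact: continuous_oneDsqrV.
    - by move=> x; rewrite invr_ge0 (le_trans ler01)// oneDsqr_ge1.
  rewrite ge0_symfun_integralT.
  - rewrite (_ : [set x | _] = `[0, +oo[%classic); last first.
      by apply/seteqP; split => x/=; rewrite in_itv/= andbT.
    by rewrite integral0y_oneDsqr -EFinM mulrC divfK.
  - by move=> x; rewrite invr_ge0 (le_trans ler01)// oneDsqr_ge1.
  - exact: continuous_oneDsqrV.
  - by move=> x/=; rewrite /oneDsqr sqrrN.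
have mc : measurable_fun setT (cauchy_weight r).
  apply: measurable_funM => //.
  rewrite (_ : (fun x => _) = (fun x => (oneDsqr x)^-1) \o (fun x => r * x))//.
  apply: measurableT_comp; last exact: measurable_funM.
  exact: continuous_measurable_fun (@continuous_oneDsqrV R).
split; last by rewrite /Rintegral E.
apply/integrableP; split; first exact/measurable_EFinP.
under eq_integral do rewrite /= ger0_norm ?cauchy_weight_ge0 ?ltW//.
by rewrite E ltry.
Qed.

(** Evenness reduces the Fourier transform to a cosine transform. All four conditions survive
    positive powers, so what holds for the bump also holds for its powers. *)
Definition profile g := [/\ elementary g, forall y, 0 <= g y <= 1,
  forall y, g (- y) = g y & forall y, 2 <= `|y| -> g y = 0].

Definition dilate g r y : R := g (r^-1 * y).

Lemma profileX g n : profile g -> profile (fun y => g y ^+ n.+1).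
Proof.
move=> [eg g01 ge gs]; split.
- exact: elementaryX.
- by move=> y; have /andP[? ?] := g01 y; rewrite exprn_ge0//= exprn_ile1.
- by move=> y; rewrite ge.
- by move=> y y2; rewrite gs// expr0n.
Qed.

Lemma profile_integrable g r : profile g -> 0 < r ->
  mu.-integrable setT (EFin \o dilate g r).
Proof.
move=> [eg g01 ge gs] r0.
have c := elementary_continuous (elementary_dilate r eg).
have [] // := @integrable_bounded_support R (dilate g r) 1 (2 * r).
- exact: continuous_measurable_fun.
- by move=> y; rewrite /dilate; have /andP[? ?] := g01 (r^-1 * y); rewrite ger0_norm.
- move=> y yr; apply: gs; rewrite normrM gtr0_norm ?invr_gt0// mulrC.
  by rewrite ler_pdivlMr.
- by rewrite mulr_ge0// ltW.
Qed.

(** By [(1 + t^2)^2 <= 2 (1 + t^4)] the quartic decay splits into two factors: one is the weight on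
    the left, the other the integrable Cauchy density. *)
Lemma profile_decay g : profile g -> exists2 C, 0 <= C & forall r xi, 0 < r ->
  `|cos_transform (dilate g r) xi| * (1 + (r * xi) ^+ 2) <= C * cauchy_weight r xi.
Proof.
move=> [eg g01 ge gs]; have [C C0 HC] := cos_transform_decay eg gs (ler0n _ 2).
exists (2 * C); first by rewrite mulr_ge0.
move=> r xi r0; have := HC r xi r0; set A := `|_|; set t := r * xi => H.
have t2 : 0 <= t ^+ 2 by exact: sqr_ge0.
rewrite /cauchy_weight -/t mulrA ler_pdivlMr; last lra.
have A0 : 0 <= A by exact: normr_ge0.
have -> : 2 * C * r = 2 * (C * r) by ring.
apply: le_trans (ler_wpM2l _ H) => //.
have -> : 2 * (A * (1 + t ^+ 4)) = A * (2 * (1 + t ^+ 4)) by ring.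
rewrite -mulrA ler_wpM2l// -subr_ge0.
have -> : 2 * (1 + t ^+ 4) - (1 + t ^+ 2) * (1 + t ^+ 2) = (1 - t ^+ 2) ^+ 2 by ring.
exact: sqr_ge0.
Qed.

Lemma profile_transform_integrable g r : profile g -> 0 < r ->
  mu.-integrable setT (EFin \o (fun xi =>
    cos_transform (dilate g r) xi * (1 + (r * xi) ^+ 2))).
Proof.
move=> pg r0; have [C C0 HC] := profile_decay pg.
have [ic _] := integral_cauchy_weight r0.
apply: (le_integrable_lebesgue (g := fun xi => C * cauchy_weight r xi)).
- apply: measurable_funM.
    apply: continuous_measurable_fun; apply: continuous_cos_transform.
    exact: profile_integrable.
  by apply: measurable_funD => //; apply: measurable_funX; exact: measurable_funM.
- move=> xi; rewrite normrM [X in _ * X]ger0_norm; first exact: HC.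
  by rewrite addr_ge0 ?sqr_ge0.
- exact: integrableRZ.
Qed.

Lemma profile_transform_integrable0 g r : profile g -> 0 < r ->
  mu.-integrable setT (EFin \o cos_transform (dilate g r)).
Proof.
move=> pg r0; have i := profile_transform_integrable pg r0.
apply: (le_integrable_lebesgue (g := fun xi =>
    `|cos_transform (dilate g r) xi * (1 + (r * xi) ^+ 2)|)).
- apply: continuous_measurable_fun; apply: continuous_cos_transform.
  exact: profile_integrable.
- move=> xi; rewrite normrM ler_peMr// ger0_norm ?addr_ge0 ?sqr_ge0//.
  by rewrite lerDl sqr_ge0.
- exact: integrable_norm.
Qed.

Lemma profile_inversion g r x : profile g -> 0 < r ->
  \int[mu]_xi (cos_transform (dilate g r) xi * cos (x * xi)) = 2 * pi * dilate g r x.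
Proof.
move=> pg r0; have [eg g01 ge gs] := pg.
have [g' eg' dg] := elementary_derive (elementary_dilate r eg).
have z y : 2 * r <= `|y| -> g (r^-1 * y) = 0.
  move=> yr; apply: gs; rewrite normrM gtr0_norm ?invr_gt0// mulrC.
  by rewrite ler_pdivlMr.
have z' y : 2 * r + 1 <= `|y| -> g' y = 0.
  by move=> yr; apply: (support_derive dg z); lra.
have [M M0 HM] := continuous_support_bounded (elementary_continuous eg') z'.
apply: (@cos_transform_inversion _ _ _ M) => //.
- exact: profile_integrable.
- exact: profile_transform_integrable0.
- by move=> y; exact: g01.
- by move=> y; rewrite /dilate mulrN ge.
- move=> y1 y2; wlog y12 : y1 y2 / y1 < y2.
    move=> W; have [|/W|->] := ltgtP y1 y2; first exact: W.
      by rewrite distrC (distrC y2).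
    by rewrite !subrr normr0 mulr0.
  rewrite distrC (distrC y1).
  have [c _ ->] := @MVT R (dilate g r) g' y1 y2 y12 (fun y _ => dg y)
    (continuous_subspaceT (is_derive_continuous dg)).
  by rewrite normrM ler_wpM2r.
Qed.

(** The function [exp (-1/(4 - y^2))] on []-2, 2[], extended by 0. *)
Definition bump y : R := flat 1 (4 - y ^+ 2).

Lemma bump_profile : profile bump.
Proof.
split.
- apply: elementary_flat; apply: elementaryD; first exact: elementary_cst.
  rewrite (_ : (fun y => _) = fun y => -1 * y ^+ 2); last by apply/funext => y; ring.
  apply: elementaryM; first exact: elementary_cst; apply: elementaryX.
  by apply: (@elementary_lin _ _ idfun) => y; exact: cvg_id.
- move=> y; rewrite /bump /flat; case: ifP => [h|_]; last by rewrite lexx ler01.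
  rewrite hornerC mul1r expR_ge0/= -[leRHS]expR0 ler_expR oppr_le0 invr_ge0.
  exact: ltW.
- by move=> y; rewrite /bump sqrrN.
- move=> y y2; rewrite /bump /flat; case: ifPn => //; rewrite subr_gt0 ltNge.
  rewrite (_ : 4 <= y ^+ 2)// -(real_normK (num_real y)).
  by rewrite (_ : 4 = 2 ^+ 2) ?ler_sqr ?nnegrE//; ring.
Qed.

Lemma bump_ge y : `|y| <= 1 -> expR (-1) <= bump y.
Proof.
move=> y1; rewrite /bump /flat; have y2 : y ^+ 2 <= 1.
  by rewrite -(real_normK (num_real y)) exprn_ile1.
rewrite (_ : 0 < 4 - y ^+ 2); last lra.
rewrite hornerC mul1r ler_expR lerN2 invf_le1; lra.
Qed.

End profile.

(** * The fractional Laplacian of a product of bumps *)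
Section product_integrals.
Context {R : realType}.
Local Notation mu := (@lebesgue_measure R).

Lemma Rintegral_opp (f : R -> R) : mu.-integrable setT (EFin \o f) ->
  mu.-integrable setT (EFin \o (fun x => f (- x))) /\
  \int[mu]_x f (- x) = \int[mu]_x f x.
Proof.
move=> fi; have mf := integrableR_measurable fi.
have mN : measurable_fun setT (-%R : measurableTypeR R -> measurableTypeR R).
  exact: oppr_measurable.
have mfN : measurable_fun setT (fun x : R => f (- x)) by exact: measurableT_comp mf mN.
have eqN (g : R -> \bar R) : measurable_fun setT g -> (forall x, 0 <= g x)%E ->
    (\int[mu]_x g (- x)%R = \int[mu]_x g x)%E.
  move=> mg g0; rewrite -(@ge0_integral_pushforward _ _ _ _ _ _ mN mu setT)//.
  by apply: eq_measure_integral => A mA _; exact: lebesgue_measureN.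
have ifN : mu.-integrable setT (EFin \o (fun x => f (- x))).
  apply/integrableP; split; first exact/measurable_EFinP.
  rewrite (eqN (fun x => `|(f x)%:E|%E))//; first by case/integrableP: fi.
  by apply: measurableT_comp => //; exact/measurable_EFinP.
split => //; rewrite /Rintegral; congr fine.
rewrite -(@integral_pushforward _ _ _ _ _ _ mN mu setT (EFin \o f))//.
  by apply: eq_measure_integral => A mA _; exact: lebesgue_measureN.
exact/measurable_EFinP.
Qed.

Lemma Rintegral_even_sin (g : R -> R) xi : mu.-integrable setT (EFin \o g) ->
  (forall y, g (- y) = g y) ->
  mu.-integrable setT (EFin \o (fun y => g y * sin (y * xi))) /\
  \int[mu]_y (g y * sin (y * xi)) = 0.
Proof.
move=> gi ge; have mg := integrableR_measurable gi.
have ii : mu.-integrable setT (EFin \o (fun y => g y * sin (y * xi))).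
  apply: (le_integrable_lebesgue (g := fun y => `|g y|)).
  - apply: measurable_funM => //; apply: measurableT_comp; last exact: measurable_funM.
    exact: continuous_measurable_fun (@continuous_sin R).
  - by move=> y; rewrite normrM ler_piMr// sin_max.
  - exact: integrable_norm.
split => //; have [_] := Rintegral_opp ii.
under eq_Rintegral do rewrite ge mulNr sinN mulrN -mulN1r.
by rewrite RintegralZl// mulN1r; lra.
Qed.

(** [lebesgue_rV 0] is the Dirac mass at the only point of [R^0]: the base case of the inductions on
    the dimension. *)
Lemma Rintegral_rV0 (f : 'rV[R]_0 -> R) :
  (@lebesgue_rV R 0).-integrable setT (EFin \o f) /\ \int[lebesgue_rV 0]_x f x = f 0.
Proof.
have mf : measurable_fun setT f.
  move=> _ A mA; rewrite setTI.
  have [fA|fA] := pselect (A (f 0)).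
    rewrite (_ : _ @^-1` _ = setT)//; apply/seteqP; split => // x _ /=.
    by rewrite (thinmx0 x).
  rewrite (_ : _ @^-1` _ = set0)//; apply/seteqP; split => // x /=.
  by rewrite (thinmx0 x).
have mEf : measurable_fun setT (EFin \o f) by exact/measurable_EFinP.
have mAf : measurable_fun setT (fun x => `|(f x)%:E|%E) by exact: measurableT_comp.
split.
  apply/integrableP; split => //.
  by rewrite [X in (X < _)%E](integral_dirac (0 : 'rV[R]_0) measurableT mAf) diracT mul1e ltry.
rewrite /Rintegral [X in fine X](integral_dirac (0 : 'rV[R]_0) measurableT mEf).
by rewrite diracT mul1e.
Qed.

(** [lebesgue_rV n.+1] is the image of a product measure under [rV_cons], so Fubini applies after
    transport. *)
Lemma Rintegral_rV_mul n (a : R -> R) (b : 'rV[R]_n -> R) :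
  mu.-integrable setT (EFin \o a) -> (lebesgue_rV n).-integrable setT (EFin \o b) ->
  (lebesgue_rV n.+1).-integrable setT
    (EFin \o (fun x => a (rV_uncons x).1 * b (rV_uncons x).2)) /\
  \int[lebesgue_rV n.+1]_x (a (rV_uncons x).1 * b (rV_uncons x).2) =
  (\int[mu]_y a y) * (\int[lebesgue_rV n]_x b x).
Proof.
move=> ia ib; have ma := integrableR_measurable ia; have mb := integrableR_measurable ib.
pose f x := a (rV_uncons x).1 * b (@rV_uncons R n x).2.
pose h (z : measurableTypeR R * 'rV[R]_n) := a z.1 * b z.2.
have mf : measurable_fun setT f.
  apply: measurable_funM.
  - apply: (measurableT_comp ma).
    exact: measurableT_comp measurable_fst (@measurable_rV_uncons R n).
  - apply: (measurableT_comp mb).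
    exact: measurableT_comp measurable_snd (@measurable_rV_uncons R n).
have mh : measurable_fun setT h.
  apply: measurable_funM.
  - exact: (measurableT_comp ma measurable_fst).
  - exact: (measurableT_comp mb measurable_snd).
have ih : (mu \x lebesgue_rV n)%E.-integrable setT (EFin \o h).
  apply: (@integrable_prod_le _ _ _ _ _ mu (lebesgue_rV n) h
    (fun x => `|a x|) (fun x => `|b x|)) => //.
  - exact: integrable_norm.
  - exact: integrable_norm.
  - by move=> x y; rewrite normrM.
have fh : (EFin \o f) \o @rV_cons R n = EFin \o h.
  by apply/funext => z; rewrite /= /f rV_consK.
have mc := @measurable_rV_cons R n.
have mEf : measurable_fun setT (EFin \o f) by exact/measurable_EFinP.
split.
  by apply: (integrable_pushforward mc) => //; rewrite preimage_setT fh.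
rewrite /Rintegral (_ : (\int[lebesgue_rV n.+1]_x (f x)%:E =
    \int[mu \x lebesgue_rV n]_z (h z)%:E)%E); last first.
  rewrite (integral_pushforward mc (mu := (mu \x lebesgue_rV n)%E) mEf)//=.
    by rewrite preimage_setT; apply: eq_integral => z _; rewrite /f rV_consK.
  by rewrite preimage_setT fh.
rewrite -(integral12_prod_meas1 ih)/= /fubini_F /h/=.
transitivity (fine (\int[mu]_y ((a y)%:E * (\int[lebesgue_rV n]_x b x)%:E))%E).
  congr fine; apply: eq_integral => y _; under eq_integral do rewrite EFinM.
  rewrite integralZl//; congr (_ * _)%E; rewrite /Rintegral fineK//.
  exact: integrable_fin_num.
rewrite integralZr// fineM//; exact: integrable_fin_num.
Qed.

Lemma rV_uncons2E n (x : 'rV[R]_n.+1) i :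
  (rV_uncons x).2 ord0 i = x ord0 (lift ord0 i).
Proof. by rewrite mxE; congr (x _ _); exact: val_inj. Qed.

Lemma prod_rV_uncons n (g : 'I_n.+1 -> R -> R) (x : 'rV[R]_n.+1) :
  \prod_i g i (x ord0 i) = g ord0 (rV_uncons x).1 *
    \prod_i g (lift ord0 i) ((rV_uncons x).2 ord0 i).
Proof.
by rewrite big_ord_recl; congr (_ * _); apply: eq_bigr => i _; rewrite rV_uncons2E.
Qed.

Lemma dotrV_uncons n (x y : 'rV[R]_n.+1) :
  dotrV x y = (rV_uncons x).1 * (rV_uncons y).1 + dotrV (rV_uncons x).2 (rV_uncons y).2.
Proof.
rewrite /dotrV big_ord_recl; congr (_ + _).
by apply: eq_bigr => i _; rewrite !rV_uncons2E.
Qed.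

Lemma Rintegral_rV_prod n (g : 'I_n -> R -> R) :
  (forall i, mu.-integrable setT (EFin \o g i)) ->
  (lebesgue_rV n).-integrable setT (EFin \o (fun x : 'rV[R]_n => \prod_i g i (x ord0 i))) /\
  \int[lebesgue_rV n]_x (\prod_i g i (x ord0 i)) = \prod_i \int[mu]_y g i y.
Proof.
elim: n g => [|n IH] g gi.
  by have [i ->] := Rintegral_rV0 (fun x : 'rV[R]_0 => \prod_i g i (x ord0 i)); rewrite !big_ord0.
have [i1 e1] := IH (fun i => g (lift ord0 i)) (fun i => gi _).
have [i2 e2] := Rintegral_rV_mul (gi ord0) i1.
have E : (fun x : 'rV[R]_n.+1 => \prod_i g i (x ord0 i)) = fun x =>
    g ord0 (rV_uncons x).1 * \prod_i g (lift ord0 i) ((rV_uncons x).2 ord0 i).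
  by apply/funext => x; rewrite prod_rV_uncons.
by rewrite E e2 e1 big_ord_recl.
Qed.

(* The sine integral is carried along: the addition formulas mix both. *)
Lemma Rintegral_rV_prod_cos n (g : 'I_n -> R -> R) (xi : 'rV[R]_n) :
  (forall i, mu.-integrable setT (EFin \o g i)) ->
  (forall i y, g i (- y) = g i y) ->
  [/\ (lebesgue_rV n).-integrable setT
        (EFin \o (fun x : 'rV[R]_n => \prod_i g i (x ord0 i) * cos (dotrV x xi))),
      (lebesgue_rV n).-integrable setT
        (EFin \o (fun x : 'rV[R]_n => \prod_i g i (x ord0 i) * sin (dotrV x xi))),
      \int[lebesgue_rV n]_x (\prod_i g i (x ord0 i) * cos (dotrV x xi)) =
        \prod_i cos_transform (g i) (xi ord0 i) &
      \int[lebesgue_rV n]_x (\prod_i g i (x ord0 i) * sin (dotrV x xi)) = 0].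
Proof.
elim: n g xi => [|n IH] g xi gi ge.
  have [i1 e1] := Rintegral_rV0 (fun x : 'rV[R]_0 => \prod_i g i (x ord0 i) * cos (dotrV x xi)).
  have [i2 e2] := Rintegral_rV0 (fun x : 'rV[R]_0 => \prod_i g i (x ord0 i) * sin (dotrV x xi)).
  by split=> //; rewrite ?e1 ?e2 /dotrV !big_ord0 ?cos0 ?sin0 ?mulr1 ?mulr0.
have [ic is' ec es] := IH (fun i => g (lift ord0 i)) (rV_uncons xi).2
  (fun i => gi _) (fun i => ge _).
set xi0 := (rV_uncons xi).1.
have c1 := integrable_cosM xi0 (gi ord0).
have [s1 s10] := Rintegral_even_sin xi0 (gi ord0) (ge ord0).
have [cc ecc] := Rintegral_rV_mul c1 ic; have [ss ess] := Rintegral_rV_mul s1 is'.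
have [sc esc] := Rintegral_rV_mul s1 ic; have [cs ecs] := Rintegral_rV_mul c1 is'.
have Ec : (fun x : 'rV[R]_n.+1 => \prod_i g i (x ord0 i) * cos (dotrV x xi)) = fun x =>
  g ord0 (rV_uncons x).1 * cos ((rV_uncons x).1 * xi0) *
  (\prod_i g (lift ord0 i) ((rV_uncons x).2 ord0 i) * cos (dotrV (rV_uncons x).2 (rV_uncons xi).2)) -
  g ord0 (rV_uncons x).1 * sin ((rV_uncons x).1 * xi0) *
  (\prod_i g (lift ord0 i) ((rV_uncons x).2 ord0 i) * sin (dotrV (rV_uncons x).2 (rV_uncons xi).2)).
  by apply/funext => x; rewrite prod_rV_uncons dotrV_uncons cosD; ring.
have Es : (fun x : 'rV[R]_n.+1 => \prod_i g i (x ord0 i) * sin (dotrV x xi)) = fun x =>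
  g ord0 (rV_uncons x).1 * sin ((rV_uncons x).1 * xi0) *
  (\prod_i g (lift ord0 i) ((rV_uncons x).2 ord0 i) * cos (dotrV (rV_uncons x).2 (rV_uncons xi).2)) +
  g ord0 (rV_uncons x).1 * cos ((rV_uncons x).1 * xi0) *
  (\prod_i g (lift ord0 i) ((rV_uncons x).2 ord0 i) * sin (dotrV (rV_uncons x).2 (rV_uncons xi).2)).
  by apply/funext => x; rewrite prod_rV_uncons dotrV_uncons sinD; ring.
have e1 : \int[lebesgue_rV n.+1]_x (\prod_i g i (x ord0 i) * cos (dotrV x xi)) =
    \prod_i cos_transform (g i) (xi ord0 i).
  rewrite Ec RintegralB// ecc ess s10 mul0r subr0 ec big_ord_recl.
  by congr (_ * _); apply: eq_bigr => i _; rewrite rV_uncons2E.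
have e2 : \int[lebesgue_rV n.+1]_x (\prod_i g i (x ord0 i) * sin (dotrV x xi)) = 0.
  by rewrite Es RintegralD// esc ecs s10 es mul0r mulr0 addr0.
have i1 : (lebesgue_rV n.+1).-integrable setT
    (EFin \o (fun x : 'rV[R]_n.+1 => \prod_i g i (x ord0 i) * cos (dotrV x xi))).
  by rewrite Ec; exact: integrableRB.
have i2 : (lebesgue_rV n.+1).-integrable setT
    (EFin \o (fun x : 'rV[R]_n.+1 => \prod_i g i (x ord0 i) * sin (dotrV x xi))).
  by rewrite Es; exact: integrableRD.
by split.
Qed.

End product_integrals.

(** * Fractional powers as superpositions of heat flows *)

Section subordination.
Context {R : realType}.
Local Notation mu := (@lebesgue_measure R).

Lemma onem_expRN_bound (x : R) : 0 <= x ->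
  0 <= 1 - expR (- x) /\ 1 - expR (- x) <= Num.min 1 x.
Proof.
move=> x0; split; first by rewrite subr_ge0 -[leRHS]expR0 ler_expR oppr_le0.
rewrite le_min; apply/andP; split; first by rewrite gerBl expR_ge0.
have := expR_ge1Dx (- x); lra.
Qed.

(* The subordinator [s^(-1-al) ds] of [a^al], written in the variable [tau = ln s]. *)
Definition subordinator (al : R) (tau : R) : R :=
  (1 - expR (- expR tau)) * expR (- (al * tau)).

(** The integrand of [int (1 - exp (-a s)) s^(-1-al) ds] after [s = exp tau]; dilations in [s]
    become translations in [tau]. *)
Definition stable_weight (al a tau : R) : R :=
  (1 - expR (- (a * expR tau))) * expR (- (al * tau)).

Lemma continuous_expRM (c : R) : continuous (fun tau : R => expR (c * tau)).
Proof.
move=> t; apply: (cvg_comp _ expR); last exact: continuous_expR.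
by apply: cvgM; [exact: cvg_cst|exact: cvg_id].
Qed.

Lemma continuous_subordinator al : continuous (subordinator al).
Proof.
move=> t; apply: cvgM.
  apply: cvgB; first exact: cvg_cst.
  apply: (cvg_comp _ expR); last exact: continuous_expR.
  by apply: (@cvgN _ R^o); exact: continuous_expR.
by under eq_fun do rewrite -mulNr; rewrite -mulNr; exact: continuous_expRM.
Qed.

Lemma stable_weight_ge0 al a tau : 0 <= a -> 0 <= stable_weight al a tau.
Proof.
move=> a0; rewrite mulr_ge0 ?expR_ge0//.
by have [] := @onem_expRN_bound (a * expR tau) _; rewrite ?mulr_ge0 ?expR_ge0.
Qed.

(** For [tau >= 0] use [1 - exp (-x) <= 1] and the rate [al]; for [tau < 0] use [1 - exp (-x) <= x]
    and the rate [1 - al]. The resulting [exp (-b |tau|)] is replaced by a Cauchy weight, whose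
    integral is known. The factor [1 + a] covers both cases and is the weight in the hypotheses of
    [subordination]. *)
Lemma stable_weight_le (al a b tau : R) : 0 < b -> b <= al -> b <= 1 - al -> 0 <= a ->
  stable_weight al a tau <= (1 + a) * (2 / b * cauchy_weight (b / 2) tau).
Proof.
move=> b0 bal bal1 a0.
have E : expR (- (b * `|tau|)) <= 2 / b * cauchy_weight (b / 2) tau.
  have -> : 2 / b * cauchy_weight (b / 2) tau = (1 + (b / 2 * tau) ^+ 2)^-1.
    by rewrite /cauchy_weight mulrA; have -> : 2 / b * (b / 2) = 1; [field; rewrite gt_eqF|rewrite mul1r].
  have p0 : 0 < 1 + (b / 2 * tau) ^+ 2 by rewrite ltr_pwDl ?sqr_ge0.
  rewrite expRN lef_pV2 ?posrE ?expR_gt0//.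
  set w := b / 2 * `|tau|; have w0 : 0 <= w by rewrite !mulr_ge0// ?invr_ge0 ltW.
  have -> : (b / 2 * tau) ^+ 2 = w ^+ 2 by rewrite /w !exprMn real_normK ?num_real.
  have -> : b * `|tau| = w + w by rewrite /w; field.
  rewrite expRD; have h := expR_ge1Dx w.
  apply: (@le_trans _ _ ((1 + w) * (1 + w))); first by nra.
  by apply: ler_pM => //; lra.
apply: le_trans (ler_wpM2l _ E); last by rewrite addr_ge0.
have /= [h0 h1] := @onem_expRN_bound (a * expR tau) (mulr_ge0 a0 (expR_ge0 _)).
move: h1; rewrite le_min => /andP[h1 h2]; rewrite /stable_weight.
have [t0|t0] := leP 0 tau.
  apply: ler_pM; rewrite ?expR_ge0//; first lra.
  by rewrite ler_expR lerN2 ger0_norm// ler_wpM2r.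
apply: (@le_trans _ _ (a * expR tau * expR (- (al * tau)))).
  by rewrite ler_wpM2r ?expR_ge0.
rewrite -mulrA -expRD; apply: ler_pM; rewrite ?expR_ge0//; first lra.
rewrite ler_expR ltr0_norm//; nra.
Qed.

Lemma stable_rate (al : R) : 0 < al < 1 -> exists b, [/\ 0 < b, b <= al & b <= 1 - al].
Proof.
move=> /andP[al0 al1]; exists (Num.min al (1 - al)).
by rewrite lt_min al0 subr_gt0 al1 !ge_min !lexx orbT.
Qed.

Lemma integrable_stable_weight (al a : R) : 0 < al < 1 -> 0 <= a ->
  mu.-integrable setT (EFin \o stable_weight al a).
Proof.
move=> al01 a0; have /andP[al0 al1] := al01.
have [b [b0 bal bal1]] := stable_rate al01.
apply: (le_integrable_lebesgue (g := fun tau =>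
    (1 + a) * (2 / b * cauchy_weight (b / 2) tau))).
- have me : measurable_fun setT (@expR R) by [].
  apply: measurable_funM; last first.
    by apply: measurableT_comp => //; apply: measurableT_comp => //; exact: measurable_funM.
  apply: measurable_funB => //; apply: measurableT_comp => //.
  by apply: measurableT_comp => //; exact: measurable_funM.
- by move=> tau; rewrite ger0_norm ?stable_weight_ge0// stable_weight_le.
- do 2 apply: integrableRZ => //.
  by have [] := @integral_cauchy_weight R (b / 2) (divr_gt0 b0 (ltr0n _ 2)).
Qed.

(** For [a > 0] the weight is [a^al] times the subordinator translated by [ln a], and Lebesgue
    measure is translation invariant. *)
Lemma Rintegral_stable_weight (al a : R) : 0 < al < 1 -> 0 <= a ->
  \int[mu]_tau stable_weight al a tau = a `^ al * \int[mu]_tau subordinator al tau.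
Proof.
move=> al01; have /andP[al0 al1] := al01; rewrite le_eqVlt => /predU1P[<-|a0].
  rewrite powR0 ?gt_eqF// mul0r; under eq_Rintegral do
    rewrite /stable_weight mul0r oppr0 expR0 subrr mul0r.
  by rewrite Rintegral_cst// mul0r.
have sE : subordinator al = stable_weight al 1.
  by apply/funext => t; rewrite /stable_weight mul1r.
have wE tau : stable_weight al a tau = a `^ al * subordinator al (tau + ln a).
  rewrite /stable_weight /subordinator expRD lnK ?posrE// mulrCA (mulrC a).
  rewrite /powR gt_eqF//; congr (_ * _); rewrite -expRD; congr expR; ring.
have is' : mu.-integrable setT (EFin \o subordinator al).
  by rewrite sE; exact: integrable_stable_weight.
have s0 tau : 0 <= subordinator al tau by rewrite sE stable_weight_ge0.
have d1 x : is_derive x (1 : R) (fun t => t + ln a) 1.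
  by apply: is_derive_eq; rewrite addr0.
have d1E : (fun x => x + ln a)^`()%classic = cst 1.
  by apply/funext => x; rewrite derive1E; have [_ ->] := d1 x.
have sh : (\int[mu]_x (subordinator al x)%:E = \int[mu]_x (subordinator al (x + ln a))%:E)%E.
  rewrite (@increasing_ge0_integration_by_substitutionT R (fun x => x + ln a)).
  - by apply: eq_integral => x _; rewrite d1E /= !fctE /= mulr1.
  - by move=> x y xy; rewrite ltrD2r.
  - by rewrite d1E => ?; exact: cvg_cst.
  - by rewrite d1E; exact: is_cvg_cst.
  - by rewrite d1E; exact: is_cvg_cst.
  - by move=> x; have [] := d1 x.
  - exact: cvg_addrr_Ny.
  - exact: cvg_addrr.
  - exact: continuous_subordinator.
  - exact: s0.
under eq_Rintegral do rewrite wE.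
have ish : mu.-integrable setT (EFin \o (fun tau => subordinator al (tau + ln a))).
  have := integrable_stable_weight al01 (ltW a0).
  rewrite (_ : stable_weight al a = fun tau => a `^ al * subordinator al (tau + ln a)).
    move=> /(integrableRZ measurableT (a `^ al)^-1).
    rewrite (_ : (fun x => (a `^ al)^-1 * (a `^ al * subordinator al (x + ln a))) =
      fun tau => subordinator al (tau + ln a))//.
    by apply/funext => x; rewrite mulKf// gt_eqF// powR_gt0.
  by apply/funext => x; rewrite wE.
by rewrite RintegralZl//; congr (_ * _); rewrite /Rintegral -sh.
Qed.

(** Only the sign of this normalising constant matters later. On [[0, 1]] the integrand is at least
    [(1 - exp (-1)) exp (-1)]. *)
Lemma Rintegral_subordinator_gt0 (al : R) : 0 < al < 1 -> 0 < \int[mu]_tau subordinator al tau.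
Proof.
move=> al01; have /andP[al0 al1] := al01.
have sE : subordinator al = stable_weight al 1.
  by apply/funext => t; rewrite /stable_weight mul1r.
pose c : R := (1 - expR (-1)) * expR (-1).
have c0 : 0 < c by rewrite mulr_gt0 ?expR_gt0// subr_gt0 -[ltRHS]expR0 ltr_expR; lra.
apply: (@lt_le_trans _ _ c) => //.
have -> : c = \int[mu]_tau (c * \1_(`[(0 : R), (1 : R)]%classic) tau).
  rewrite RintegralZl//; last exact: integrable_indic_itv.
  have E : (\int[mu]_x (\1_(`[(0 : R), (1 : R)]%classic) x)%:E = 1%:E)%E.
    have muI : mu (`[(0 : R), (1 : R)]%classic) = 1%:E.
      by rewrite lebesgue_measure_itv/= lte01 oppr0 adde0.
    by rewrite integral_indic// setIT; exact: muI.
  by rewrite /Rintegral E mulr1.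
apply: le_Rintegral => //.
- by apply: integrableRZ => //; exact: integrable_indic_itv.
- by rewrite sE; exact: integrable_stable_weight.
move=> t _; rewrite indicE; case: (boolP (t \in _)) => [|_]; last first.
  by rewrite mulr0 sE stable_weight_ge0.
rewrite inE/= in_itv/= => /andP[t0 t1]; rewrite mulr1 /c /subordinator.
have e1 : 1 <= expR t by rewrite -[leLHS]expR0 ler_expR.
have e2 : 0 <= 1 - expR (-1) :> R by rewrite subr_ge0 -[leRHS]expR0 ler_expR; lra.
apply: ler_pM; rewrite ?expR_ge0//.
- by rewrite lerD2l lerN2 ler_expR; lra.
- by rewrite ler_expR; nra.
Qed.

Lemma cvg_expR_quotient (a : R) : 0 <= a ->
  n.+1%:R * (1 - expR (- (n.+1%:R^-1 * a))) @[n --> \oo] --> a.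
Proof.
move=> a0; apply/subr_cvg0; apply: norm_cvg0.
apply: (@squeeze_cvgr _ _ _ _ (fun=> 0) (fun n => a ^+ 2 * harmonic n)).
- apply: nearW => n; rewrite normr_ge0/= /harmonic/=.
  set m : R := n.+1%:R; have m0 : 0 < m by rewrite ltr0n.
  set x := m^-1 * a; have x0 : 0 <= x by rewrite mulr_ge0// invr_ge0 ltW.
  have -> : a = m * x by rewrite /x mulVKf// gt_eqF.
  have [h1 h2] := onem_expRN_bound x0; move: h2; rewrite le_min => /andP[_ h2].
  have h3 : x - x ^+ 2 <= 1 - expR (- x).
    have e : expR (- x) * (1 + x) <= 1.
      apply: (@le_trans _ _ (expR (- x) * expR x)).
        by rewrite ler_wpM2l ?expR_ge0 ?expR_ge1Dx.
      by rewrite -expRD addNr expR0.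
    have e0 := expR_ge0 (- x).
    by have e1 : expR (- x) <= 1; [lra|nra].
  rewrite -mulrBr normrM gtr0_norm// ler0_norm; last lra.
  have -> : (m * x) ^+ 2 / m = m * x ^+ 2 by field; rewrite gt_eqF.
  apply: ler_wpM2l; [exact: ltW|lra].
- exact: cvg_cst.
- by rewrite -(mulr0 (a ^+ 2)); apply: cvgM; [exact: cvg_cst|exact: cvg_harmonic].
Qed.

(** [a^(theta/2)] is a positive superposition of the functions [1 - exp (-s a)], so nonnegativity
    passes from them to it. For [theta = 2] the superposition degenerates, and [a] is instead the
    limit of [(n+1) (1 - exp (-a/(n+1)))]. In the application [a = |xi|^2], and the last hypothesis
    is a statement on the heat flow. *)
Lemma subordination d (T : measurableType d)
    (m : {sigma_finite_measure set T -> \bar R}) (a q : T -> R) (theta : R) :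
  0 < theta <= 2 -> measurable_fun setT a -> (forall t, 0 <= a t) ->
  measurable_fun setT q -> m.-integrable setT (EFin \o (fun t => q t * (1 + a t))) ->
  (forall s, 0 < s -> 0 <= \int[m]_t ((1 - expR (- (s * a t))) * q t)) ->
  0 <= \int[m]_t (a t `^ (theta / 2) * q t).
Proof.
move=> /andP[th0 th2] ma a0 mq iq H.
have me s : measurable_fun setT (fun t => 1 - expR (- (s * a t))).
  apply: measurable_funB => //; apply: measurableT_comp => //.
  by apply: measurableT_comp => //; exact: measurable_funM.
move: th2; rewrite le_eqVlt => /predU1P[th2|th2].
  have [||||_ C] := @Rintegral_dominated_cvg _ _ R m setT
    (fun n t => n.+1%:R * ((1 - expR (- (n.+1%:R^-1 * a t))) * q t))
    (fun t => a t `^ (theta / 2) * q t) (fun t => `|q t * (1 + a t)|) measurableT.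
  - by move=> n; apply: measurable_funM => //; exact: measurable_funM.
  - move=> t _; rewrite th2 divff// powRr1//.
    under eq_fun do rewrite mulrA; apply: cvgM; last exact: cvg_cst.
    exact: cvg_expR_quotient.
  - exact: integrable_norm.
  - move=> n t _; set x := n.+1%:R^-1 * a t.
    have x0 : 0 <= x by rewrite mulr_ge0// invr_ge0.
    have [h1 h2] := onem_expRN_bound x0; move: h2; rewrite le_min => /andP[_ h2].
    rewrite !normrM mulrA (ger0_norm h1) [leRHS]mulrC ler_wpM2r//.
    rewrite !ger0_norm ?addr_ge0//.
    apply: (@le_trans _ _ (n.+1%:R * x)); first by rewrite ler_wpM2l.
    by rewrite /x mulVKf// ?lerDr// pnatr_eq0.
  rewrite -(cvg_lim (@Rhausdorff R) C); apply: limr_ge.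
    by apply/cvg_ex; eexists; exact: C.
  apply: nearW => n; rewrite RintegralZl//.
    by rewrite mulr_ge0//; apply: H; rewrite invr_gt0.
  apply: (le_integrableR (g := fun t => `|q t * (1 + a t)|)) => //.
  - exact: measurable_funM.
  - move=> t _; set x := n.+1%:R^-1 * a t.
    have x0 : 0 <= x by rewrite mulr_ge0// invr_ge0.
    have [h1 h2] := onem_expRN_bound x0; move: h2; rewrite le_min => /andP[h2 _].
    rewrite !normrM (ger0_norm h1) [leRHS]mulrC ler_wpM2r//.
    rewrite ger0_norm ?addr_ge0//; apply: (le_trans h2).
    by rewrite lerDl.
  - exact: integrable_norm.
set al := theta / 2; have al01 : 0 < al < 1 by rewrite /al; lra.
pose F (z : measurableTypeR R * T) := stable_weight al (a z.2) z.1 * q z.2.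
have [b [b0 bal bal1]] := stable_rate al01.
pose W tau := 2 / b * cauchy_weight (b / 2) tau.
have iW : mu.-integrable setT (EFin \o W).
  apply: integrableRZ => //.
  by have [] := @integral_cauchy_weight R (b / 2) (divr_gt0 b0 (ltr0n _ 2)).
have mF : measurable_fun setT F.
  apply: measurable_funM; last exact: (measurableT_comp mq measurable_snd).
  have m1 : measurable_fun setT (fun z : measurableTypeR R * T => z.1 : R) by exact: measurable_fst.
  have m2 : measurable_fun setT (fun z : measurableTypeR R * T => a z.2).
    exact: (measurableT_comp ma measurable_snd).
  apply: measurable_funM; last first.
    by apply: measurableT_comp => //; apply: measurableT_comp => //; exact: measurable_funM.
  apply: measurable_funB => //; apply: measurableT_comp => //.
  apply: measurableT_comp => //; apply: measurable_funM => //.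
  exact: measurableT_comp.
have FW tau t : `|F (tau, t)| <= W tau * `|q t * (1 + a t)|.
  rewrite /F/= normrM ger0_norm ?stable_weight_ge0// normrM mulrCA mulrC ler_wpM2l//.
  rewrite (ger0_norm (_ : 0 <= 1 + a t)) ?addr_ge0// [leRHS]mulrC.
  exact: stable_weight_le.
have iF : (mu \x m)%E.-integrable setT (EFin \o F).
  apply: (@integrable_prod_le _ _ _ _ _ mu m F W (fun t => `|q t * (1 + a t)|)) => //.
  exact: integrable_norm.
have iF1 tau : m.-integrable setT (fun t => (F (tau, t))%:E).
  apply: (@le_integrableR _ _ _ _ _ (fun t => F (tau, t)) (fun t => W tau * `|q t * (1 + a t)|)) => //.
  - exact: (measurableT_comp mF (measurable_pair1 tau)).
  - by apply: integrableRZ => //; exact: integrable_norm.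
have iF2 t : mu.-integrable setT (fun tau => (F (tau, t))%:E).
  rewrite (_ : (fun tau => _) = EFin \o (fun tau => q t * stable_weight al (a t) tau)).
    by apply: integrableRZ => //; exact: integrable_stable_weight.
  by apply/funext => tau; rewrite /F/= mulrC.
have K0 := Rintegral_subordinator_gt0 al01.
(* Multiplied by the normalising constant, the integrand becomes the [tau]-integral of [F]; after
   Fubini every inner integral is nonnegative. *)
rewrite -(pmulr_rge0 _ K0).
rewrite (_ : _ * _ = \int[m]_t \int[mu]_tau F (tau, t)); last first.
  rewrite -RintegralZl//.
    apply: eq_Rintegral => t _; rewrite /F/=.
    under [in RHS]eq_Rintegral do rewrite mulrC.
    rewrite RintegralZl//; last exact: integrable_stable_weight.
    rewrite [X in _ = _ * X](Rintegral_stable_weight al01 (a0 t)).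
    by move: (Rintegral _ _ _) => K; ring.
  apply: (le_integrableR (g := fun t => `|q t * (1 + a t)|)) => //.
  - apply: measurable_funM => //; exact: (measurableT_comp (measurable_powR _)).
  - move=> t _; rewrite !normrM [leRHS]mulrC ler_wpM2r//.
    rewrite !ger0_norm ?powR_ge0 ?addr_ge0//.
    have [a1|a1] := leP 1 (a t).
      rewrite (@le_trans _ _ (a t `^ 1))//; last by rewrite powRr1// lerDr.
      by rewrite ler_powR// ltW//; case/andP: al01.
    rewrite (@le_trans _ _ 1) ?lerDl//.
    have al0 : 0 <= al by case/andP: al01 => /ltW.
    have := @ge0_ler_powR R al al0 (a t) 1; rewrite !nnegrE powR1.
    by apply => //; exact: ltW.
  - exact: integrable_norm.
rewrite -(Rintegral_Fubini iF iF1 iF2); apply: Rintegral_ge0 => tau _.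
rewrite (_ : Rintegral _ _ _ = expR (- (al * tau)) *
   \int[m]_t ((1 - expR (- (expR tau * a t))) * q t)).
  by rewrite mulr_ge0 ?expR_ge0// H// expR_gt0.
rewrite -RintegralZl//.
  by apply: eq_Rintegral => t _; rewrite /F /stable_weight/= (mulrC (a t)); ring.
have := integrableRZ measurableT (expR (al * tau)) (iF1 tau).
rewrite (_ : (fun t => expR (al * tau) * F (tau, t)) =
  fun t => (1 - expR (- (expR tau * a t))) * q t)//.
apply/funext => t; rewrite /F /stable_weight/= (mulrC (a t)).
transitivity (expR (al * tau) * expR (- (al * tau)) *
  ((1 - expR (- (expR tau * a t))) * q t)); first by ring.
by rewrite -expRD addrN expR0 mul1r.
Qed.

End subordination.

Section fractional_laplacian.
Context {R : realType} {N : nat}.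
Local Notation mu := (@lebesgue_measure R).
Local Notation lam := (@lebesgue_rV R N).
Implicit Types (g : R -> R) (x xi : 'rV[R]_N) (r theta : R).

Definition tensor g r x : R := \prod_(i < N) dilate g r (x ord0 i).

Definition tensor_transform g r xi : R :=
  \prod_(i < N) cos_transform (dilate g r) (xi ord0 i).

Lemma dotrVC x xi : dotrV x xi = dotrV xi x.
Proof. by apply: eq_bigr => i _; rewrite mulrC. Qed.

Lemma dotrV_ge0 xi : 0 <= dotrV xi xi.
Proof. by apply: sumr_ge0 => i _; rewrite -expr2 sqr_ge0. Qed.

Lemma measurable_dotrV x : measurable_fun setT (fun xi => dotrV xi x).
Proof.
apply: measurable_sum => i; apply: measurable_funM => //.
exact: (measurable_rV_coord i).
Qed.

Lemma measurable_dotrVV : measurable_fun setT (fun xi : 'rV[R]_N => dotrV xi xi).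
Proof.
by apply: measurable_sum => i; apply: measurable_funM; exact: (measurable_rV_coord i).
Qed.

Lemma cos_transformN g z : cos_transform g (- z) = cos_transform g z.
Proof. by apply: eq_Rintegral => y _; rewrite mulrN cosN. Qed.

Lemma onemD_sum_le_prod (b : 'I_N -> R) : (forall i, 0 <= b i) ->
  1 + \sum_i b i <= \prod_i (1 + b i).
Proof.
move=> b0; suff [] : 1 + \sum_i b i <= \prod_i (1 + b i) /\ 0 <= \sum_i b i by [].
apply: (big_ind2 (fun s p => 1 + s <= p /\ 0 <= s)).
- by rewrite addr0.
- move=> s1 p1 s2 p2 [h1 s10] [h2 s20]; split; last exact: addr_ge0.
  apply: (@le_trans _ _ ((1 + s1) * (1 + s2))); first by nra.
  by apply: ler_pM => //; rewrite addr_ge0.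
- by move=> i _.
Qed.

(** The radial weight is bounded by a product of one-dimensional ones, so that decay in each
    coordinate suffices. *)
Lemma dilate_dotrV_le r xi : 1 + r ^+ 2 * dotrV xi xi <= \prod_i (1 + (r * xi ord0 i) ^+ 2).
Proof.
apply: le_trans (onemD_sum_le_prod _); last by move=> i; exact: sqr_ge0.
rewrite /dotrV mulr_sumr lerD2l; apply: ler_sum => i _.
by rewrite exprMn -expr2.
Qed.

Lemma tensor_transform_integrable g r : profile g -> 0 < r ->
  lam.-integrable setT (EFin \o (fun xi => tensor_transform g r xi *
    \prod_i (1 + (r * xi ord0 i) ^+ 2))).
Proof.
move=> pg r0.
have [ii _] := @Rintegral_rV_prod R N (fun _ z => cos_transform (dilate g r) z * (1 + (r * z) ^+ 2))
  (fun=> profile_transform_integrable pg r0).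
rewrite (_ : (fun xi => _) = fun xi : 'rV[R]_N =>
  \prod_i (cos_transform (dilate g r) (xi ord0 i) * (1 + (r * xi ord0 i) ^+ 2)))//.
by apply/funext => xi; rewrite big_split.
Qed.

Lemma measurable_tensor_transform g r : profile g -> 0 < r ->
  measurable_fun setT (tensor_transform g r).
Proof.
move=> pg r0; apply: measurable_prod => i _.
apply: measurableT_comp; last exact: (measurable_rV_coord i).
apply: continuous_measurable_fun; apply: continuous_cos_transform.
exact: profile_integrable.
Qed.

Lemma tensor_transform_weight_integrable g r x : profile g -> 0 < r ->
  lam.-integrable setT (EFin \o (fun xi =>
    tensor_transform g r xi * cos (dotrV xi x) * (1 + dotrV xi xi))).
Proof.
move=> pg r0; have ii := integrable_norm (tensor_transform_integrable pg r0).
have mt := measurable_tensor_transform pg r0.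
apply: (@le_integrableR _ _ _ _ _ _ (fun xi => (1 + r ^- 2) * `|tensor_transform g r xi *
    \prod_i (1 + (r * xi ord0 i) ^+ 2)|)) => //; last exact: integrableRZ.
  apply: measurable_funM; last by apply: measurable_funD => //; exact: measurable_dotrVV.
  apply: measurable_funM => //; apply: measurableT_comp; last exact: measurable_dotrV.
  exact: continuous_measurable_fun (@continuous_cos R).
move=> xi _; rewrite !normrM mulrCA -mulrA ler_wpM2l//.
have h := dilate_dotrV_le r xi; have a0 := dotrV_ge0 xi.
have r2 : 0 < r ^+ 2 by rewrite exprn_gt0.
rewrite (ger0_norm (_ : 0 <= 1 + dotrV xi xi)) ?addr_ge0//.
rewrite (ger0_norm (_ : 0 <= \prod_i _)); last first.
  by apply: prodr_ge0 => i _; rewrite addr_ge0 ?sqr_ge0.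
apply: (@le_trans _ _ (1 + dotrV xi xi)).
  by rewrite ler_piMl ?addr_ge0// cos_max.
apply: le_trans (ler_wpM2l _ h); last by rewrite addr_ge0// invr_ge0 ltW.
rewrite mulrDl mul1r mulrDr mulr1 mulKf ?gt_eqF//.
have : 0 <= r ^- 2 by rewrite invr_ge0 ltW.
have : 0 <= r ^+ 2 * dotrV xi xi by rewrite mulr_ge0// ltW.
lra.
Qed.

Lemma tensor_transform_cos_integrable g r x : profile g -> 0 < r ->
  lam.-integrable setT (EFin \o (fun xi => tensor_transform g r xi * cos (dotrV xi x))).
Proof.
move=> pg r0; have ii := integrable_norm (tensor_transform_weight_integrable x pg r0).
apply: (@le_integrableR _ _ _ _ _ _ (fun xi =>
  `|tensor_transform g r xi * cos (dotrV xi x) * (1 + dotrV xi xi)|)) => //.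
  apply: measurable_funM; first exact: measurable_tensor_transform.
  apply: measurableT_comp; last exact: measurable_dotrV.
  exact: continuous_measurable_fun (@continuous_cos R).
move=> xi _; rewrite [leRHS]normrM ler_peMr// ger0_norm ?lerDl ?dotrV_ge0//.
by rewrite addr_ge0 ?dotrV_ge0.
Qed.

Lemma expr_mul_prod (c : R) (f : 'I_N -> R) :
  c ^+ N * \prod_i f i = \prod_i (c * f i).
Proof. by rewrite big_split/= prodr_const card_ord. Qed.

Lemma Rintegral_tensor_transform g r x : profile g -> 0 < r ->
  \int[lam]_xi (tensor_transform g r xi * cos (dotrV xi x)) =
  (2 * pi) ^+ N * tensor g r x.
Proof.
move=> pg r0.
have [_ _ -> _] := @Rintegral_rV_prod_cos R N (fun=> cos_transform (dilate g r)) x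
  (fun=> profile_transform_integrable0 pg r0) (fun=> cos_transformN _).
rewrite /tensor expr_mul_prod.
apply: eq_bigr => i _; rewrite -profile_inversion//.
by apply: eq_Rintegral => z _; rewrite (mulrC z).
Qed.

(** The Gaussian factors over the coordinates, so the heat flow of a tensor is the product of
    one-dimensional heat flows. *)
Lemma Rintegral_tensor_transform_gauss g r s x : profile g -> 0 < r -> 0 < s ->
  \int[lam]_xi (expR (- (s ^+ 2 / 2 * dotrV xi xi)) *
    (tensor_transform g r xi * cos (dotrV xi x))) =
  (2 * pi) ^+ N * \prod_i heat s (dilate g r) (x ord0 i).
Proof.
move=> pg r0 s0.
pose G z := gauss_weight s z * cos_transform (dilate g r) z.
have iG : mu.-integrable setT (EFin \o G).
  have ih := profile_transform_integrable0 pg r0.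
  apply: (le_integrable_lebesgue (g := fun z => `|cos_transform (dilate g r) z|)).
  - apply: measurable_funM; first exact: measurable_gauss_weight.
    exact: integrableR_measurable ih.
  - move=> z; rewrite normrM ler_piMl// ger0_norm ?gauss_weight_ge0//.
    exact: gauss_weight_le1.
  - exact: integrable_norm.
have eG z : G (- z) = G z by rewrite /G cos_transformN /gauss_weight sqrrN.
have [_ _ E _] := @Rintegral_rV_prod_cos R N (fun=> G) x (fun=> iG) (fun=> eG).
transitivity (\int[lam]_xi (\prod_(i < N) G (xi ord0 i) * cos (dotrV xi x))).
  apply: eq_Rintegral => xi _; rewrite mulrA big_split/=; congr (_ * _ * _).
  rewrite /dotrV mulr_sumr -sumrN expR_sum; apply: eq_bigr => i _.
  by rewrite /gauss_weight; congr expR; field.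
rewrite E expr_mul_prod.
apply: eq_bigr => i _; rewrite -heat_cos_transform//; last exact: profile_integrable.
by apply: eq_Rintegral => z _; rewrite /G (mulrC z).
Qed.

Lemma tensorX g r l x : tensor (fun y => g y ^+ l) r x = tensor g r x ^+ l.
Proof. by rewrite /tensor prodrXl. Qed.

Lemma tensor_ge0 g r x : profile g -> 0 <= tensor g r x.
Proof. by move=> [_ g01 _ _]; apply: prodr_ge0 => i _; case/andP: (g01 (r^-1 * x ord0 i)). Qed.

Lemma tensor_le1 g r x : profile g -> tensor g r x <= 1.
Proof.
move=> [_ g01 _ _]; apply: (@le_trans _ _ (\prod_(i < N) 1)); last by rewrite big1.
by apply: ler_prod => i _; exact: g01.
Qed.

(** By evenness the sine part of the transform vanishes. The constant [c] makes room for the time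
    factor of a space-time cutoff. *)
Lemma frac_laplacian_tensor g r theta (c : R) x : profile g -> 0 < r ->
  frac_laplacian theta (fun y => c * tensor g r y) x =
  (2 * pi) ^- N * \int[lam]_xi (enorm xi `^ theta *
    (c * (tensor_transform g r xi * cos (dotrV xi x)))).
Proof.
move=> pg r0; have [_ _ ge _] := pg.
have H xi := @Rintegral_rV_prod_cos R N (fun=> dilate g r) xi
  (fun=> profile_integrable pg r0)
  (fun _ y => etrans (congr1 g (mulrN r^-1 y)) (ge (r^-1 * y))).
have fre xi : fourier_re (fun y => c * tensor g r y) xi = c * tensor_transform g r xi.
  have [ic _ ec _] := H xi; rewrite /fourier_re /tensor_transform -ec -RintegralZl//; apply: eq_Rintegral => y _.
  by rewrite mulrA.
have fim xi : fourier_im (fun y => c * tensor g r y) xi = 0.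
  have [_ is' _ e0] := H xi.
  rewrite /fourier_im -[RHS]oppr0; congr (- _).
  rewrite -[RHS](mulr0 c) -e0 -RintegralZl//; apply: eq_Rintegral => y _.
  by rewrite mulrA.
rewrite /frac_laplacian; congr (_ * _); apply: eq_Rintegral => xi _.
by rewrite fre fim mul0r subr0 dotrVC -[c * _ * _]mulrA.
Qed.

Lemma enorm_powR theta xi : enorm xi `^ theta = dotrV xi xi `^ (theta / 2).
Proof. by rewrite /enorm -powR12_sqrt ?dotrV_ge0// -powRrM mulrC. Qed.

Lemma powR_le_onemD (t al : R) : 0 <= t -> 0 <= al <= 1 -> t `^ al <= 1 + t.
Proof.
move=> t0 /andP[al0 al1]; have [t1|t1] := leP 1 t.
  apply: (@le_trans _ _ (t `^ 1)); first by rewrite ler_powR.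
  by rewrite powRr1// lerDr.
apply: (@le_trans _ _ 1); last by rewrite lerDl.
have := @ge0_ler_powR R al al0 t 1; rewrite !nnegrE powR1.
by apply => //; exact: ltW.
Qed.

Lemma measurable_enorm_powR theta : measurable_fun setT (fun xi => enorm xi `^ theta).
Proof.
under eq_fun do rewrite enorm_powR.
exact: (measurableT_comp (measurable_powR _) measurable_dotrVV).
Qed.

Lemma frac_laplacian_integrable g r theta x : profile g -> 0 < r -> 0 < theta <= 2 ->
  lam.-integrable setT (EFin \o (fun xi => enorm xi `^ theta *
    (tensor_transform g r xi * cos (dotrV xi x)))).
Proof.
move=> pg r0 th02; have ii := tensor_transform_weight_integrable x pg r0.
apply: (@le_integrableR _ _ _ _ _ _ (fun xi =>
  `|tensor_transform g r xi * cos (dotrV xi x) * (1 + dotrV xi xi)|)) => //.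
- apply: measurable_funM; first exact: measurable_enorm_powR.
  exact: integrableR_measurable (tensor_transform_cos_integrable x pg r0).
- move=> xi _; rewrite mulrC !normrM ler_wpM2l ?mulr_ge0//.
  rewrite !ger0_norm ?powR_ge0 ?addr_ge0 ?dotrV_ge0// enorm_powR.
  by apply: powR_le_onemD; [exact: dotrV_ge0|lra].
- exact: integrable_norm.
Qed.

(** By scaling, [|xi|^theta = r^(-theta) (r^2 |xi|^2)^(theta/2) <= r^(-theta) (1 + r^2 |xi|^2)]. The
    decay of the transforms covers the last weight and leaves Cauchy weights, whose integrals do not
    depend on [r]. *)
Lemma frac_laplacian_bound g theta : profile g -> 0 < theta <= 2 ->
  exists2 C, 0 <= C & forall r x, 0 < r ->
    `|frac_laplacian theta (fun y => 1 * tensor g r y) x| <= C * r `^ (- theta).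
Proof.
move=> pg th02; have [C C0 HC] := profile_decay pg.
exists ((2 * pi) ^- N * (C * pi) ^+ N).
  by rewrite mulr_ge0 ?invr_ge0 ?exprn_ge0 ?mulr_ge0 ?pi_ge0.
move=> r x r0; rewrite frac_laplacian_tensor//.
have p0 : 0 <= (2 * pi : R) ^- N by rewrite invr_ge0 exprn_ge0// mulr_ge0// pi_ge0.
rewrite normrM ger0_norm// -mulrA ler_wpM2l//.
under eq_Rintegral do rewrite mul1r.
have ii := frac_laplacian_integrable x pg r0 th02.
apply: (le_trans (le_normr_Rintegral _ ii)) => //.
have [ic ec] := integral_cauchy_weight r0.
have icC : mu.-integrable setT (EFin \o (fun z => C * cauchy_weight r z)) by exact: integrableRZ.
have [iP eP] := @Rintegral_rV_prod R N (fun _ z => C * cauchy_weight r z) (fun=> icC).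
have -> : (C * pi) ^+ N * r `^ (- theta) = \int[lam]_xi (r `^ (- theta) *
    \prod_(i < N) (C * cauchy_weight r (xi ord0 i))).
  rewrite RintegralZl// eP mulrC; congr (_ * _).
  by rewrite prodr_const card_ord RintegralZl// ec.
apply: le_Rintegral => //; first exact: integrable_norm.
  exact: integrableRZ.
move=> xi _; rewrite normrM ger0_norm ?powR_ge0//.
have -> : enorm xi `^ theta = r `^ (- theta) * (r ^+ 2 * dotrV xi xi) `^ (theta / 2).
  rewrite enorm_powR powRM ?sqr_ge0 ?dotrV_ge0// -powR_mulrn ?ltW// -powRrM mulrA.
  rewrite (_ : 2 * (theta / 2) = theta); last by field.
  by rewrite powRN mulVf ?mul1r// gt_eqF// powR_gt0.
rewrite -mulrA ler_wpM2l ?powR_ge0// normrM.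
apply: (@le_trans _ _ ((1 + r ^+ 2 * dotrV xi xi) * `|tensor_transform g r xi|)).
  apply: ler_pM; rewrite ?powR_ge0 ?mulr_ge0//; last by rewrite ler_piMr// cos_max.
  by apply: powR_le_onemD; [rewrite mulr_ge0 ?sqr_ge0 ?dotrV_ge0|lra].
apply: (le_trans (ler_wpM2r _ (dilate_dotrV_le r xi))) => //.
rewrite /tensor_transform (big_morph _ (@normrM R) (normr1 R)) -big_split/=.
apply: ler_prod => i _; rewrite mulr_ge0 ?addr_ge0 ?sqr_ge0//= mulrC.
exact: HC.
Qed.

(* Cordoba-Cordoba: subordinate to the heat flow, which acts coordinatewise on
   tensors, and use Jensen's inequality in each coordinate. *)
Lemma frac_laplacian_power_le g r theta (c : R) l x : profile g -> 0 < r ->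
  0 < theta <= 2 -> 0 <= c ->
  frac_laplacian theta (fun y => c * tensor (fun z => g z ^+ l.+1) r y) x <=
  c * (l.+1%:R * tensor g r x ^+ l *
    frac_laplacian theta (fun y => 1 * tensor g r y) x).
Proof.
move=> pg r0 th02 c0; have pl := profileX l pg.
rewrite !frac_laplacian_tensor//.
have p0 : 0 < (2 * pi : R) ^+ N by rewrite exprn_gt0// mulr_gt0// pi_gt0.
have i1 := frac_laplacian_integrable x pg r0 th02.
have i2 := frac_laplacian_integrable x pl r0 th02.
set K := l.+1%:R * tensor g r x ^+ l.
under [X in _ * X <= _]eq_Rintegral do rewrite mulrCA.
under [X in _ <= _ * (_ * (_ * X))]eq_Rintegral do rewrite mul1r.
rewrite RintegralZl// mulrCA ler_wpM2l// [leRHS]mulrCA.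
apply: ler_wpM2l; first by rewrite invr_ge0 ltW.
rewrite -subr_ge0 -RintegralZl// -RintegralB//; last exact: integrableRZ.
(* Since [K] is a constant once [x] is fixed, the claim is that [|xi|^theta q] has a nonnegative
   integral, to which [subordination] applies. *)
pose q xi := K * (tensor_transform g r xi * cos (dotrV xi x)) -
  tensor_transform (fun z => g z ^+ l.+1) r xi * cos (dotrV xi x).
have c1 := tensor_transform_cos_integrable x pg r0.
have c2 := tensor_transform_cos_integrable x pl r0.
have w1 := tensor_transform_weight_integrable x pg r0.
have w2 := tensor_transform_weight_integrable x pl r0.
have iq : lam.-integrable setT (EFin \o q) by apply: integrableRB => //; exact: integrableRZ.
suff : 0 <= \int[lam]_xi (dotrV xi xi `^ (theta / 2) * q xi).
  by congr (0 <= _); apply: eq_Rintegral => xi _; rewrite enorm_powR /q; ring.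
apply: subordination => //.
- exact: measurable_dotrVV.
- exact: dotrV_ge0.
- exact: integrableR_measurable iq.
- have := integrableRB measurableT (integrableRZ measurableT K w1) w2.
  by congr (_.-integrable _ (_ \o _)); apply/funext => xi; rewrite /q; ring.
(* The Gaussian weight of parameter [t] is [exp (-s xi^2)] exactly when [t^2 / 2 = s]. *)
move=> s s0; pose t := Num.sqrt (2 * s).
have t0 : 0 < t by rewrite sqrtr_gt0 mulr_gt0.
have t2 : t ^+ 2 / 2 = s by rewrite sqr_sqrtr ?mulr_ge0 ?ltW//; field.
have iE f : lam.-integrable setT (EFin \o f) ->
    lam.-integrable setT (EFin \o (fun xi => expR (- (s * dotrV xi xi)) * f xi)).
  move=> fi; apply: (@le_integrableR _ _ _ _ _ _ (fun xi => `|f xi|)) => //.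
  - apply: measurable_funM; last exact: integrableR_measurable fi.
    apply: measurableT_comp => //; apply: measurableT_comp => //.
    by apply: measurable_funM => //; exact: measurable_dotrVV.
  - move=> xi _; rewrite normrM ler_piMl// ger0_norm ?expR_ge0//.
    by rewrite -[leRHS]expR0 ler_expR oppr_le0 mulr_ge0 ?dotrV_ge0// ltW.
  - exact: integrable_norm.
have E1 := Rintegral_tensor_transform x pg r0.
have E2 := Rintegral_tensor_transform x pl r0.
have E3 := Rintegral_tensor_transform_gauss x pg r0 t0; rewrite t2 in E3.
have E4 := Rintegral_tensor_transform_gauss x pl r0 t0; rewrite t2 in E4.
rewrite (_ : \int[lam]_xi _ = \int[lam]_xi q xi -
  (K * \int[lam]_xi (expR (- (s * dotrV xi xi)) * (tensor_transform g r xi * cos (dotrV xi x)))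
   - \int[lam]_xi (expR (- (s * dotrV xi xi)) *
     (tensor_transform (fun z => g z ^+ l.+1) r xi * cos (dotrV xi x))))); last first.
  have j1 := integrableRZ measurableT K (iE _ c1); have j2 := iE _ c2.
  rewrite -RintegralZl//; last exact: iE.
  rewrite -(RintegralB measurableT j1 j2).
  rewrite -(RintegralB measurableT iq (integrableRB measurableT j1 j2)).
  by apply: eq_Rintegral => xi _; rewrite /q; ring.
rewrite RintegralB//; last exact: integrableRZ.
rewrite RintegralZl// E1 E2 E3 E4 tensorX.
set P := tensor g r x; set H := \prod_i heat t (dilate g r) (x ord0 i).
set Hl := \prod_i _.
have [eg g01 ge gs] := pg.
have mg : measurable_fun setT (dilate g r).
  exact: integrableR_measurable (profile_integrable pg r0).
have g01' y : 0 <= dilate g r y <= 1 by exact: g01.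
have H0 : 0 <= H.
  by apply: prodr_ge0 => i _; apply: heat_ge0 => y; case/andP: (g01' y).
have HHl : H ^+ l.+1 <= Hl.
  rewrite /H /Hl -prodrXl; apply: ler_prod => i _.
  rewrite exprn_ge0/=; last by apply: heat_ge0 => y; case/andP: (g01' y).
  by apply: heat_jensen => //; rewrite gt_eqF.
(* At time 0 the two flows are [P] and [P^(l+1)], at time [s] they are [H] and [Hl]. The tangent
   inequality at [P] bounds [H^(l+1)] from below, and Jensen gives [H^(l+1) <= Hl]. *)
have T := expr_tangent l H0 (tensor_ge0 r x pg).
have : 0 <= (2 * pi) ^+ N * (Hl - (P ^+ l.+1 + l.+1%:R * P ^+ l * (H - P))).
  rewrite mulr_ge0 ?(ltW p0)// subr_ge0; exact: le_trans T HHl.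
by congr (0 <= _); rewrite /K -/P exprS; ring.
Qed.

End fractional_laplacian.

(** * Cutoffs in space-time *)
Section cubes.
Context {R : realType}.
Local Notation mu := (@lebesgue_measure R).

Lemma integrable_indic_lty d (T : measurableType d) (m : {measure set T -> \bar R})
    (A D : set T) : measurable D -> measurable A -> (m A < +oo)%E ->
  m.-integrable D (EFin \o (\1_A : T -> R)) /\
  ((\int[m]_(x in D) (\1_A x : R))%:E <= m A)%E.
Proof.
move=> mD mA Aoo.
have iA : m.-integrable D (EFin \o (\1_A : T -> R)).
  apply/integrableP; split; first exact/measurable_EFinP/measurable_indic.
  under eq_integral do rewrite /= ger0_norm//.
  rewrite integral_indic//; apply: le_lt_trans Aoo.
  by apply: le_measure; rewrite ?inE//; exact: measurableI.
split=> //; rewrite /Rintegral fineK; last exact: integrable_fin_num.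
rewrite integral_indic//.
by apply: le_measure; rewrite ?inE//; exact: measurableI.
Qed.

Definition cube n (a b : R) : set 'rV[R]_n := [set x | forall i, a <= x ord0 i <= b].

Lemma measurable_cube n a b : measurable (@cube n a b).
Proof.
rewrite (_ : @cube n a b = \bigcap_(i in [set: 'I_n]) (rV_coord i @^-1` `[a, b]%classic)).
  apply: fin_bigcap_measurable => // i _; rewrite -[X in measurable X]setTI.
  exact: measurable_rV_coord.
apply/seteqP; split => [x h i _|x h i]; rewrite /rV_coord/=.
  by rewrite in_itv/=; exact: h.
by have := h i I; rewrite /rV_coord/= in_itv.
Qed.

Lemma lebesgue_itv_cc (a b : R) : a <= b -> mu `[a, b]%classic = (b - a)%:E.
Proof.
move=> ab; rewrite lebesgue_measure_itv/= lte_fin; case: ltP => // ba.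
by have -> : a = b; [apply/eqP; rewrite eq_le ab|rewrite subrr].
Qed.

Lemma lebesgue_rV_cube n a b : a <= b -> lebesgue_rV n (@cube n a b) = ((b - a) ^+ n)%:E.
Proof.
move=> ab; pose J : set R := `[a, b]%classic.
have [ii e] := @Rintegral_rV_prod R n (fun=> \1_J) (fun=> integrable_indic_itv a b true false).
have E : (fun x : 'rV[R]_n => \prod_(i < n) (\1_J (x ord0 i) : R)) = \1_(@cube n a b).
  apply/funext => x; rewrite indicE; case: (boolP (x \in @cube n a b)).
    rewrite inE => h; rewrite big1// => i _; rewrite indicE mem_set//=.
    by rewrite /J/= in_itv/=; exact: h.
  rewrite notin_setE => /existsNP[i hi].
  have nJ : ~ J (x ord0 i) by move=> Jx; apply: hi; move: Jx; rewrite /J/= in_itv.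
  by rewrite (bigD1 i)//= indicE memNset// mul0r.
rewrite E in ii e.
have eJ : (\int[mu]_x (\1_J x)%:E)%E = (b - a)%:E.
  by rewrite /J integral_indic// setIT; exact: lebesgue_itv_cc.
have ec : (\int[lebesgue_rV n]_x (\1_(@cube n a b) x)%:E)%E = lebesgue_rV n (@cube n a b).
  by rewrite integral_indic ?setIT//; exact: measurable_cube.
rewrite -ec -[LHS]fineK; last exact: integrable_fin_num ii.
rewrite -/(Rintegral _ _ _) e; congr EFin.
by rewrite prodr_const card_ord /Rintegral eJ.
Qed.

End cubes.

Section space_time.
Context {R : realType} {N : nat}.
Local Notation lambda := (@Lebesgue_space_time R N).
Local Notation ctype :=
  (caratheodory_type ((@lebesgue_rV R N \x @lebesgue_measure R)%E^*)%mu).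
Local Notation D := (@space_time R N +oo%E).

Lemma measurable_ctype (A : set ('rV[R]_N * measurableTypeR R)) :
  measurable A -> measurable (A : set ctype).
Proof. by move=> mA; apply: sub_caratheodory; exact: sub_sigma_algebra. Qed.

Lemma Lebesgue_space_timeE (A : set ('rV[R]_N * measurableTypeR R)) :
  measurable A -> lambda A = (@lebesgue_rV R N \x @lebesgue_measure R)%E A.
Proof. exact: measurable_mu_extE. Qed.

Lemma space_timeE : D = [set: 'rV[R]_N] `*` `]0, +oo[%classic.
Proof.
apply/seteqP; split => [[x t]|[x t]]; rewrite /space_time/=.
  by move=> [t0 _]; split => //; rewrite in_itv/= t0.
by move=> [_]; rewrite in_itv/= andbT => t0; split => //; rewrite ltry.
Qed.

Lemma measurable_space_time : measurable (D : set ('rV[R]_N * measurableTypeR R)).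
Proof. by rewrite space_timeE; exact: measurableX. Qed.

Definition cylinder (r T : R) : set ('rV[R]_N * R) :=
  cube (- r) r `*` `[0, T]%classic.

Lemma measurable_cylinder r T :
  measurable (cylinder r T : set ('rV[R]_N * measurableTypeR R)).
Proof. by apply: measurableX => //; exact: measurable_cube. Qed.

Lemma integral_cylinder r T : 0 <= r -> 0 <= T ->
  lambda.-integrable (D : set ctype) (EFin \o (\1_(cylinder r T) : ctype -> R)) /\
  \int[lambda]_(z in (D : set ctype)) (\1_(cylinder r T) z : R) <= (2 * r) ^+ N * T.
Proof.
move=> r0 T0; have mC := measurable_cylinder r T.
have E : lambda (cylinder r T) = ((2 * r) ^+ N * T)%:E.
  rewrite Lebesgue_space_timeE// /cylinder product_measure1E//; last exact: measurable_cube.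
  rewrite EFinM; congr (_ * _)%E.
    have h := @lebesgue_rV_cube R N (- r) r (ge0_cp r0).2.
    by rewrite opprK -mulr2n -mulr_natl in h; exact: h.
  by have h := lebesgue_itv_cc T0; rewrite subr0 in h; exact: h.
have mD : measurable (D : set ctype) := measurable_ctype measurable_space_time.
have Coo : (lambda (cylinder r T) < +oo)%E by rewrite [X in (X < _)%E]E ltry.
have [ii] := integrable_indic_lty mD (measurable_ctype mC) Coo.
by rewrite [X in (_ <= X)%E]E lee_fin.
Qed.

End space_time.

Section test_functions.
Context {R : realType} {N : nat}.
Implicit Types (z : 'rV[R]_N * R) (r T theta : R) (l : nat).

(** The coordinates receive linear structures below, in order to enter [elementary] as linear
    atoms. *)
Definition space_coord (i : 'I_N) z : R := z.1 ord0 i.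
Definition time_coord z : R := z.2.

Lemma space_coord_is_linear i : linear (space_coord i).
Proof. by move=> a y z; rewrite /space_coord/= !mxE. Qed.
HB.instance Definition _ i :=
  GRing.isLinear.Build R ('rV[R]_N * R)%type R *%R (space_coord i) (space_coord_is_linear i).

Lemma time_coord_is_linear : linear time_coord.
Proof. by []. Qed.
HB.instance Definition _ :=
  GRing.isLinear.Build R ('rV[R]_N * R)%type R *%R time_coord time_coord_is_linear.

Lemma continuous_space_coord i : continuous (space_coord i).
Proof.
move=> z; apply: (cvg_comp fst (fun x : 'rV[R]_N => x ord0 i)); first exact: cvg_fst.
exact: coord_continuous.
Qed.

Lemma continuous_time_coord : continuous time_coord.
Proof. by move=> z; exact: cvg_snd. Qed.

(** Even in time and not vanishing at [t = 0], as the test class allows, so that the source is seen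
    on all of []0, T]]. *)
Definition cutoff r T z : R := tensor bump r z.1 * dilate bump T z.2.

Lemma elementary_comp_bump (V : normedModType R) (r : R) (f : V -> R) : elementary f ->
  elementary (fun v => dilate bump r (f v)).
Proof.
move=> ef; apply: elementary_flat; apply: elementaryD; first exact: elementary_cst.
rewrite (_ : (fun v => _) = fun v => -1 * (r^-1 * f v) ^+ 2); last first.
  by apply/funext => v; ring.
apply: elementaryM; first exact: elementary_cst; apply: elementaryX.
by apply: elementaryM => //; exact: elementary_cst.
Qed.

Lemma elementary_cutoff r T : elementary (cutoff r T).
Proof.
apply: elementaryM.
  apply: (@elementary_prod R _ _ (index_enum 'I_N)
    (fun i (z : 'rV[R]_N * R) => dilate bump r (space_coord i z))) => i.
  by apply: elementary_comp_bump; apply: elementary_lin; exact: continuous_space_coord.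
by apply: (elementary_comp_bump T (f := time_coord)); apply: elementary_lin;
  exact: continuous_time_coord.
Qed.

Lemma cutoff_ge0 r T z : 0 <= cutoff r T z.
Proof.
have [_ g01 _ _] := @bump_profile R; rewrite mulr_ge0 ?tensor_ge0//.
  exact: bump_profile.
by have /andP[] := g01 (T^-1 * z.2).
Qed.

Lemma cutoff_le1 r T z : cutoff r T z <= 1.
Proof.
have [_ g01 _ _] := @bump_profile R; have /andP[b0 b1] := g01 (T^-1 * z.2).
rewrite mulr_ile1 ?tensor_ge0 ?tensor_le1//; exact: bump_profile.
Qed.

Lemma dilate_bump_eq0 (s y : R) : 0 < s -> 2 * s < `|y| -> dilate bump s y = 0.
Proof.
move=> s0 sy; have [_ _ _ gs] := @bump_profile R; apply: gs.
by rewrite normrM gtr0_norm ?invr_gt0// mulrC ler_pdivlMr// ltW.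
Qed.

Lemma dilate_bump_ge (s y : R) : 0 < s -> `|y| <= s -> expR (-1) <= dilate bump s y.
Proof.
move=> s0 sy; apply: bump_ge.
by rewrite normrM gtr0_norm ?invr_gt0// mulrC ler_pdivrMr// mul1r.
Qed.

Lemma cutoff_support r T z : 0 < r -> 0 < T -> cutoff r T z != 0 ->
  cube (- (2 * r)) (2 * r) z.1 /\ `|z.2| <= 2 * T.
Proof.
move=> r0 T0; rewrite mulf_eq0 negb_or => /andP[/prodf_neq0 h1 h2]; split.
  move=> i; rewrite -ler_norml leNgt; apply: contra (h1 i isT) => hi.
  by rewrite dilate_bump_eq0.
by rewrite leNgt; apply: contra h2 => h; rewrite dilate_bump_eq0.
Qed.

Lemma cutoff_ge r T z : 0 < r -> 0 < T -> cube (- r) r z.1 -> `|z.2| <= T ->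
  expR (-1) ^+ N.+1 <= cutoff r T z.
Proof.
move=> r0 T0 z1 z2; rewrite exprSr; apply: ler_pM; rewrite ?expR_ge0 ?exprn_ge0 ?expR_ge0//.
  rewrite (_ : expR (-1) ^+ N = \prod_(i < N) expR (-1)); last first.
    by rewrite prodr_const card_ord.
  apply: ler_prod => i _; rewrite expR_ge0/=; apply: dilate_bump_ge => //.
  by rewrite ler_norml; exact: z1.
exact: dilate_bump_ge.
Qed.

Lemma cutoff_test_function r T l : 0 < r -> 0 < T ->
  test_function +oo%E (fun z => cutoff r T z ^+ l.+1).
Proof.
move=> r0 T0; split.
- by apply: elementary_smooth; apply: elementaryX; exact: elementary_cutoff.
- pose K : set ('rV[R]_N * R) :=
    [set x : 'rV[R]_N | forall i, `[- (2 * r), 2 * r]%classic (x ord0 i)] `*` `[- (2 * T), 2 * T]%classic.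
  have cK : compact K.
    apply: compact_setX; last exact: segment_compact.
    exact: (@rV_compact _ N (fun=> `[- (2 * r), 2 * r]%classic) (fun=> @segment_compact _ _ _)).
  apply: (subclosed_compact (@closed_closure _ _) cK).
  have clK : closed K by apply: compact_closed cK; exact: norm_hausdorff.
  rewrite [X in _ `<=` X]((closure_id K).1 clK).
  apply: closure_subset => z /=; rewrite expf_eq0/= => h.
  have [z1 z2] := cutoff_support r0 T0 h; split => /=.
    by move=> i; rewrite in_itv/=; exact: z1.
  by rewrite in_itv/= -ler_norml.
- by move=> z _ /=; exact: ltry.
Qed.

Lemma cutoffX r T l z : cutoff r T z ^+ l.+1 =
  dilate bump T z.2 ^+ l.+1 * tensor (fun y => bump y ^+ l.+1) r z.1.
Proof. by rewrite /cutoff exprMn tensorX mulrC. Qed.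

(** The time derivative is of size [1/T <= r^(-theta)], by the condition on [T]; the space part is
    the convexity inequality followed by the scaling bound. Each of the two keeps the power [l] of
    the cutoff. *)
Lemma adjoint_cutoff_le theta l : 0 < theta <= 2 -> exists2 C, 0 < C &
  forall r T z, 0 < r -> r `^ theta <= T ->
  adjoint_operator theta (fun z => cutoff r T z ^+ l.+1) z <=
  C * r `^ (- theta) * cutoff r T z ^+ l.
Proof.
move=> th02; have pb := @bump_profile R; have [eb g01 _ gs] := pb.
have [b' eb' db] := elementary_derive eb.
have s' y : 2 + 1 <= `|y| -> b' y = 0.
  by move=> h; apply: (support_derive db gs); lra.
have [M M0 HM] := continuous_support_bounded (elementary_continuous eb') s'.
have [C1 C10 HC1] := @frac_laplacian_bound R N bump theta pb th02.
(* The [+ 1] makes the constant positive. *)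
exists (l.+1%:R * (M + C1) + 1); first by rewrite ltr_pwDr// mulr_ge0// addr_ge0.
move=> r T [x t] r0 rT; have rt0 : 0 < r `^ theta by rewrite powR_gt0.
have T0 : 0 < T by exact: lt_le_trans rt0 rT.
set P := tensor bump r x; set e := dilate bump T t.
have P0 : 0 <= P by exact: tensor_ge0.
have P1 : P <= 1 by exact: tensor_le1.
have /andP[e0 e1] : 0 <= e <= 1 by exact: g01.
have Ti : T^-1 <= r `^ (- theta).
  by rewrite powRN lef_pV2 ?posrE.
have k0 : 0 <= r `^ (- theta) by exact: powR_ge0.
have c0 : 0 <= cutoff r T (x, t) ^+ l by rewrite exprn_ge0 ?cutoff_ge0.
have cE : cutoff r T (x, t) ^+ l = P ^+ l * e ^+ l by rewrite exprMn.
rewrite /adjoint_operator/=.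
have dt : - derive1 (fun s => cutoff r T (x, s) ^+ l.+1) t <=
    l.+1%:R * M * r `^ (- theta) * cutoff r T (x, t) ^+ l.
  have dd : is_derive t (1 : R) (fun s => cutoff r T (x, s) ^+ l.+1)
      (l.+1%:R * (P * (T^-1 * b' (T^-1 * t))) * cutoff r T (x, t) ^+ l).
    have d1 : is_derive t (1 : R) (fun s => cutoff r T (x, s)) (P * (T^-1 * b' (T^-1 * t))).
      exact: (is_derive_scale P (is_derive_dilate T db t)).
    exact: is_derive_pow.
  rewrite derive1E; have [_ ->] := dd.
  rewrite -mulNr ler_wpM2r// -mulrN -!mulrA ler_wpM2l//.
  apply: (le_trans (ler_norm _)); rewrite normrN !normrM (ger0_norm P0).
  rewrite (gtr0_norm (_ : 0 < T^-1)) ?invr_gt0// [leRHS]mulrC.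
  apply: (@le_trans _ _ (T^-1 * `|b' (T^-1 * t)|)).
    by rewrite ler_piMl// mulr_ge0// invr_ge0 ltW.
  by apply: ler_pM => //; rewrite invr_ge0 ltW.
have df : frac_laplacian theta (fun y => cutoff r T (y, t) ^+ l.+1) x <=
    l.+1%:R * C1 * r `^ (- theta) * cutoff r T (x, t) ^+ l.
  rewrite (_ : (fun y => _) = fun y => e ^+ l.+1 * tensor (fun y => bump y ^+ l.+1) r y); last first.
    by apply/funext => y; rewrite cutoffX.
  apply: (le_trans (frac_laplacian_power_le l x pb r0 th02 _)); first exact: exprn_ge0.
  have h := HC1 r x r0; set F := frac_laplacian _ _ _ in h *.
  have -> : e ^+ l.+1 * (l.+1%:R * tensor bump r x ^+ l * F) =
    l.+1%:R * (P ^+ l * e ^+ l) * (e * F) by rewrite -/P exprS; ring.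
  (* [F] may be negative, hence the passage to its absolute value before [e <= 1] is used. *)
  have eF : e * F <= C1 * r `^ (- theta).
    apply: le_trans h; apply: (@le_trans _ _ (e * `|F|)).
      by rewrite ler_wpM2l// ler_norm.
    by rewrite ler_piMl.
  have -> : l.+1%:R * C1 * r `^ (- theta) * cutoff r T (x, t) ^+ l =
    l.+1%:R * (P ^+ l * e ^+ l) * (C1 * r `^ (- theta)) by rewrite cE; ring.
  by rewrite ler_wpM2l// mulr_ge0// mulr_ge0// exprn_ge0.
apply: (le_trans (lerD dt df)); rewrite -!mulrDl -mulrDr ler_wpM2r// ler_wpM2r//.
by rewrite lerDl.
Qed.

End test_functions.

(** * Young's inequality with cutoffs, and powers of geometric sums *)

Section young.
Context {R : realType}.
Implicit Types (u B Phi e p q s : R).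

Lemma powRD_gt0 (x a b : R) : 0 < x -> x `^ (a + b) = x `^ a * x `^ b.
Proof. by move=> x0; rewrite powRD// (gt_eqF x0) implybT. Qed.

(** If [B <= e u^(p-1) Phi], the first term on the right dominates. Otherwise [u^(p-1) Phi < B/e];
    raising to the power [s] gives [u Phi^s <= (B/e)^s], and [Phi^(l+1) <= Phi^s] because [s <= l+1]
    and [Phi <= 1]. *)
Lemma young_power u B Phi e p s l : 0 <= u -> 0 <= B -> 0 <= Phi <= 1 -> 0 < e ->
  1 < p -> s = (p - 1)^-1 -> s <= l.+1%:R ->
  u * (B * Phi ^+ l.+1) <= e * (u `^ p * Phi ^+ l.+2) + e `^ (- s) * B `^ (1 + s).
Proof.
move=> u0 B0 /andP[P0 P1] e0 p1 sE sl.
have p10 : 0 < p - 1 by rewrite subr_gt0.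
have s0 : 0 < s by rewrite sE invr_gt0.
have R0 : 0 <= e `^ (- s) * B `^ (1 + s) by rewrite mulr_ge0 ?powR_ge0.
have R1 : 0 <= e * (u `^ p * Phi ^+ l.+2).
  by rewrite mulr_ge0 ?(ltW e0)// mulr_ge0 ?powR_ge0 ?exprn_ge0.
move: u0; rewrite le_eqVlt => /predU1P[uE|u0]; first by rewrite -[u in X in X <= _]uE mul0r addr_ge0.
move: P0; rewrite le_eqVlt => /predU1P[PE|P0].
  by rewrite -[Phi in X in X <= _]PE expr0n !mulr0 addr_ge0.
have uE : u * u `^ (p - 1) = u `^ p.
  by rewrite -[X in X * _](powRr1 (ltW u0)) -powRD_gt0// addrC subrK.
have [h|h] := leP B (e * (u `^ (p - 1) * Phi)).
  apply: (@le_trans _ _ (e * (u `^ p * Phi ^+ l.+2))); last by rewrite lerDl.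
  rewrite -uE [Phi ^+ l.+2]exprS.
  have -> : e * (u * u `^ (p - 1) * (Phi * Phi ^+ l.+1)) =
    u * (e * (u `^ (p - 1) * Phi) * Phi ^+ l.+1) by ring.
  by rewrite ler_wpM2l ?(ltW u0)// ler_wpM2r// exprn_ge0// (ltW P0).
apply: (@le_trans _ _ (e `^ (- s) * B `^ (1 + s))); last by rewrite lerDr.
have B1 : 0 < B by apply: le_lt_trans h; rewrite mulr_ge0 ?(ltW e0)// mulr_ge0 ?powR_ge0 ?(ltW P0).
have us : u * Phi ^+ l.+1 <= (u `^ (p - 1) * Phi) `^ s.
  rewrite (powRM _ (powR_ge0 _ _) (ltW P0)) -powRrM sE divff ?gt_eqF//.
  rewrite (powRr1 (ltW u0)) ler_wpM2l ?(ltW u0)// -(powR_mulrn _ (ltW P0)) -sE.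
  by rewrite ger_powR// P0.
have us' : (u `^ (p - 1) * Phi) `^ s <= (B / e) `^ s.
  apply: ge0_ler_powR; first exact: ltW.
  - by rewrite nnegrE mulr_ge0 ?powR_ge0 ?(ltW P0).
  - by rewrite nnegrE mulr_ge0 ?invr_ge0 ?(ltW e0).
  - by rewrite ler_pdivlMr// mulrC ltW.
rewrite mulrCA powRD_gt0// powRr1// [leRHS]mulrCA ler_wpM2l//.
apply: (le_trans us); apply: (le_trans us').
by rewrite powRM ?invr_ge0 ?(ltW e0)// -(powR_inv1 (ltW e0)) -powRrM mulN1r mulrC.
Qed.

(** As [b] is increasing, the sum is a geometric tail, at most its first nonzero term divided by
    [1 - q], and that term raised to [1 + s] occurs on the right. The constant is free of [n],
    whereas Hölder's inequality would cost [n^s]. *)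
Lemma geometric_powR_sum q s n (b : nat -> bool) : 0 <= q < 1 -> 0 <= s ->
  (forall k, b k -> b k.+1) ->
  (\sum_(k < n) q ^+ k * (b k)%:R) `^ (1 + s) <=
  (1 - q) `^ (- (1 + s)) * \sum_(k < n) (q ^+ k) `^ (1 + s) * (b k)%:R.
Proof.
move=> /andP[q0 q1] s0; have s1 : 0 <= 1 + s by lra.
have q10 : 0 < 1 - q by lra.
have S0 m (c : nat -> bool) : 0 <= \sum_(k < m) q ^+ k * (c k)%:R.
  by apply: sumr_ge0 => k _; rewrite mulr_ge0 ?exprn_ge0.
have T0 m (c : nat -> bool) : 0 <= \sum_(k < m) (q ^+ k) `^ (1 + s) * (c k)%:R.
  by apply: sumr_ge0 => k _; rewrite mulr_ge0 ?powR_ge0.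
elim: n b => [|n IH] b bS.
  by rewrite !big_ord0 mulr0 powR0// gt_eqF//; lra.
case: (boolP (b 0%N)) => b0.
  have S1 : \sum_(k < n.+1) q ^+ k * (b k)%:R <= (1 - q)^-1.
    rewrite -[leRHS]mul1r ler_pdivlMr//.
    apply: (@le_trans _ _ ((\sum_(k < n.+1) q ^+ k) * (1 - q))).
      apply: ler_wpM2r; first exact: ltW.
      by apply: ler_sum => k _; rewrite ler_piMr ?exprn_ge0// lern1 leq_b1.
    rewrite mulrC -opprB mulNr -subrX1 opprB.
    by rewrite gerBl exprn_ge0.
  apply: (@le_trans _ _ ((1 - q)^-1 `^ (1 + s))).
    by apply: ge0_ler_powR; rewrite ?nnegrE// invr_ge0 ltW.
  rewrite -(powR_inv1 (ltW q10)) -powRrM mulN1r ler_peMr ?powR_ge0//.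
  rewrite big_ord_recl expr0 powR1 b0 mul1r lerDl.
  by apply: sumr_ge0 => k _; rewrite mulr_ge0 ?powR_ge0.
have E1 : \sum_(k < n.+1) q ^+ k * (b k)%:R = q * \sum_(k < n) q ^+ k * (b k.+1)%:R.
  rewrite big_ord_recl (negbTE b0) mulr0 add0r mulr_sumr.
  by apply: eq_bigr => k _; rewrite lift0 exprS mulrA.
have E2 : \sum_(k < n.+1) (q ^+ k) `^ (1 + s) * (b k)%:R =
    q `^ (1 + s) * \sum_(k < n) (q ^+ k) `^ (1 + s) * (b k.+1)%:R.
  rewrite big_ord_recl (negbTE b0) mulr0 add0r mulr_sumr.
  by apply: eq_bigr => k _; rewrite lift0 exprS powRM ?exprn_ge0// mulrA.
rewrite E1 E2 powRM ?(S0 n (fun k => b k.+1))// mulrCA ler_wpM2l ?powR_ge0//.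
by apply: (IH (fun k => b k.+1)) => k; exact: bS.
Qed.

End young.

(** * Nonexistence *)
Section estimates.
Context {R : realType} {N : nat}.
Local Notation leb := (@lebesgue_measure R).
Local Notation lambda := (@Lebesgue_space_time R N).
Local Notation ctype :=
  (caratheodory_type ((@lebesgue_rV R N \x @lebesgue_measure R)%E^*)%mu).
Local Notation D := (@space_time R N +oo%E).
Implicit Types (mu : {measure set 'rV[R]_N -> \bar R}) (u : 'rV[R]_N * R -> R).

(** A lower bound for [cutoff^(l+2)] on the inner cylinder: one factor [exp (-1)] for each
    coordinate and one for time. *)
Definition bump_floor l : R := (expR (-1) ^+ N.+1) ^+ l.+2.

Lemma bump_floor_gt0 l : 0 < bump_floor l.
Proof. by rewrite !exprn_gt0 ?expR_gt0. Qed.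

(** Stated in the extended reals: finiteness of the mass of the cube is drawn from this
    inequality. *)
Lemma source_ge mu r T l : 0 < r -> 0 < T ->
  (mu \x leb)%E.-integrable (D : set ('rV[R]_N * measurableTypeR R))
    (fun z => (cutoff r T z ^+ l.+2)%:E) ->
  ((bump_floor l * T)%:E * mu (cube (- r) r) <=
   (\int[(mu \x leb)%E]_(z in (D : set ('rV[R]_N * measurableTypeR R)))
      (cutoff r T z ^+ l.+2))%:E)%E.
Proof.
(* Open at 0, because [space_time] excludes [t = 0]. *)
move=> r0 T0 ii; pose J : set (measurableTypeR R) := `]0, T]%classic.
pose A : set ('rV[R]_N * measurableTypeR R) := cube (- r) r `*` J.
have mJ : measurable J by exact: measurable_itv.
have mA : measurable A by apply: measurableX => //; exact: measurable_cube.
have AD : A `<=` D.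
  move=> [x t] [_]; rewrite /J/= in_itv/= => /andP[t0 _]; split => //=.
  exact: ltry.
have mD : measurable (D : set ('rV[R]_N * measurableTypeR R)) := measurable_space_time.
rewrite /Rintegral fineK; last exact: integrable_fin_num.
have k0 := bump_floor_gt0 l.
apply: (@le_trans _ _ (\int[(mu \x leb)%E]_(z in D) ((bump_floor l)%:E * (\1_A z)%:E))%E).
  rewrite ge0_integralZl_EFin//; last 2 first.
  - exact/measurable_EFinP/measurable_indic.
  - exact: ltW.
  rewrite integral_indic// (setIidl AD) EFinM -muleA; apply: lee_wpmul2l.
    by rewrite lee_fin ltW.
  have E : (mu \x leb)%E A = (mu (cube (- r) r) * leb J)%E.
    by rewrite product_measure1E//; exact: measurable_cube.
  rewrite [X in (_ <= X)%E]E muleC; apply: lee_wpmul2l; first exact: measure_ge0.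
  have h : leb J = T%:E by rewrite lebesgue_measure_itv/= lte_fin T0 oppr0 adde0.
  by rewrite -[X in (X <= _)%E]h.
apply: ge0_le_integral => //.
- by move=> z _; rewrite -EFinM lee_fin mulr_ge0// ltW.
- by apply: measurable_funeM; exact/measurable_EFinP/measurable_indic.
- by case/integrableP: ii.
move=> z Dz; rewrite -EFinM lee_fin indicE; case: (boolP (z \in A)) => [|_]; last first.
  by rewrite mulr0 exprn_ge0 ?cutoff_ge0.
rewrite inE => -[z1]; rewrite /J/= in_itv/= => /andP[t0 tT]; rewrite mulr1.
rewrite /bump_floor; apply: lerXn2r; rewrite ?nnegrE ?cutoff_ge0 ?exprn_ge0 ?expR_ge0//.
by apply: cutoff_ge => //; rewrite gtr0_norm.
Qed.

(* [p' = 1 + s] is the conjugate exponent of [p]; the bounds do not depend on [mu]. *)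
Lemma energy_estimate theta p s l : 0 < theta <= 2 -> 1 < p -> s = (p - 1)^-1 ->
  s <= l.+1%:R -> exists2 C, 0 < C & forall mu u, is_solution theta p mu +oo%E u ->
  forall r T, 0 < r -> r `^ theta <= T ->
  \int[lambda]_(z in (D : set ctype)) (u z `^ p * cutoff r T z ^+ l.+2) <=
    C * r `^ (N%:R - theta * (1 + s)) * T /\
  ((bump_floor l)%:E * mu (cube (- r) r) <= (C * r `^ (N%:R - theta * (1 + s)))%:E)%E.
Proof.
move=> th02 p1 sE sl; have p10 : 0 < p - 1 by rewrite subr_gt0.
have s0 : 0 < s by rewrite sE invr_gt0.
have [C1 C10 HC1] := @adjoint_cutoff_le R N theta l.+1 th02.
(* Young's inequality is used with [e = 1/2]; [4 ^+ N * 2] comes from the volume [(4r)^N * 2T] of a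
   cylinder containing the support, and the outer 2 compensates for the half of the [u^p] integral
   that is absorbed. *)
pose C := 2 * (2^-1 `^ (- s) * C1 `^ (1 + s) * 4 ^+ N * 2).
have C0 : 0 < C by rewrite !mulr_gt0 ?powR_gt0 ?exprn_gt0 ?invr_gt0.
exists C => // mu u [u0 mu_ sol] r T r0 rT.
have T0 : 0 < T by apply: lt_le_trans rT; rewrite powR_gt0.
have [i1 i2 i3 e] := sol _ (cutoff_test_function l.+1 r0 T0).
pose X := \int[lambda]_(z in (D : set ctype)) (u z `^ p * cutoff r T z ^+ l.+2).
pose Y := \int[(mu \x leb)%E]_(z in (D : set ('rV[R]_N * measurableTypeR R)))
  (cutoff r T z ^+ l.+2).
have {}e : \int[lambda]_(z in (D : set ctype)) (u z * adjoint_operator theta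
      (fun z => cutoff r T z ^+ l.+2) z) = X + Y by exact: e.
have [ic ec] := @integral_cylinder R N (2 * r) (2 * T)
  (mulr_ge0 (ler0n _ 2) (ltW r0)) (mulr_ge0 (ler0n _ 2) (ltW T0)).
have mD : measurable (D : set ctype) := measurable_ctype measurable_space_time.
pose K := 2^-1 `^ (- s) * (C1 * r `^ (- theta)) `^ (1 + s).
have K0 : 0 <= K by rewrite mulr_ge0 ?powR_ge0.
have kr0 : 0 <= C1 * r `^ (- theta) by rewrite mulr_ge0 ?powR_ge0// ltW.
have le : Rintegral lambda (D : set ctype) (fun z => u z * adjoint_operator theta
      (fun z => cutoff r T z ^+ l.+2) z) <= 2^-1 * X + K * ((2 * (2 * r)) ^+ N * (2 * T)).
  apply: (@le_trans _ _ (\int[lambda]_(z in (D : set ctype))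
    (2^-1 * (u z `^ p * cutoff r T z ^+ l.+2) + K * (\1_(cylinder (2 * r) (2 * T)) z : R)))).
    apply: le_Rintegral => //.
      by apply: integrableRD => //; apply: integrableRZ.
    move=> z Dz; have uz := u0 _ Dz.
    apply: (@le_trans _ _ (u z * (C1 * r `^ (- theta) * cutoff r T z ^+ l.+1))).
      by rewrite ler_wpM2l// HC1.
    (* Where the cutoff vanishes the left side is 0; elsewhere the indicator equals 1. *)
    have [c0|c0] := eqVneq (cutoff r T z) 0.
      by rewrite c0 !expr0n/= !mulr0 add0r mulr_ge0// indicE.
    have [z1 z2] := cutoff_support r0 T0 c0.
    rewrite indicE mem_set; last first.
      by split => //=; rewrite in_itv/= (ltW Dz.1)/= (le_trans (ler_norm _) z2).
    rewrite mulr1; apply: young_power => //; rewrite ?invr_gt0//.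
    by rewrite cutoff_ge0 cutoff_le1.
  rewrite RintegralD//; [|exact: integrableRZ|exact: integrableRZ].
  rewrite !RintegralZl// lerD2l ler_wpM2l//.
have X0 : 0 <= X by apply: Rintegral_ge0 => z _; rewrite mulr_ge0 ?powR_ge0 ?exprn_ge0 ?cutoff_ge0.
have Y0 : 0 <= Y by apply: Rintegral_ge0 => z _; rewrite exprn_ge0 ?cutoff_ge0.
have KE : K * ((2 * (2 * r)) ^+ N * (2 * T)) = 2^-1 * (C * r `^ (N%:R - theta * (1 + s)) * T).
  rewrite powRD_gt0// powR_mulrn ?ltW// /K powRM ?powR_ge0 ?ltW// -powRrM /C.
  have -> : 2 * (2 * r) = 4 * r by ring.
  by rewrite exprMn mulNr; field.
(* From [X + Y <= X/2 + Z/2] with [X, Y >= 0], both [X] and [Y] are at most [Z]. *)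
have [XC YC] : X <= C * r `^ (N%:R - theta * (1 + s)) * T /\
    Y <= C * r `^ (N%:R - theta * (1 + s)) * T.
  move: le; rewrite e KE; move: (X) (Y) (C * _ * T) X0 Y0; clear.
  by move=> x y z x0 y0 h; split; lra.
split; first exact: XC.
have := source_ge r0 T0 i3; rewrite -/Y => h.
have {h} : ((bump_floor l * T)%:E * mu (cube (- r) r) <=
    (C * r `^ (N%:R - theta * (1 + s)) * T)%:E)%E.
  by apply: le_trans h _; rewrite lee_fin.
rewrite (mulrC (bump_floor l)) (mulrC _ T) (EFinM T (bump_floor l)) (EFinM T) -muleA.
by rewrite lee_pmul2l// lte_fin.
Qed.

End estimates.

Lemma Rintegral_sum d (T : measurableType d) (R : realType) (m : {measure set T -> \bar R})
    (D : set T) (f : nat -> T -> R) n : measurable D ->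
  (forall k, (k < n)%N -> m.-integrable D (EFin \o f k)) ->
  m.-integrable D (EFin \o (fun z => \sum_(k < n) f k z)) /\
  \int[m]_(z in D) (\sum_(k < n) f k z) = \sum_(k < n) \int[m]_(z in D) f k z.
Proof.
move=> mD; elim: n => [|n IH] fi.
  have -> : (fun z => \sum_(k < 0) f k z) = (fun=> 0) by apply/funext => z; rewrite big_ord0.
  split; first exact: integrable0.
  by rewrite big_ord0 /Rintegral integral0.
have [|i e] := IH; first by move=> k kn; apply: fi; rewrite ltnS ltnW.
have -> : (fun z => \sum_(k < n.+1) f k z) = (fun z => \sum_(k < n) f k z + f n z).
  by apply/funext => z; rewrite big_ord_recr.
have fn := fi n (ltnSn n); split; first exact: integrableRD.
by rewrite RintegralD// e big_ord_recr.
Qed.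

(** * Summation over dyadic scales with a common time scale *)

Section dyadic.
Context {R : realType} {N : nat}.
Local Notation leb := (@lebesgue_measure R).
Local Notation lambda := (@Lebesgue_space_time R N).
Local Notation ctype :=
  (caratheodory_type ((@lebesgue_rV R N \x @lebesgue_measure R)%E^*)%mu).
Local Notation D := (@space_time R N +oo%E).
Implicit Types (mu : {measure set 'rV[R]_N -> \bar R}) (u : 'rV[R]_N * R -> R).

Lemma cube_subset n (a b c d : R) : c <= a -> b <= d -> @cube R n a b `<=` cube c d.
Proof.
move=> ca bd x h i; have /andP[h1 h2] := h i.
by rewrite (le_trans ca)// (le_trans h2).
Qed.

Lemma powR_expr (x c : R) k : 0 <= x -> (x ^+ k) `^ c = (x `^ c) ^+ k.
Proof.
by move=> x0; rewrite -(powR_mulrn k x0) -powRrM mulrC powRrM powR_mulrn ?powR_ge0.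
Qed.

Lemma powR_geometric (a c : R) k : 0 < a -> (a * 2 ^+ k) `^ c = a `^ c * (2 `^ c) ^+ k.
Proof.
by move=> a0; rewrite powRM ?exprn_ge0 ?(ltW a0)// powR_expr.
Qed.

Lemma exp2_le1 k : 1 <= 2 ^+ k :> R.
Proof. by rewrite exprn_ege1// ler1n. Qed.

(** Young's inequality is applied once to the whole sum rather than to each scale, so the [u^p] term
    appears once, with the cutoff of the largest scale, and the remainder is a power of a geometric
    sum. *)
Lemma dyadic_adjoint_le theta p s l C r n u z :
  (forall r T z, 0 < r -> r `^ theta <= T ->
    adjoint_operator theta (fun z : 'rV[R]_N * R => cutoff r T z ^+ l.+2) z <=
    C * r `^ (- theta) * cutoff r T z ^+ l.+1) ->
  0 < theta -> 0 < C -> 0 < r -> 1 < p -> s = (p - 1)^-1 -> s <= l.+1%:R ->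
  D z -> 0 <= u z -> forall e T, 0 < e -> T = (r * 2 ^+ n) `^ theta ->
  \sum_(k < n) (u z * adjoint_operator theta
      (fun z => cutoff (r * 2 ^+ k) T z ^+ l.+2) z) <=
  (e / @bump_floor R N l) * (u z `^ p * cutoff (r * 2 ^+ n) (2 * T) z ^+ l.+2) +
  (e `^ (- s) * C `^ (1 + s) * (1 - 2 `^ (- theta)) `^ (- (1 + s))) *
  \sum_(k < n) ((r * 2 ^+ k) `^ (- (theta * (1 + s))) *
    \1_(cylinder (2 * (r * 2 ^+ k)) (2 * T)) z).
Proof.
move=> HC th0 C0 r0 p1 sE sl Dz uz e T e0 TE.
have p10 : 0 < p - 1 by rewrite subr_gt0.
have s0 : 0 < s by rewrite sE invr_gt0.
have r_ k : 0 < r * 2 ^+ k by rewrite mulr_gt0 ?exprn_gt0.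
have T0 : 0 < T by rewrite TE powR_gt0.
have rT k : (k <= n)%N -> (r * 2 ^+ k) `^ theta <= T.
  move=> kn; rewrite TE; apply: ge0_ler_powR; rewrite ?nnegrE ?(ltW th0) ?(ltW (r_ _))//.
  by rewrite ler_pM2l// ler_weXn2l// ler1n.
pose q : R := 2 `^ (- theta).
have q01 : 0 <= q < 1.
  have -> : q = (2 `^ theta)^-1 by rewrite /q powRN.
  rewrite invr_ge0 powR_ge0/= invf_lt1 ?powR_gt0//.
  have {1}<- : 1 `^ theta = 1 :> R by rewrite powR1.
  by apply: gt0_ltr_powR; rewrite ?nnegrE// ltr1n.
pose b k := z \in cylinder (2 * (r * 2 ^+ k)) (2 * T).
have bS k : b k -> b k.+1.
  rewrite /b !inE => -[h1 h2]; split => //; apply: cube_subset h1.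
    by rewrite lerN2 ler_pM2l// ler_pM2l// ler_weXn2l// ler1n.
  by rewrite ler_pM2l// ler_pM2l// ler_weXn2l// ler1n.
(* Each cutoff is replaced by the indicator of a cylinder containing its support in positive time;
   [q^k] is the ratio of [r_k^(-theta)] to [r^(-theta)]. *)
pose w : R := C * r `^ (- theta) * \sum_(k < n) q ^+ k * (b k)%:R.
have K0 : 0 <= C * r `^ (- theta) by rewrite mulr_ge0 ?powR_ge0// ltW.
have w0 : 0 <= w.
  rewrite mulr_ge0// sumr_ge0// => k _.
  by rewrite mulr_ge0 ?exprn_ge0 ?powR_ge0.
have le1 : \sum_(k < n) (u z * adjoint_operator theta
    (fun z => cutoff (r * 2 ^+ k) T z ^+ l.+2) z) <= u z * w.
  rewrite -mulr_sumr ler_wpM2l// /w mulr_sumr ler_sum// => k _.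
  apply: le_trans (HC _ _ _ (r_ k) (rT _ (ltnW (ltn_ord k)))) _.
  rewrite powR_geometric// -/q -!mulrA ler_pM2l// ler_pM2l ?powR_gt0//.
  rewrite ler_pM2l ?exprn_gt0 ?powR_gt0//.
  have [c0|c0] := eqVneq (cutoff (r * 2 ^+ k) T z) 0.
    by rewrite c0 expr0n.
  have [z1 z2] := cutoff_support (r_ k) T0 c0.
  rewrite /b mem_set/= ?exprn_ile1 ?cutoff_ge0 ?cutoff_le1//.
  by split => //=; rewrite in_itv/= (ltW Dz.1)/= (le_trans (ler_norm _) z2).
apply: (le_trans le1).
have k0 := @bump_floor_gt0 R N l.
(* Taken with [Phi = 1], the cutoffs having been bounded by indicators. *)
have young := young_power uz w0 (_ : 0 <= 1 <= 1) e0 p1 sE sl.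
have {young} := young _; rewrite ler01 lexx !expr1n !mulr1 => /(_ isT) young.
have [w00|wn0] := eqVneq w 0.
  rewrite w00 mulr0; apply: addr_ge0; apply: mulr_ge0.
  - by rewrite divr_ge0 ?ltW.
  - by apply: mulr_ge0; rewrite ?powR_ge0 ?exprn_ge0 ?cutoff_ge0.
  - by rewrite !mulr_ge0 ?powR_ge0.
  - by apply: sumr_ge0 => k _; rewrite mulr_ge0 ?powR_ge0// indicE.
apply: (le_trans young); apply: lerD.
  rewrite -mulrA ler_pM2l// ler_pdivlMl//.
  rewrite mulrC ler_wpM2l ?powR_ge0//.
  (* Where [w] is nonzero, [z] lies in one of the cylinders. Since [k < n], [2 r 2^k <= r 2^n], so
     the cutoff of scale [r 2^n] and time [2T] is at least its floor there. *)
  have [k bk] : exists k : 'I_n, b k.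
    apply/existsP; apply: contraNT wn0; rewrite negb_exists => /forallP h.
    by rewrite /w big1 ?mulr0// => k _; rewrite (negbTE (h k)) mulr0.
  move: bk; rewrite /b inE => -[z1]; rewrite /= in_itv/= => /andP[z20 z2T].
  rewrite /bump_floor; apply: lerXn2r; rewrite ?nnegrE ?cutoff_ge0 ?exprn_ge0 ?expR_ge0//.
  have kn : 2 * (r * 2 ^+ k) <= r * 2 ^+ n.
    by rewrite mulrCA ler_pM2l// -exprS ler_weXn2l// ler1n.
  apply: cutoff_ge => //; first by rewrite mulr_gt0.
    by apply: cube_subset z1 => //; rewrite lerN2.
  by rewrite ger0_norm.
rewrite /w powRM//; last first.
  by rewrite sumr_ge0// => k _; rewrite mulr_ge0 ?exprn_ge0 ?powR_ge0.
rewrite powRM ?powR_ge0 ?(ltW C0)// -!mulrA.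
rewrite ler_pM2l ?powR_gt0// ler_pM2l ?powR_gt0//.
rewrite -powRrM mulNr.
apply: (@le_trans _ _ (r `^ (- (theta * (1 + s))) * ((1 - q) `^ (- (1 + s)) *
   \sum_(k < n) (q ^+ k) `^ (1 + s) * (b k)%:R))).
  by rewrite ler_pM2l ?powR_gt0// geometric_powR_sum// ltW.
rewrite mulrCA ler_wpM2l ?powR_ge0// mulr_sumr ler_sum// => k _.
have -> : (r * 2 ^+ k) `^ (- (theta * (1 + s))) =
    r `^ (- (theta * (1 + s))) * (q ^+ k) `^ (1 + s).
  by rewrite powR_geometric// -mulNr (powRrM 2) -/q powR_expr ?powR_ge0.
by rewrite indicE -/(b k) mulrA.
Qed.

(** The [n] sources give the left side times [T]. On the right, [energy_estimate] at the largest
    scale bounds the [u^p] term by a multiple of [e T], and each of the [n] cylinders contributes a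
    multiple of [e^(-s) T]; then [T] cancels. *)
Lemma dyadic_estimate theta p s l : 0 < theta <= 2 -> 1 < p -> s = (p - 1)^-1 ->
  s <= l.+1%:R -> N%:R <= theta * (1 + s) -> exists2 C, 0 < C &
  forall mu u, is_solution theta p mu +oo%E u -> forall r m n e, 1 <= r -> 0 <= m ->
  (m%:E <= mu (cube (- r) r))%E -> 0 < e ->
  n%:R * (@bump_floor R N l * m) <= C * (e + e `^ (- s) * n%:R).
Proof.
move=> th02 p1 sE sl Ncrit; have [th0 _] := andP th02.
have p10 : 0 < p - 1 by rewrite subr_gt0.
have s0 : 0 < s by rewrite sE invr_gt0.
have [C1 C10 HC1] := @adjoint_cutoff_le R N theta l.+1 th02.
have [C2 C20 HC2] := @energy_estimate R N theta p s l th02 p1 sE sl.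
have k0 := @bump_floor_gt0 R N l.
pose A := 2 * C2 / @bump_floor R N l.
pose B0 := C1 `^ (1 + s) * (1 - 2 `^ (- theta)) `^ (- (1 + s)).
pose B := B0 * (4 ^+ N * 2).
have A0 : 0 < A by rewrite divr_gt0// mulr_gt0.
have B00 : 0 <= B0 by rewrite mulr_ge0 ?powR_ge0.
have B_ge0 : 0 <= B by apply: mulr_ge0 => //; rewrite mulr_ge0 ?exprn_ge0.
exists (A + B); first exact: ltr_wpDr.
move=> mu u us r m n e r1 m0 hm e0; have [u0 mu_ sol] := us.
have r0 : 0 < r by apply: lt_le_trans r1.
have r_ k : 0 < r * 2 ^+ k by rewrite mulr_gt0 ?exprn_gt0.
have r_1 k : 1 <= r * 2 ^+ k by rewrite mulr_ege1 ?exp2_le1.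
pose T := (r * 2 ^+ n) `^ theta.
have T0 : 0 < T by rewrite powR_gt0.
have mD : measurable (D : set ctype) := measurable_ctype measurable_space_time.
pose f k := fun z : 'rV[R]_N * R =>
  u z * adjoint_operator theta (fun z => cutoff (r * 2 ^+ k) T z ^+ l.+2) z.
have fi k : lambda.-integrable (D : set ctype) (EFin \o (f k : ctype -> R)).
  by have [] := sol _ (cutoff_test_function l.+1 (r_ k) T0).
have fge k : (k < n)%N -> @bump_floor R N l * T * m <= \int[lambda]_(z in (D : set ctype)) f k z.
  move=> kn; have [i1 i2 i3 ->] := sol _ (cutoff_test_function l.+1 (r_ k) T0).
  (* The [u^p] part of the identity is nonnegative and is dropped. *)
  rewrite -[leLHS]add0r; apply: lerD.
    by apply: Rintegral_ge0 => z _; rewrite mulr_ge0 ?powR_ge0 ?exprn_ge0 ?cutoff_ge0.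
  rewrite -lee_fin; apply: le_trans (source_ge (r_ k) T0 i3).
  rewrite EFinM; apply: lee_wpmul2l; first by rewrite lee_fin mulr_ge0 ?ltW.
  apply: (le_trans hm); apply: le_measure; rewrite ?inE; try exact: measurable_cube.
  by apply: cube_subset; rewrite ?lerN2 ler_peMr ?exp2_le1 ?ltW.
have [iS eS] := @Rintegral_sum _ ctype R lambda D f n mD (fun k _ => fi k).
pose h k := fun z : 'rV[R]_N * R => (r * 2 ^+ k) `^ (- (theta * (1 + s))) *
  (\1_(cylinder (2 * (r * 2 ^+ k)) (2 * T)) z : R).
have hh k : lambda.-integrable (D : set ctype) (EFin \o (h k : ctype -> R)) /\
    \int[lambda]_(z in (D : set ctype)) h k z <= 4 ^+ N * 2 * T.
  have [ic ec] := @integral_cylinder R N (2 * (r * 2 ^+ k)) (2 * T)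
    (mulr_ge0 (ler0n _ 2) (ltW (r_ k))) (mulr_ge0 (ler0n _ 2) (ltW T0)).
  split; first exact: integrableRZ.
  rewrite /h RintegralZl//; apply: le_trans (ler_wpM2l (powR_ge0 _ _) ec) _.
  have -> : 2 * (2 * (r * 2 ^+ k)) = 4 * (r * 2 ^+ k) by ring.
  rewrite exprMn mulrCA -[leRHS]mulrA -mulrA ler_pM2l ?exprn_gt0//.
  rewrite mulrA ler_piMl ?mulr_ge0 ?(ltW T0)//.
  (* The exponent of [r 2^k] is [N - theta (1 + s) <= 0] and the base is at least 1, so every scale
     has the same bound. *)
  rewrite -(powR_mulrn N (ltW (r_ k))) -powRD_gt0//.
  apply: (@le_trans _ _ ((r * 2 ^+ k) `^ 0)); last by rewrite powRr0.
  by apply: ler_powR; rewrite ?subr_le0.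
have [iH eH] := @Rintegral_sum _ ctype R lambda D h n mD (fun k _ => (hh k).1).
(* Time [2 * T] here, because the cylinders of all scales reach up to [2 * T]. *)
have RT : (r * 2 ^+ n) `^ theta <= 2 * T by rewrite -/T ler_peMl ?ler1n ?ltW.
have [HX _] := HC2 mu u us _ _ (r_ n) RT.
have [_ i2 _ _] := sol _ (cutoff_test_function l.+1 (r_ n) (mulr_gt0 (ltr0n _ 2) T0)).
have main : n%:R * (@bump_floor R N l * T * m) <=
    e / @bump_floor R N l * (C2 * 1 * (2 * T)) + e `^ (- s) * B0 * (n%:R * (4 ^+ N * 2 * T)).
  apply: (@le_trans _ _ (\sum_(k < n) \int[lambda]_(z in (D : set ctype)) f k z)).
    rewrite mulr_natl -[X in _ *+ X]card_ord -sumr_const.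
    by apply: ler_sum => k _; exact: fge.
  rewrite -eS; apply: (@le_trans _ _ (\int[lambda]_(z in (D : set ctype))
      (e / @bump_floor R N l * (u z `^ p * cutoff (r * 2 ^+ n) (2 * T) z ^+ l.+2) +
       e `^ (- s) * B0 * \sum_(k < n) h k z))).
    apply: le_Rintegral => //.
      by apply: integrableRD => //; apply: integrableRZ.
    move=> z Dz; rewrite /B0 mulrA.
    exact: (dyadic_adjoint_le HC1 th0 C10 r0 p1 sE sl Dz (u0 _ Dz) e0 (erefl T)).
  rewrite RintegralD//; [|exact: integrableRZ|exact: integrableRZ].
  rewrite !RintegralZl//; apply: lerD; apply: ler_wpM2l.
  - by rewrite divr_ge0 ?ltW.
  - apply: (le_trans HX); apply: ler_wpM2r; first by rewrite mulr_ge0 ?ltW.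
    apply: ler_wpM2l; first exact: ltW.
    apply: (@le_trans _ _ ((r * 2 ^+ n) `^ 0)); last by rewrite powRr0.
    by apply: ler_powR; rewrite ?subr_le0.
  - by rewrite mulr_ge0 ?powR_ge0.
  - rewrite eH mulr_natl -[X in _ *+ X]card_ord -sumr_const.
    by apply: ler_sum => k _; exact: (hh k).2.
rewrite -(ler_pM2l T0).
apply: (@le_trans _ _ (T * (A * e + B * (e `^ (- s) * n%:R)))).
  apply: (@le_trans _ _ (n%:R * (@bump_floor R N l * T * m))).
    by rewrite le_eqVlt; apply/orP; left; apply/eqP; ring.
  by apply: (le_trans main); rewrite /A /B le_eqVlt; apply/orP; left; apply/eqP; ring.
rewrite ler_pM2l// mulrDl; apply: lerD.
- by rewrite ler_pM2l// lerDl mulr_ge0 ?powR_ge0.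
- by rewrite ler_wpM2l// lerDr ltW.
Qed.

End dyadic.

(** * Contradictions in the two ranges of the exponent *)

Section nonexistence.
Context {R : realType} {N : nat}.
Implicit Types (mu : {measure set 'rV[R]_N -> \bar R}) (u : 'rV[R]_N * R -> R).

(** If all cubes of integer half-side [k+1] were null, so would be their union, the whole space. *)
Lemma cube_measure_gt0 mu (A : set 'rV[R]_N) : measurable A -> mu A <> 0%E ->
  exists2 r : R, 1 <= r & (0 < mu (cube (- r) r))%E.
Proof.
move=> mA A0; apply: contrapT => h; apply: A0.
have neg k : mu.-negligible (cube (- k.+1%:R) k.+1%:R : set 'rV[R]_N).
  apply/negligibleP; first exact: measurable_cube.
  apply/eqP; rewrite eq_le measure_ge0 andbT leNgt; apply/negP => k0; apply: h.
  by exists k.+1%:R => //; rewrite ler1n.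
apply/negligibleP => //; apply: negligibleS (negligible_bigcup neg) => x _.
pose y : R := \sum_i `|x ord0 i|.
have y0 : 0 <= y by apply: sumr_ge0.
exists (Num.bound y) => // i; rewrite -ler_norml.
apply: (@le_trans _ _ y); first by rewrite /y (bigD1 i)//= lerDl sumr_ge0.
by rewrite (le_trans (ltW (archi_boundP y0)))// ler_nat.
Qed.

Lemma critical_nonexistence theta p s l mu : 0 < theta <= 2 -> 1 < p -> s = (p - 1)^-1 ->
  s <= l.+1%:R -> N%:R <= theta * (1 + s) ->
  (exists2 A : set 'rV[R]_N, measurable A & mu A <> 0%E) ->
  ~ has_global_solution theta p mu.
Proof.
move=> th02 p1 sE sl Ncrit [A mA A0] [u us].
have s0 : 0 < s by rewrite sE invr_gt0 subr_gt0.
have k0 := @bump_floor_gt0 R N l.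
have [r r1 mr] := cube_measure_gt0 mA A0.
have r0 : 0 < r by apply: lt_le_trans r1.
have [C1 C10 /(_ mu u us r _ r0 (lexx _))[_ HC1]] := @energy_estimate R N theta p s l th02 p1 sE sl.
have [C C0 /(_ mu u us r)HC] := @dyadic_estimate R N theta p s l th02 p1 sE sl Ncrit.
(* The single-scale bound rules out infinite mass, so the mass can be treated as a real number. *)
have mfin : mu (cube (- r) r) \is a fin_num.
  rewrite ge0_fin_numE//; rewrite ltNge leye_eq; apply/negP => /eqP moo.
  by move: HC1; rewrite moo mulry gtr0_sg// mul1e leye_eq.
pose m := fine (mu (cube (- r) r)).
have m0 : 0 < m by rewrite fine_gt0// mr/= ltey_eq mfin.
have {HC} : forall n e, 0 < e -> n%:R * (@bump_floor R N l * m) <= C * (e + e `^ (- s) * n%:R).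
  by move=> n e e0; apply: HC => //; [exact: ltW|rewrite fineK].
move: (mulr_gt0 k0 m0); move: (_ * m) => a a0 HC.
(* With [C e^(-s) = a/2] the estimate reads [n a <= C e + n a / 2], which fails as soon as
   [n > 2 C e / a]. *)
pose e := (2 * C / a) `^ s^-1.
have e0 : 0 < e by rewrite powR_gt0// divr_gt0// mulr_gt0.
have eE : C * e `^ (- s) = a / 2.
  rewrite /e -powRrM mulrN mulVf ?gt_eqF// powR_inv1; last by rewrite divr_ge0 ?mulr_ge0 ?ltW.
  by field; rewrite !gt_eqF.
pose n := Num.bound (2 * C * e / a).
have nE : 2 * C * e / a < n%:R.
  by apply: archi_boundP; rewrite divr_ge0 ?ltW// !mulr_gt0.
have := HC n e e0; rewrite mulrDr (mulrA C) eE => h.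
move: nE; rewrite ltr_pdivrMr// => nE; lra.
Qed.

Lemma enorm_le (r : R) (x : 'rV[R]_N) : 0 <= r -> cube (- r) r x -> enorm x <= N%:R * r.
Proof.
move=> r0 xr; rewrite -[leRHS]ger0_norm ?mulr_ge0// -sqrtr_sqr ler_sqrt ?sqr_ge0//.
apply: (@le_trans _ _ (\sum_(i < N) r ^+ 2)).
  apply: ler_sum => i _; rewrite -expr2 -real_normK ?num_real//.
  by apply: lerXn2r; rewrite ?nnegrE ?ler_norml//; exact: xr.
have -> : \sum_(i < N) r ^+ 2 = N%:R * r ^+ 2 by rewrite sumr_const card_ord mulr_natl.
rewrite exprMn; apply: ler_wpM2r; first exact: sqr_ge0.
by rewrite -natrX ler_nat; case: (N) => // k; rewrite leq_pmull.
Qed.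

Lemma enorm_ge (x : 'rV[R]_N) i : `|x ord0 i| <= enorm x.
Proof.
rewrite -sqrtr_sqr ler_sqrt ?dotrV_ge0// /dotrV (bigD1 i)//= expr2 lerDl.
by apply: sumr_ge0 => j _; rewrite -expr2 sqr_ge0.
Qed.

Lemma measurable_rV_ctype (A : set 'rV[R]_N) : measurable A ->
  measurable (A : set (caratheodory_type ((@lebesgue_rV R N)^*)%mu)).
Proof. by move=> mA; apply: sub_caratheodory; exact: sub_sigma_algebra. Qed.

(** Integrate over the corner [[r/2, r]^N], of volume [(r/2)^N]: each coordinate is at least
    [r/2 >= r0], so it avoids the ball, and the crude bound [enorm x <= N r] gives the smallest
    value of the decreasing power. *)
Lemma density_cube_ge (c a r0 r : R) f mu : (0 < N)%N -> has_density f mu -> 0 <= c -> 0 <= a ->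
  0 < r0 -> 2 * r0 <= r ->
  {ae @Lebesgue_rV R N, forall x : 'rV[R]_N, ~ enorm x < r0 -> c * enorm x `^ (- a) <= f x} ->
  ((c * (N%:R * r) `^ (- a) * (r / 2) ^+ N)%:E <= mu (cube (- r) r))%E.
Proof.
move=> N0 [f0 mf muE] c0 a0 r00 r0r ae.
have r_gt0 : 0 < r by apply: lt_le_trans r0r; rewrite mulr_gt0.
pose A : set 'rV[R]_N := cube (r / 2) r.
have mA : measurable A by exact: measurable_cube.
have mA' := measurable_rV_ctype mA.
apply: (@le_trans _ _ (mu A)); last first.
  apply: le_measure; rewrite ?inE//; first exact: measurable_cube.
  by apply: cube_subset => //; apply: (@le_trans _ _ 0); rewrite ?oppr_le0 ?divr_ge0 ?ltW.
have LA : @Lebesgue_rV R N A = ((r / 2) ^+ N)%:E.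
  have rr : r / 2 <= r by lra.
  have e : @Lebesgue_rV R N A = @lebesgue_rV R N A by exact: measurable_mu_extE.
  rewrite e (_ : r / 2 = r - r / 2); last by field.
  exact: lebesgue_rV_cube.
rewrite muE// EFinM -LA -integral_cst//.
apply: (ae_ge0_le_integral mA').
- by move=> x _; rewrite lee_fin mulr_ge0 ?powR_ge0.
- exact: measurable_cst.
- by move=> x _; rewrite lee_fin.
- by apply/measurable_EFinP; apply: measurable_funS mf.
apply: (negligibleS _ ae); apply: subsetC => x /= h Ax; rewrite lee_fin.
have xr : r0 <= enorm x.
  have i : 'I_N by exact: Ordinal N0.
  apply: le_trans (enorm_ge x i); have /andP[h1 _] := Ax i.
  by apply: le_trans (ler_norm _); apply: le_trans h1; lra.
apply: le_trans (h _); last by rewrite ltNge xr.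
apply: ler_wpM2l => //; rewrite !powRN lef_pV2 ?posrE ?powR_gt0//; last 2 first.
- by rewrite mulr_gt0// ltr0n.
- exact: lt_le_trans xr.
apply: ge0_ler_powR => //; rewrite ?nnegrE ?sqrtr_ge0//.
  by rewrite mulr_ge0// ltW.
apply: enorm_le; first exact: ltW.
by apply: cube_subset Ax => //; apply: (@le_trans _ _ 0); rewrite ?oppr_le0 ?divr_ge0 ?ltW.
Qed.

(** The lower bound from the density and the upper bound from the energy estimate both scale as
    [r^(N - theta (1 + s))], so the comparison is between constants, none of which depends on [f],
    [mu] or [r0]. *)
Lemma supercritical_nonexistence theta p s l : (0 < N)%N -> 0 < theta <= 2 -> 1 < p ->
  s = (p - 1)^-1 -> s <= l.+1%:R -> exists2 c : R, 0 < c & forall f mu r0,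
  has_density f mu -> 0 < r0 ->
  {ae @Lebesgue_rV R N, forall x : 'rV[R]_N, ~ enorm x < r0 ->
    c * enorm x `^ (- (theta * (1 + s))) <= f x} ->
  ~ has_global_solution theta p mu.
Proof.
move=> N0 th02 p1 sE sl; have [th0 _] := andP th02.
have s0 : 0 < s by rewrite sE invr_gt0 subr_gt0.
have k0 := @bump_floor_gt0 R N l.
have [C C0 HC] := @energy_estimate R N theta p s l th02 p1 sE sl.
have NR0 : 0 < N%:R :> R by rewrite ltr0n.
pose a := theta * (1 + s); have a0 : 0 <= a by rewrite mulr_ge0 ?addr_ge0 ?ltW.
(* The quotient is the value at which the two bounds coincide; the [+ 1] exceeds it. *)
pose c := C * 2 ^+ N * N%:R `^ a / @bump_floor R N l + 1.
have c0 : 0 < c.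
  by rewrite ltr_wpDl// divr_ge0 ?(ltW k0)// !mulr_ge0 ?powR_ge0 ?exprn_ge0// ltW.
exists c => // f mu r0 fmu r00 ae [u us].
(* The smallest scale at which the corner cube [[r/2, r]^N] satisfies the condition of
   [density_cube_ge]. *)
pose r := 2 * r0; have r_gt0 : 0 < r by rewrite mulr_gt0.
have [_ h1] := HC mu u us r _ r_gt0 (lexx _).
have h2 := density_cube_ge N0 fmu (ltW c0) a0 r00 (lexx _) ae.
have : ((@bump_floor R N l)%:E * (c * (N%:R * r) `^ (- a) * (r / 2) ^+ N)%:E <=
    (C * r `^ (N%:R - a))%:E)%E.
  by apply: le_trans h1; apply: lee_wpmul2l => //; rewrite lee_fin ltW.
rewrite -EFinM lee_fin powRM ?(ltW NR0) ?(ltW r_gt0)// powRD_gt0// powR_mulrn ?(ltW r_gt0)//.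
rewrite powRN expr_div_n.
have -> : @bump_floor R N l * (c * ((N%:R `^ a)^-1 * r `^ (- a)) * (r ^+ N / 2 ^+ N)) =
  (@bump_floor R N l * c / (N%:R `^ a * 2 ^+ N)) * (r ^+ N * r `^ (- a)).
  by field; rewrite !gt_eqF ?powR_gt0 ?exprn_gt0.
rewrite ler_pM2r ?mulr_gt0 ?exprn_gt0 ?powR_gt0//.
rewrite ler_pdivrMr ?mulr_gt0 ?exprn_gt0 ?powR_gt0// /c mulrDr mulr1.
have -> : @bump_floor R N l * (C * 2 ^+ N * N%:R `^ a / @bump_floor R N l) =
  C * (N%:R `^ a * 2 ^+ N) by field; rewrite gt_eqF.
by rewrite gerDl leNgt k0.
Qed.

End nonexistence.

(** For [theta < N] clear denominators in [p <= N / (N - theta)]. For [N <= theta] both sides hold,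
    since [1 + (p - 1)^-1 > 1]. *)
Lemma le_p_starE (R : realType) (N : nat) (theta p : R) : 0 < theta -> 1 < p ->
  (p%:E <= p_star N theta)%E = (N%:R <= theta * (1 + (p - 1)^-1)).
Proof.
move=> th0 p1; have p10 : 0 < p - 1 by rewrite subr_gt0.
have -> : theta * (1 + (p - 1)^-1) = theta * p / (p - 1) by field; rewrite gt_eqF.
rewrite ler_pdivlMr// /p_star; case: ltP => thN.
  rewrite lee_fin ler_pdivlMr ?subr_gt0//; apply/idP/idP; nra.
rewrite leey; apply/esym; nra.
Qed.

Theorem corollary1p2 (R : realType) (N : nat) (theta : R)
  (hN : (1 <= N)%N) (htheta0 : 0 < theta) (htheta2 : theta <= 2) :
  (forall p : R, 1 < p -> (p%:E <= p_star N theta)%E ->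
    forall mu : {measure set 'rV[R]_N -> \bar R},
      radon_measure mu \/ (exists f : 'rV[R]_N -> R, has_density f mu) ->
      (exists2 A : set 'rV[R]_N, measurable A & mu A <> 0%E) ->
      ~ has_global_solution theta p mu)
  /\
  (forall p : R, (p_star N theta < p%:E)%E ->
    exists2 gamma : R, 0 < gamma &
      forall (f : 'rV[R]_N -> R) (mu : {measure set 'rV[R]_N -> \bar R}),
        has_density f mu ->
        (exists2 r : R, 0 < r &
          {ae @Lebesgue_rV R N, forall x : 'rV[R]_N,
            ~ enorm x < r ->
            gamma * enorm x `^ (- (theta * p / (p - 1))) <= f x}) ->
        ~ has_global_solution theta p mu).
Proof.
have th02 : 0 < theta <= 2 by rewrite htheta0.
(* Provides the power [l] with [s <= l+1] required by Young's inequality. *)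
have bound (p : R) : 1 < p -> (p - 1)^-1 <= (Num.bound (p - 1)^-1).+1%:R.
  move=> p1; have p0 : 0 <= (p - 1)^-1 by rewrite invr_ge0 subr_ge0 ltW.
  by rewrite (le_trans (ltW (archi_boundP p0)))// ler_nat.
split=> [p p1 pN mu _ mu0|p pN].
  apply: (critical_nonexistence th02 p1 erefl (bound p p1) _ mu0).
  by rewrite -le_p_starE.
(* When [theta < N] this follows from [p_star > 1]; otherwise [p_star] is infinite and [pN] is
   absurd. *)
have p1 : 1 < p.
  move: pN; rewrite /p_star; case: (ltP theta N%:R) => // thN; rewrite lte_fin.
  by apply: lt_trans; rewrite ltr_pdivlMr ?subr_gt0// mul1r gtrDl oppr_lt0.
have [c c0 Hc] := supercritical_nonexistence hN th02 p1 erefl (bound p p1).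
exists c => // f mu fmu [r r0 ae]; apply: (Hc f mu r fmu r0).
suff -> : theta * (1 + (p - 1)^-1) = theta * p / (p - 1) by [].
by field; rewrite subr_eq0 gt_eqF.
Qed.
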